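(* Let $(p_n)\subset(1,\infty)$ be such that $p_n\to 2$ as $n\to\infty$ and let $u_{p_n}$ be a $\mathcal C_{p_n}$-ground state solution of $(P_m)$ with $m=p_n$ for every $n\in\mathbb N$. Then $u_{p_n}\to u_2$ in $H^1(B)\cap C^{0,\beta}(\bar B)$ for every $\beta\in(0,1)$, where $u_2$ is the unique $\mathcal C_2$-ground state solution of $(P_m)$ with $m=2$.
   Context: $B$ is the open unit ball of $\mathbb R^N$, $N\ge 1$, and $\nu$ is the outer unit normal of $\partial B$. For $1<m<\infty$ and $q>m$ (the exponent $q$ may be Sobolev-supercritical), $(P_m)$ denotes the Neumann problem $$-\Delta_m u+u^{m-1}=u^{q-1}\ \text{ in } B,\qquad u>0 \text{ and } u \text{ radial in } B,\qquad \frac{\partial u}{\partial\nu}=0\ \text{ on }\partial B,$$ where $\Delta_m u=\mathrm{div}(|\nabla u|^{m-2}\nabla u)$. The exponent $q$ is fixed, the same for all values of $m$ under consideration, and the assumption $q>m$ is in force for each of them ($m=2$ and $m=p_n$). The convergence in the claim is that of the full sequence. For radial $u$ write $u(|x|)=u(x)$. The cone $\mathcal C_m$ is $$\mathcal C_m=\{u\in W^{1,m}_{\mathrm{rad}}(B): u\ge 0,\ u(r_1)\le u(r_2)\text{ for all }0<r_1\le r_2\le 1\},$$ where $W^{1,m}_{\mathrm{rad}}(B)$ is the space of radial functions in $W^{1,m}(B)$. Functions in $\mathcal C_m$ are bounded. Solutions of $(P_m)$ in $\mathcal C_m$ are understood in the weak sense; by standard elliptic regularity they belong to $C^{1,\alpha}(\bar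 B)$ for some $\alpha\in(0,1)$. Ground states. Let $s_0=s_0(m)=\left(\frac qm\right)^{\frac1{q-m}}+1$, let $\ell\in(m,m^* )$, where $m^*$ is the critical Sobolev exponent ($m^*=Nm/(N-m)$ if $m<N$, $m^*=+\infty$ otherwise), and set $$f_q(s)=\begin{cases}s^{q-1}& s\in[0,s_0],\\ s_0^{q-1}+\frac{q-1}{\ell-1}s_0^{q-\ell}(s^{\ell-1}-s_0^{\ell-1})& s>s_0,\end{cases}\qquad F_q(u)=\int_0^u f_q(s)\,ds.$$ Define $$I_m(u)=\int_B\left(\frac{|\nabla u|^m}{m}+\frac{|u|^m}{m}-F_q(u)\right)dx,$$ $$\mathcal N_m=\left\{u\in\mathcal C_m\setminus\{0\}:\ \int_B(|\nabla u|^m+|u|^m)\,dx=\int_B f_q(u)u\,dx\right\},\qquad c_m=\inf_{u\in\mathcal N_m}I_m(u).$$ A $\mathcal C_m$-ground state solution of $(P_m)$ is a solution $u\in\mathcal C_m$ of $(P_m)$ (hence $u\in\mathcal N_m$) such that $I_m(u)=c_m$. It is known that a $\mathcal C_m$-ground state solution exists for every $q>m$; in some cases it is the constant function $1$. The uniqueness of the $\mathcal C_2$-ground state solution is taken from the literature, where, as the authors recall, it has been proved for $m=2$ and $q$ sufficiently large. *)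

(* Defs.v *)
From HB Require Import structures.
Set Warnings "-notation-overridden,-ambiguous-paths,-notation-incompatible-prefix,-redundant-canonical-projection".
From mathcomp Require Import all_boot all_order all_algebra.
From mathcomp Require Import all_classical all_reals all_analysis.

Set Implicit Arguments.
Unset Strict Implicit.
Unset Printing Implicit Defensive.

Import Order.TTheory GRing.Theory Num.Theory.
Import numFieldNormedType.Exports.

Local Open Scope classical_set_scope.
Local Open Scope ring_scope.

(* 'rV[T]_n gets the product sigma-algebra (the sigma-algebra generated by the
   coordinates), exactly as the library does for n.-tuple T; for T = R it is the
   Borel sigma-algebra of R^n. *)
Definition measure_rV_display : measure_display -> measure_display.
Proof. exact. Qed.

Definition rV_coor (T : Type) n (i : 'I_n) (x : 'rV[T]_n) : T := x ord0 i.

Section measurable_rV.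
Context {d} {T : sigmaRingType d}.
Variable n : nat.

Let rV_set0 : g_sigma_preimage (@rV_coor T n) set0.
Proof. exact: sigma_algebra0. Qed.

Let rV_setC A :
  g_sigma_preimage (@rV_coor T n) A -> g_sigma_preimage (@rV_coor T n) (~` A).
Proof. exact: sigma_algebraC. Qed.

Let rV_bigcup (F : _^nat) : (forall i, g_sigma_preimage (@rV_coor T n) (F i)) ->
  g_sigma_preimage (@rV_coor T n) (\bigcup_i (F i)).
Proof. exact: sigma_algebra_bigcup. Qed.

HB.instance Definition _ := @isMeasurable.Build (measure_rV_display d)
  'rV[T]_n (g_sigma_preimage (@rV_coor T n)) rV_set0 rV_setC rV_bigcup.

End measurable_rV.

Section lebesgue_rV.
Context {R : realType}.

Lemma measurable_rV_coor n (i : 'I_n) :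
  measurable_fun [set: 'rV[R]_n] (rV_coor i).
Proof.
move=> _ Y mY; rewrite setTI; apply: sub_sigma_algebra => /=.
rewrite -bigcup_seq/=; exists i => /=; first by rewrite mem_index_enum.
by exists Y => //; rewrite setTI.
Qed.

Lemma measurable_fun_rV d (S : measurableType d) n (f : S -> 'rV[R]_n) :
  (forall i, measurable_fun [set: S] (rV_coor i \o f)) ->
  measurable_fun [set: S] f.
Proof.
move=> mf.
suff : g_sigma_preimage (fun i => rV_coor i \o f) `<=` measurable.
  by rewrite g_sigma_preimage_comp => sub _ A mA; apply: sub; exists A.
apply: smallest_sub; first exact: sigma_algebra_measurable.
rewrite -bigcup_seq; apply: bigcup_sub => i _ A [B mB <-].
exact: mf.
Qed.

Definition rV_cons n (z : R * 'rV[R]_n) : 'rV[R]_n.+1 :=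
  row_mx (const_mx z.1 : 'rV[R]_1) z.2.

Lemma rV_cons_ord0 n z : @rV_cons n z ord0 ord0 = z.1.
Proof.
by rewrite mxE; case: splitP => [j _|j //]; rewrite mxE.
Qed.

Lemma rV_cons_lift n z (i : 'I_n) : @rV_cons n z ord0 (lift ord0 i) = z.2 ord0 i.
Proof.
rewrite mxE; case: splitP => [[[] //]|j /= /eqP].
by rewrite /bump /= eqSS => /eqP/val_inj ->.
Qed.

Lemma measurable_rV_cons n : measurable_fun [set: R * 'rV[R]_n] (@rV_cons n).
Proof.
apply: measurable_fun_rV => i; have [j ->|->] := unliftP ord0 i.
  rewrite (_ : _ \o _ = rV_coor j \o snd); last first.
    by apply/funext => z /=; rewrite /rV_coor rV_cons_lift.
  by apply: measurableT_comp; [exact: measurable_rV_coor|].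
rewrite (_ : _ \o _ = fst) //.
by apply/funext => z /=; rewrite /rV_coor rV_cons_ord0.
Qed.

(* n-dimensional Lebesgue measure: the n-fold product of the one-dimensional one. *)
Fixpoint lebesgue_rV (n : nat) : {measure set 'rV[R]_n -> \bar R} :=
  match n with
  | 0%N => \d_(0 : 'rV[R]_0)
  | k.+1 => measure_function_pushforward__canonical__measure_function_Measure
              (lebesgue_measure \x^ lebesgue_rV k)%E (@measurable_rV_cons k)
  end.

Lemma lebesgue_rV_box n (A : 'I_n -> set R) : (forall i, measurable (A i)) ->
  lebesgue_rV n [set x | forall i, A i (x ord0 i)] =
  (\prod_(i < n) lebesgue_measure (A i))%E.
Proof.
elim: n A => [|n IH] A mA.
  rewrite big_ord0 /= /dirac indicE mem_set//.
  by move=> [].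
rewrite big_ord_recl.
pose B := [set x : 'rV[R]_n | forall i, A (lift ord0 i) (x ord0 i)].
have mB : measurable B.
  have -> : B = \big[setI/setT]_(i < n) (rV_coor i @^-1` A (lift ord0 i)).
    rewrite -bigcap_seq; apply/seteqP; split => [x h i _|x h i]; first exact: h.
    by apply: h; rewrite /= mem_index_enum.
  apply: bigsetI_measurable => i _; rewrite -[X in measurable X]setTI.
  exact: measurable_rV_coor.
transitivity ((lebesgue_measure \x^ lebesgue_rV n)%E (A ord0 `*` B)).
  rewrite /= /pushforward; congr product_measure2.
  apply/seteqP; split => [[a x] /= h|[a x] /= [h0 h] i].
    split; first by have := h ord0; rewrite rV_cons_ord0.
    by move=> i; have := h (lift ord0 i); rewrite rV_cons_lift.
  by have [k ->|->] := unliftP ord0 i; rewrite ?rV_cons_ord0 ?rV_cons_lift.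
rewrite product_measure2E; [|exact: mA|exact: mB].
by rewrite -(IH (fun i => A (lift ord0 i))).
Qed.

End lebesgue_rV.

Section sobolev.
Context {R : realType} {N : nat}.
Local Notation E := 'rV[R]_N.
Local Notation mu := (@lebesgue_rV R N).
Implicit Types (u v : E -> R) (g : E -> E) (w : R -> R).

Definition dotv (x y : E) : R := \sum_(i < N) x ord0 i * y ord0 i.

(* The library norm `|x| on row vectors is the sup norm. *)
Definition enorm (x : E) : R := Num.sqrt (dotv x x).

Definition oball : set E := [set x | enorm x < 1].
Definition cball : set E := [set x | enorm x <= 1].

Definition partial (i : 'I_N) u : E -> R := fun x => 'D_(delta_mx ord0 i) u x.

Definition smooth u : Prop :=
  forall (s : seq 'I_N) (x : E), differentiable (foldr partial u s) x.

(* C_c^oo(B) *)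
Definition test_function u : Prop :=
  let K := closure [set x | u x != 0] in
  [/\ smooth u, compact K & K `<=` oball].

Definition loc_integrable u : Prop :=
  forall K : set E, compact K -> K `<=` oball -> mu.-integrable K (EFin \o u).

Definition weak_gradient u g : Prop := forall i : 'I_N,
  loc_integrable (fun x => g x ord0 i) /\
  forall phi, test_function phi ->
    \int[mu]_(x in oball) (u x * partial i phi x) =
    - \int[mu]_(x in oball) (g x ord0 i * phi x).

(* The weak gradient, which is unique up to a null set of B; 0 if there is none. *)
Definition wgrad u : E -> E := xget (cst 0) [set g | weak_gradient u g].

Definition in_Lp (m : R) u : Prop := measurable_fun oball u /\
  (\int[mu]_(x in oball) (`|u x| `^ m)%:E < +oo)%E.

(* W^{1,m}(B), through Borel representatives: the notions below, from W1norm to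
   ground_state, do not distinguish Borel functions that agree a.e. on B. *)
Definition W1 (m : R) u : Prop := in_Lp m u /\
  exists g, weak_gradient u g /\ in_Lp m (enorm \o g).

Definition W1norm (m : R) u : R :=
  (\int[mu]_(x in oball) (enorm (wgrad u x) `^ m + `|u x| `^ m)) `^ m^-1.

Definition has_profile u w : Prop :=
  u = (fun x => w (enorm x)) %[ae mu in oball].

Definition W1rad (m : R) u : Prop := W1 m u /\ exists w, has_profile u w.

(* A radial Sobolev function has exactly one profile that is continuous on
   ]0, 1]; its values are the u(r) in the definition of the cone. *)
Definition in_cone (m : R) u : Prop := W1rad m u /\
  exists w, [/\ has_profile u w, {within `]0, 1], continuous w},
    forall r, 0 < r <= 1 -> 0 <= w r &
    forall r1 r2, 0 < r1 -> r1 <= r2 -> r2 <= 1 -> w r1 <= w r2].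

(* Weak solutions of (P_m) in the cone. The Neumann condition is the natural one:
   the test functions v need not vanish on the boundary. Where the gradient is 0
   the first summand is 0, also for m < 2, since 0 `^ r = 0 for r != 0. *)
Definition cone_solution (m q : R) u : Prop :=
  [/\ in_cone m u,
      (\forall x \ae mu, oball x -> 0 < u x) &
      forall v, W1 m v ->
        \int[mu]_(x in oball)
          (enorm (wgrad u x) `^ (m - 2) * dotv (wgrad u x) (wgrad v x)
           + u x `^ (m - 1) * v x) =
        \int[mu]_(x in oball) (u x `^ (q - 1) * v x)].

Definition s0 (m q : R) : R := (q / m) `^ (q - m)^-1 + 1.

Definition critical_exponent (m : R) : \bar R :=
  if m < N%:R then (N%:R * m / (N%:R - m))%:E else +oo%E.

(* The nonlinearity is only evaluated at s >= 0. *)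
Definition fq (m q l s : R) : R :=
  let t := s0 m q in
  if s <= t then s `^ (q - 1)
  else t `^ (q - 1)
       + (q - 1) / (l - 1) * t `^ (q - l) * (s `^ (l - 1) - t `^ (l - 1)).

Definition Fq (m q l u : R) : R :=
  \int[@lebesgue_measure R]_(s in `[0, u]) fq m q l s.

Definition energy (m q l : R) u : R :=
  \int[mu]_(x in oball)
    (enorm (wgrad u x) `^ m / m + `|u x| `^ m / m - Fq m q l (u x)).

Definition nehari (m q l : R) : set (E -> R) :=
  [set u | [/\ in_cone m u, ~ (u = cst 0 %[ae mu in oball]) &
    \int[mu]_(x in oball) (enorm (wgrad u x) `^ m + `|u x| `^ m) =
    \int[mu]_(x in oball) (fq m q l (u x) * u x)]].

Definition ground_level (m q l : R) : \bar R :=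
  ereal_inf [set (energy m q l u)%:E | u in nehari m q l].

Definition ground_state (m q l : R) u : Prop :=
  cone_solution m q u /\ (energy m q l u)%:E = ground_level m q l.

(* The norm of C^{0,b} of the closed ball, +oo outside that space. *)
Definition holder_norm (b : R) u : \bar R :=
  (ereal_sup [set `|u x|%:E | x in cball] +
   ereal_sup [set (`|u z.1 - u z.2| / enorm (z.1 - z.2) `^ b)%:E
             | z in [set z : E * E | [/\ cball z.1, cball z.2 & z.1 != z.2]]])%E.

End sobolev.

Arguments oball {R N}.
Arguments cball {R N}.
Arguments critical_exponent {R} N m.

(* Main.v *)
From HB Require Import structures.
Require Import Defs.
From mathcomp Require Import all_boot all_order all_algebra.
From mathcomp Require Import all_classical all_reals all_analysis.
From mathcomp Require Import measurable_realfun.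
From mathcomp Require Import lra ring.
Import Order.TTheory GRing.Theory Num.Theory.
Import numFieldNormedType.Exports.
Local Open Scope classical_set_scope.
Local Open Scope ring_scope.

(** The exponents p_n of the equations vary, but all solutions in the cone solve
    one and the same kind of ordinary differential equation, which bounds them and
    their derivatives uniformly.

    Structure of the solutions. A solution in the cone has a nondecreasing
    profile W(|x|). Put b = W^(m-1) - W^(q-1), the reaction term. Testing with the
    constant 1 shows that b(|x|) has integral 0 over the ball, and since b changes
    sign once, from plus to minus, its integral over every smaller ball is
    nonnegative. So the flux K(r) = r^(1-N) int_0^r s^(N-1) b(s) ds is nonnegative,
    and the equation should say that W' = K^(1/(m-1)). No regularity of u is known
    at first, so this is proved weakly: by the divergence theorem for radial
    fields ([divergence_radial]), the field K(|x|)^(1/(m-1)) x/|x| satisfies the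
    same weak equation as the gradient of u, and the strict monotonicity of
    x |-> |x|^(m-2) x forces the two to agree ([cone_solution_gradient]). The
    result is [cone_solution_profile]: W is C^1, W' = K^(1/(m-1)), and W(0) <= 1 <=
    W(1). As b <= 1, we get K(r) <= r; so 0 <= W' < 1 and W < 2, whatever m is.
    Because s0 > 2, the truncation in f_q is never active, and the energy of a
    solution is (1/m - 1/q) int W^q ([radial_profile_energy]).

    Passage to the limit. The profiles w_n of the u_n are 1-Lipschitz with values
    in [0, 2], so a subsequence converges pointwise ([lipschitz_subsequence]). All
    integrals pass to the limit by dominated convergence, so the limit W solves the
    equation with m = 2 ([radial_profile_limit]); it is positive because
    W(1) - W(0) = W'(x) <= x W(1) for some x < 1.

    The limit is a ground state. Let V be the profile of u_2. A multiple t_n V lies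
    on the Nehari set for p_n, and t_n -> 1. Comparison of energies gives
    int w_n^q <= t_n^q int V^q ([ground_state_le]), hence int W^q <= int V^q
    ([limit_mass_le]), which says that W has the least energy for m = 2. By
    uniqueness W = V. As this holds for every subsequence, the full sequence w_n
    converges to V ([profile_cvg]).

    Norms. The formula W' = K^(1/(m-1)) makes the derivatives converge pointwise as
    well ([slope_cvg]), and they are bounded by 1, so dominated convergence gives
    convergence in H^1. Pointwise convergence of Lipschitz functions on [0, 1] is
    uniform, and interpolation with the Lipschitz bound gives the Hoelder norms. *)

Set Implicit Arguments.
Unset Strict Implicit.
Unset Printing Implicit Defensive.

(** * Integrals and almost everywhere equality *)

Lemma cvg_cst_eq (R : realType) (u : nat -> R) (l c : R) :
  (forall k, u k = c) -> u @ \oo --> l -> l = c.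
Proof.
move=> uc ul; apply: (cvg_unique _ ul) => //.
by rewrite (_ : u = fun=> c); [exact: cvg_cst|apply/funext].
Qed.

Section ae_integral.
Context d (T : measurableType d) (R : realType).
Variable mu : {measure set T -> \bar R}.
Import HBNNSimple.

Let nnintegral (f : T -> \bar R) := ereal_sup [set sintegral mu h |
  h in [set h : {nnsfun T >-> R} | forall x, (h x)%:E <= f x]%E].

Let le_nnintegral_ae (f g : T -> \bar R) (Z : set T) :
  measurable Z -> mu Z = 0%E -> (forall x, ~ Z x -> f x = g x) ->
  (forall x, 0 <= g x)%E ->
  (nnintegral f <= nnintegral g)%E.
Proof.
move=> mZ Z0 fg g0; apply: ge_ereal_sup => _ [h hf <-].
pose h' : {nnsfun T >-> R} := proj_nnsfun h (measurableC mZ).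
have -> : sintegral mu h = sintegral mu h'.
  rewrite -!integralT_nnsfun.
  apply: ge0_ae_eq_integral => //.
  - exact/measurable_EFinP.
  - exact/measurable_EFinP.
  - by move=> x _; rewrite lee_fin.
  - by move=> x _; rewrite lee_fin.
  exists Z; split=> // x /= hx; apply: contrapT => nZ; apply: hx => _.
  by rewrite /h'/= /mindic indicE mem_set// mulr1.
apply: ereal_sup_ubound; exists h' => // x.
rewrite /h'/= /mindic indicE.
have [/set_mem nZ|nZ] := boolP (x \in ~` Z).
  by rewrite mulr1 -fg.
by rewrite mulr0.
Qed.

(** The integral of an arbitrary function, measurable or not, is a supremum
    over simple functions, and a null set can be removed from these: so it does
    not distinguish functions that agree almost everywhere. *)
Lemma ae_integral (D : set T) (f g : T -> \bar R) :
  {ae mu, forall x, D x -> f x = g x} ->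
  (\int[mu]_(x in D) f x = \int[mu]_(x in D) g x)%E.
Proof.
move=> [Z [mZ Z0 sZ]].
have fg x : ~ Z x -> (f \_ D) x = (g \_ D) x.
  move=> nZx; rewrite !patchE; case: ifPn => // /set_mem Dx.
  by apply: contrapT => nfg; apply: nZx; apply: sZ => /= /(_ Dx).
have aux (a b : T -> \bar R) : (forall x, ~ Z x -> a x = b x) ->
    (forall x, 0 <= a x)%E -> (forall x, 0 <= b x)%E ->
    (\int[mu]_x a x = \int[mu]_x b x)%E.
  move=> ab a0 b0; rewrite ge0_integralTE// [RHS]ge0_integralTE//.
  apply/eqP; rewrite eq_le; apply/andP; split.
    exact: (le_nnintegral_ae mZ Z0).
  by apply: (le_nnintegral_ae mZ Z0) => // x nZ; rewrite ab.
rewrite integral_mkcond [RHS]integral_mkcond integralE [RHS]integralE.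
by congr (_ - _)%E; apply: aux => // x nZ; rewrite ?funeposE ?funenegE fg.
Qed.

Lemma ae_Rintegral (D : set T) (f g : T -> R) :
  {ae mu, forall x, D x -> f x = g x} ->
  \int[mu]_(x in D) f x = \int[mu]_(x in D) g x.
Proof.
move=> fg; rewrite /Rintegral.
have h : {ae mu, forall x, D x -> (f x)%:E = (g x)%:E}.
  by apply: filterS fg => x fgx Dx; rewrite fgx.
by rewrite (ae_integral h).
Qed.

Lemma integrable_bounded (D : set T) (f : T -> R) (C : R) :
  measurable D -> (mu D < +oo)%E -> measurable_fun D f ->
  (forall x, D x -> `|f x| <= C) -> mu.-integrable D (EFin \o f).
Proof.
move=> mD Doo mf fC; apply: measurable_bounded_integrable => //.
exists C; split; first exact: num_real.
by move=> r Cr x Dx /=; rewrite (le_trans (fC x Dx))// ltW.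
Qed.

Section real_integrable.
Variable D : set T.
Hypothesis mD : measurable D.
Implicit Types f g : T -> R.

Lemma Rintegrable_measurable f :
  mu.-integrable D (EFin \o f) -> measurable_fun D f.
Proof. by move=> fi; have /measurable_EFinP := measurable_int _ fi. Qed.

Lemma RintegrableD f g :
  mu.-integrable D (EFin \o f) -> mu.-integrable D (EFin \o g) ->
  mu.-integrable D (EFin \o (fun x => f x + g x)).
Proof. by move=> fi gi; have := integrableD mD fi gi. Qed.

Lemma RintegrableB f g :
  mu.-integrable D (EFin \o f) -> mu.-integrable D (EFin \o g) ->
  mu.-integrable D (EFin \o (fun x => f x - g x)).
Proof. by move=> fi gi; have := integrableB mD fi gi. Qed.

Lemma Rintegrable_le f g : measurable_fun D f ->
  (forall x, D x -> `|f x| <= g x) -> mu.-integrable D (EFin \o g) ->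
  mu.-integrable D (EFin \o f).
Proof.
move=> mf fg gi; apply: le_integrable gi => //; first exact/measurable_EFinP.
by move=> x Dx; rewrite /= lee_fin (le_trans (fg x Dx))// ler_norm.
Qed.

Lemma RintegrableZ f c :
  mu.-integrable D (EFin \o f) -> mu.-integrable D (EFin \o (fun x => c * f x)).
Proof. by move=> fi; have := integrableZl mD c fi. Qed.

Lemma Rintegrable_norm f :
  mu.-integrable D (EFin \o f) -> mu.-integrable D (EFin \o (fun x => `|f x|)).
Proof. by move=> fi; have := integrable_norm fi. Qed.

Lemma Rintegrable_mul_bounded f g C :
  mu.-integrable D (EFin \o f) -> measurable_fun D g ->
  (forall x, D x -> `|g x| <= C) ->
  mu.-integrable D (EFin \o (fun x => f x * g x)).
Proof.
move=> fi mg gC; apply: (@Rintegrable_le _ (fun x => C * `|f x|)).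
- by apply: measurable_funM => //; exact: Rintegrable_measurable.
- by move=> x Dx; rewrite normrM mulrC ler_wpM2r// gC.
- by apply: RintegrableZ; exact: Rintegrable_norm.
Qed.

Lemma Rintegrable_sum (I : Type) (r : seq I) (f : I -> T -> R) :
  (forall i, mu.-integrable D (EFin \o f i)) ->
  mu.-integrable D (EFin \o (fun x => \sum_(i <- r) f i x)).
Proof.
move=> fi; elim: r => [|i r IH].
  have -> : (fun x => \sum_(j <- [::]) f j x) = (fun=> 0).
    by apply/funext => x; rewrite big_nil.
  exact: integrable0.
have -> : (fun x => \sum_(j <- i :: r) f j x) =
    (fun x => f i x + \sum_(j <- r) f j x).
  by apply/funext => x; rewrite big_cons.
exact: RintegrableD (fi i) IH.
Qed.

Lemma Rintegral_sum (I : Type) (r : seq I) (f : I -> T -> R) :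
  (forall i, mu.-integrable D (EFin \o f i)) ->
  \int[mu]_(x in D) (\sum_(i <- r) f i x) = \sum_(i <- r) \int[mu]_(x in D) f i x.
Proof.
move=> fi; elim: r => [|i r IH].
  by rewrite big_nil; under eq_Rintegral do rewrite big_nil; rewrite Rintegral_cst ?mul0r.
rewrite big_cons -IH; have -> : (fun x => \sum_(j <- i :: r) f j x) =
    (fun x => f i x + \sum_(j <- r) f j x).
  by apply/funext => x; rewrite big_cons.
by rewrite RintegralD//; exact: Rintegrable_sum.
Qed.

End real_integrable.

Lemma Rintegral_cvg (D : set T) (f_ : nat -> T -> R) (f g : T -> R) :
  measurable D ->
  (forall n, measurable_fun D (f_ n)) -> measurable_fun D f ->
  mu.-integrable D (EFin \o g) ->
  {ae mu, forall x, D x -> f_ ^~ x @ \oo --> f x} ->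
  (forall n x, D x -> `|f_ n x| <= g x) ->
  \int[mu]_(x in D) f_ n x @[n --> \oo] --> \int[mu]_(x in D) f x.
Proof.
move=> mD mf_ mf ig ff fg.
have mf_E n : measurable_fun D (fun x => (f_ n x)%:E) by exact/measurable_EFinP.
have mfE : measurable_fun D (fun x => (f x)%:E) by exact/measurable_EFinP.
have ffE : {ae mu, forall x, D x -> (fun n => (f_ n x)%:E) @ \oo --> (f x)%:E}.
  apply: filterS ff => x h Dx; apply: cvg_EFin; first exact: nearW.
  exact: (h Dx).
have fgE : {ae mu, forall x n, D x -> (`|(f_ n x)%:E| <= (g x)%:E)%E}.
  by apply: aeW => x n Dx; rewrite /= lee_fin fg.
have [i1 _ i2] := @dominated_convergence _ _ _ mu D mD
    (fun n x => (f_ n x)%:E) (fun x => (f x)%:E) (fun x => (g x)%:E) mf_E mfE ffE ig fgE.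
apply: (@fine_cvg _ _ _ _ _ (\int[mu]_(x in D) f x)).
rewrite fineK; first exact: i2.
exact: integrable_fin_num i1.
Qed.

Lemma Rintegral_eq0_ae (D : set T) (f : T -> R) :
  measurable D -> mu.-integrable D (EFin \o f) ->
  (forall x, D x -> 0 <= f x) -> \int[mu]_(x in D) f x = 0 ->
  {ae mu, forall x, D x -> f x = 0}.
Proof.
move=> mD fi f0 If0.
have mf : measurable_fun D (EFin \o f) by exact: measurable_int fi.
have h := (ae_eq_integral_abs mu mD mf).1.
have : (\int[mu]_(x in D) `|(EFin \o f) x| = 0)%E.
  transitivity (\int[mu]_(x in D) (f x)%:E)%E.
    by apply: eq_integral => x /set_mem Dx; rewrite /= ger0_norm// f0.
  rewrite -[LHS]fineK//; last exact: integrable_fin_num.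
  by congr EFin.
move=> /h; apply: filterS => x hx Dx.
by have := hx Dx; rewrite /= => -[].
Qed.
End ae_integral.

(** * Lebesgue measure on R^N *)

Section measure_rV.
Context {R : realType}.
Implicit Types n : nat.

Lemma cvg_rV (X : Type) (F : set_system X) (FF : Filter F) n
    (f : X -> 'rV[R]_n) (a : 'rV[R]_n) :
  (forall i, f x ord0 i @[x --> F] --> a ord0 i) -> f x @[x --> F] --> a.
Proof.
move=> fa A [P Pa PA]; rewrite /=.
have : \forall x \near F, forall i, P ord0 i (f x ord0 i).
  by apply: filter_forall => i; apply: fa; exact: Pa.
apply: filterS => x h; apply: PA => i j.
by rewrite (ord1 i); exact: h.
Qed.

Lemma coor_continuous n (i : 'I_n) : continuous (fun x : 'rV[R]_n => x ord0 i).
Proof. exact: coord_continuous. Qed.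

Lemma measurable_rV_coorE n (i : 'I_n) :
  measurable_fun [set: 'rV[R]_n] (fun x : 'rV[R]_n => x ord0 i).
Proof. exact: measurable_rV_coor. Qed.

Lemma measurable_rV_box n (A : 'I_n -> set R) : (forall i, measurable (A i)) ->
  measurable [set x : 'rV[R]_n | forall i, A i (x ord0 i)].
Proof.
move=> mA.
have -> : [set x : 'rV[R]_n | forall i, A i (x ord0 i)] =
    \big[setI/setT]_(i < n) ((fun x : 'rV[R]_n => x ord0 i) @^-1` A i).
  rewrite -bigcap_seq; apply/seteqP; split => [x h i _|x h i]; first exact: h.
  by apply: h; rewrite /= mem_index_enum.
apply: bigsetI_measurable => i _; rewrite -[X in measurable X]setTI.
exact: measurable_rV_coorE.
Qed.

Lemma nbhs_rV_ball n (x : 'rV[R]_n) (U : set 'rV[R]_n) : nbhs x U ->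
  exists2 e : R, 0 < e & forall y : 'rV[R]_n,
    (forall i, `|x ord0 i - y ord0 i| < e) -> U y.
Proof.
move=> /nbhs_ballP[e /= e0 eU]; exists e => // y xy.
by apply: eU; split => // i j; rewrite (ord1 i); exact: xy.
Qed.

Lemma rational_box n (U : set 'rV[R]_n) (x : 'rV[R]_n) : open U -> U x ->
  exists (q : 'rV[rat]_n) (k : nat),
    (forall i, `|ratr (q ord0 i) - x ord0 i| < k.+1%:R^-1) /\
    (forall y : 'rV[R]_n,
      (forall i, `|ratr (q ord0 i) - y ord0 i| <= k.+1%:R^-1) -> U y).
Proof.
move=> oU Ux.
have [e e0 eU] := nbhs_rV_ball (open_nbhs_nbhs (conj oU Ux)).
have [k [a [aE a0 ke]]] :
    exists (k : nat) (a : R), [/\ k.+1%:R^-1 = a, 0 < a & a < e / 2].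
  have e20 : 0 < e / 2 by rewrite divr_gt0.
  have [k hk] := ltr_add_invr e20; exists k, k.+1%:R^-1.
  by split; rewrite ?invr_gt0//; move: hk; rewrite add0r.
have qex i : exists q : rat, `|(ratr q : R) - x ord0 i| < a.
  have lt : x ord0 i - a < x ord0 i + a by lra.
  have [q] := rat_in_itvoo lt.
  by rewrite in_itv/= => /andP[q1 q2]; exists q; rewrite ltr_norml; lra.
have [q hq] := choice qex.
exists (\row_i q i), k; rewrite aE; split => [i|y hy]; first by rewrite mxE.
apply: eU => i; have := hy i; have := hq i; rewrite mxE.
have : a + a < e by lra.
move=> h1 h2 h3; apply: lt_trans h1.
rewrite (_ : x ord0 i - y ord0 i =
  (ratr (q i) - y ord0 i) - (ratr (q i) - x ord0 i)); last by ring.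
by apply: (le_lt_trans (ler_normB _ _)); rewrite ler_ltD.
Qed.

(** The boxes with rational centre and rational side length form a countable
    base of the topology, so the coordinates generate the Borel sets. *)
Lemma open_measurable_rV n (U : set 'rV[R]_n) : open U -> measurable U.
Proof.
move=> oU.
pose bx (z : 'rV[rat]_n * nat) : set 'rV[R]_n :=
  [set y | forall i, ball (ratr (z.1 ord0 i) : R) (z.2.+1%:R^-1) (y ord0 i)].
pose V z : set 'rV[R]_n := if pselect (bx z `<=` U) then bx z else set0.
have -> : U = \bigcup_(z in [set: 'rV[rat]_n * nat]) V z.
  apply/seteqP; split => [x Ux|x [z _]]; last first.
    by rewrite /V; case: pselect => [sU|_]/= bx_x; [exact: sU|].
  have [q [k [qx qU]]] := rational_box oU Ux.
  exists (q, k) => //.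
  rewrite /V; case: pselect => [_ i|]; first exact: qx.
  by case=> y hy; apply: qU => i; exact/ltW/hy.
apply: countable_bigcupT_measurable => [|z]; first exact: countableP.
rewrite /V; case: pselect => [_|_]//=.
apply: (@measurable_rV_box n
  (fun i => ball (ratr (z.1 ord0 i) : R) (z.2.+1%:R^-1))) => i.
exact: measurable_ball.
Qed.

Lemma closed_measurable_rV n (U : set 'rV[R]_n) : closed U -> measurable U.
Proof.
by move=> cU; rewrite -(setCK U); apply: measurableC;
  apply: open_measurable_rV; exact: closed_openC.
Qed.

Lemma compact_measurable_rV n (K : set 'rV[R]_n) : compact K -> measurable K.
Proof.
move=> cK; apply: closed_measurable_rV; exact: compact_closed.
Qed.

Lemma continuous_measurable_rV n (f : 'rV[R]_n -> R) :
  continuous f -> measurable_fun setT f.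
Proof.
move=> cf; apply: (measurability _ (RGenOInfty.measurableE R)) => //.
move=> _ [_ [x ->] <-]; apply: open_measurable_rV; rewrite setTI.
rewrite preimage_itvoy; move/continuousP : cf => /(_ _ (@open_gt R x)).
exact.
Qed.

Local Notation mu := (@lebesgue_rV R).

Lemma measurable_rV_cube n (a b : 'I_n -> R) :
  measurable [set x : 'rV[R]_n | forall i, x ord0 i \in `[a i, b i]].
Proof.
by apply: (@measurable_rV_box n (fun i => [set` `[a i, b i]])) => i;
  exact: measurable_itv.
Qed.

Lemma lebesgue_rV_cube n (a b : 'I_n -> R) : (forall i, a i <= b i) ->
  mu n [set x | forall i, x ord0 i \in `[a i, b i]] =
  (\prod_(i < n) (b i - a i))%:E.
Proof.
move=> ab; rewrite (@lebesgue_rV_box R n (fun i => [set` `[a i, b i]])).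
  rewrite -prodEFin; apply: eq_bigr => i _.
  rewrite lebesgue_measure_itv/= lte_fin; case: ltP => [_|ba]; first by rewrite EFinB.
  have -> : b i = a i by apply/eqP; rewrite eq_le ba ab.
  by rewrite subrr.
by move=> i; exact: measurable_itv.
Qed.

Lemma lebesgue_rV_open_gt0 n (U : set 'rV[R]_n) : open U -> U !=set0 ->
  (0 < mu n U)%E.
Proof.
move=> oU [x Ux].
have [e e0 eU] := nbhs_rV_ball (open_nbhs_nbhs (conj oU Ux)).
pose a (i : 'I_n) := x ord0 i - e / 2; pose b (i : 'I_n) := x ord0 i + e / 2.
have ab i : a i <= b i by rewrite /a /b; lra.
apply: (@lt_le_trans _ _ (mu n [set y | forall i, y ord0 i \in `[a i, b i]])).
  rewrite lebesgue_rV_cube// lte_fin; apply: prodr_gt0 => i _.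
  by rewrite /a /b; lra.
apply: le_measure; rewrite ?inE.
- exact: measurable_rV_cube.
- exact: open_measurable_rV.
- move=> y hy; apply: eU => i; have := hy i; rewrite in_itv/= /a /b => /andP[h1 h2].
  by rewrite ltr_norml; lra.
Qed.

(** A separate name for the measure, to which an instance of sigma-finiteness can
    be attached, as Fubini's theorem requires. *)
Definition leb n : set 'rV[R]_n -> \bar R := mu n.

HB.instance Definition _ n := Measure.on (@leb n).

Let leb_sigma_finite n : sigma_finite setT (@leb n).
Proof.
exists (fun k => [set x : 'rV[R]_n | forall i, x ord0 i \in `[- (k%:R), k%:R]]).
  apply/seteqP; split => // x _.
  exists (Num.bound (\sum_i `|x ord0 i|)) => // i.
  have h : `|x ord0 i| <= (Num.bound (\sum_i `|x ord0 i|))%:R.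
    apply: le_trans (ltW (archi_boundP _)); last exact: sumr_ge0.
    by rewrite (bigD1 i)//= lerDl sumr_ge0.
  by rewrite in_itv/= -ler_norml.
move=> k; split; first exact: measurable_rV_cube.
rewrite /leb lebesgue_rV_cube ?ltry//.
by move=> i; rewrite lerNl (le_trans _ (ler0n _ _))// oppr_le0.
Qed.

HB.instance Definition _ n :=
  Measure_isSigmaFinite.Build _ _ _ (@leb n) (@leb_sigma_finite n).

Local Notation lam := (@lebesgue_measure R).

Let eq_prod n (f : R * 'rV[R]_n -> \bar R) :
  (\int[(lam \x^ mu n)%E]_z f z = \int[(lam \x @leb n)%E]_z f z)%E.
Proof.
apply: eq_measure_integral => A mA _; apply/esym.
apply: (product_measure_unique (m1 := lam) (m2 := @leb n)
  (m' := (lam \x^ @leb n)%E)) => // B C mB mC.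
by rewrite /= product_measure2E.
Qed.

Let integrable_cons n (f : 'rV[R]_n.+1 -> \bar R) :
  (mu n.+1).-integrable setT f ->
  (lam \x @leb n)%E.-integrable setT (f \o @rV_cons R n).
Proof.
move=> /integrableP[mf foo].
have mfc : measurable_fun setT (f \o @rV_cons R n).
  by apply: measurableT_comp => //; exact: measurable_rV_cons.
apply/integrableP; split => //.
rewrite -eq_prod; apply: le_lt_trans foo.
have maf : measurable_fun setT (abse \o f) by exact: measurableT_comp.
have af0 : {in setT, forall y, (0 <= (abse \o f) y)%E}.
  by move=> y _; exact: abse_ge0.
pose m : {measure set (measurableTypeR R * 'rV[R]_n) -> \bar R} :=
  (lam \x^ mu n)%E.
have mc : measurable_fun [set: measurableTypeR R * 'rV[R]_n] (@rV_cons R n).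
  exact: measurable_rV_cons.
have h := ge0_integral_pushforward mc m measurableT maf af0.
by rewrite -[leLHS]h.
Qed.

Let integral_cons n (f : 'rV[R]_n.+1 -> \bar R) :
  (mu n.+1).-integrable setT f ->
  (\int[mu n.+1]_x f x = \int[(lam \x @leb n)%E]_z (f \o @rV_cons R n) z)%E.
Proof.
move=> fi; have /integrableP[mfc] := integrable_cons fi.
have mf := measurable_int _ fi; rewrite -!eq_prod => foo.
pose m : {measure set (measurableTypeR R * 'rV[R]_n) -> \bar R} :=
  (lam \x^ mu n)%E.
have mc : measurable_fun [set: measurableTypeR R * 'rV[R]_n] (@rV_cons R n).
  exact: measurable_rV_cons.
have ifc : m.-integrable (@rV_cons R n @^-1` setT) (f \o @rV_cons R n).
  by rewrite preimage_setT; apply/integrableP.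
exact: (integral_pushforward mc mf ifc measurableT).
Qed.

Lemma Fubini_rV1 n (f : 'rV[R]_n.+1 -> \bar R) :
  (mu n.+1).-integrable setT f ->
  (\int[mu n.+1]_x f x = \int[lam]_t \int[mu n]_y f (rV_cons (t, y)))%E.
Proof.
move=> fi; have fic := integrable_cons fi.
by rewrite integral_cons// -(integral12_prod_meas1 fic).
Qed.

Lemma Fubini_rV2 n (f : 'rV[R]_n.+1 -> \bar R) :
  (mu n.+1).-integrable setT f ->
  (\int[mu n.+1]_x f x = \int[mu n]_y \int[lam]_t f (rV_cons (t, y)))%E.
Proof.
move=> fi; have fic := integrable_cons fi.
by rewrite integral_cons// -(integral21_prod_meas1 fic).
Qed.

Lemma rV_consD_ord0 n (t s : R) (y : 'rV[R]_n) :
  rV_cons (t, y) + s *: delta_mx ord0 ord0 = rV_cons (t + s, y).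
Proof.
apply/rowP => k; rewrite [LHS]mxE [X in _ + X]mxE [X in _ * X]mxE /=.
have [j ->|->] := unliftP ord0 k.
  by rewrite !rV_cons_lift/= mulr0 addr0.
by rewrite !rV_cons_ord0/= mulr1.
Qed.

Lemma rV_consD_lift n (t s : R) (y : 'rV[R]_n) (j : 'I_n) :
  rV_cons (t, y) + s *: delta_mx ord0 (lift ord0 j) =
  rV_cons (t, y + s *: delta_mx ord0 j).
Proof.
apply/rowP => k; rewrite [LHS]mxE [X in _ + X]mxE [X in _ * X]mxE /=.
have [i ->|->] := unliftP ord0 k.
  by rewrite !rV_cons_lift/= !mxE/= (inj_eq lift_inj).
by rewrite !rV_cons_ord0/= mulr0 addr0.
Qed.

Lemma rV_cons_continuous1 n (y : 'rV[R]_n) :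
  continuous (fun t : R => rV_cons (t, y)).
Proof.
move=> t; apply: cvg_rV => k; have [i ->|->] := unliftP ord0 k.
  by rewrite rV_cons_lift/=; under eq_fun do rewrite rV_cons_lift/=; exact: cvg_cst.
by rewrite rV_cons_ord0/=; under eq_fun do rewrite rV_cons_ord0/=; exact: cvg_id.
Qed.

Lemma rV_cons_continuous2 n (t : R) :
  continuous (fun y : 'rV[R]_n => rV_cons (t, y)).
Proof.
move=> y; apply: (@cvg_rV _ (nbhs y)) => k; have [i ->|->] := unliftP ord0 k.
  by rewrite rV_cons_lift/=; under eq_fun do rewrite rV_cons_lift/=; exact: coor_continuous.
by rewrite rV_cons_ord0/=; under eq_fun do rewrite rV_cons_ord0/=; exact: cvg_cst.
Qed.

Lemma integrable_cube n (D : 'rV[R]_n -> R) (M C : R) : 0 <= M ->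
  measurable_fun setT D -> (forall x, `|D x| <= C) ->
  (forall x : 'rV[R]_n, (exists j, M < `|x ord0 j|) -> D x = 0) ->
  (mu n).-integrable setT (EFin \o D).
Proof.
move=> M0 mD DC D0.
pose Q := [set x : 'rV[R]_n | forall i, x ord0 i \in `[- M, M]].
have mQ : measurable Q by exact: (@measurable_rV_cube n (fun=> - M) (fun=> M)).
have -> : EFin \o D = (EFin \o D) \_ Q.
  apply/funext => x; rewrite patchE; case: ifPn => // /negP xQ /=.
  congr EFin; apply: D0; apply: contrapT => nM; apply: xQ; apply/mem_set => i.
  rewrite in_itv/= -ler_norml leNgt; apply/negP => Mx; apply: nM.
  by exists i.
apply/(integrable_mkcond _ mQ); apply: (@integrable_bounded _ _ _ _ _ _ C) => //.
- rewrite /Q (@lebesgue_rV_cube n (fun=> - M) (fun=> M)) ?ltry//.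
  by move=> _; rewrite lerNl (le_trans _ M0)// oppr_le0.
- exact: measurable_funTS.
Qed.

Lemma is_derive_translate (f : R -> R) (t d : R) :
  is_derive (0 : R) (1 : R) (fun s => f (t + s)) d -> is_derive t (1 : R) f d.
Proof.
have e : (fun h : R => h^-1 *: (((fun s => f (t + s)) \o shift 0) (h *: (1 : R)) -
    f (t + 0))) = (fun h : R => h^-1 *: ((f \o shift t) (h *: (1 : R)) - f t)).
  by apply/funext => h /=; rewrite !addr0 [t + _]addrC.
by case=> d1 d2; split; [rewrite /derivable -e|rewrite /derive -e].
Qed.

(** Fubini in the direction of the derivative, then the fundamental theorem of
    calculus on lines: a compactly supported function has a partial derivative
    of integral zero. *)
Lemma integral_partial_eq0 n (i : 'I_n) (F D : 'rV[R]_n -> R) (M C : R) :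
  0 < M ->
  (forall x, is_derive (0 : R) (1 : R)
     (fun t : R => F (x + t *: delta_mx ord0 i)) (D x)) ->
  continuous D -> (forall x, `|D x| <= C) ->
  (forall x : 'rV[R]_n, (exists j, M < `|x ord0 j|) -> F x = 0 /\ D x = 0) ->
  (\int[mu n]_x (D x)%:E = 0)%E.
Proof.
elim: n i F D => [[]//|n IH] i F D M0 FD cD DC FD0.
have Di : (mu n.+1).-integrable setT (EFin \o D).
  apply: (@integrable_cube _ _ M C) => //; first exact: ltW.
  - exact: continuous_measurable_rV.
  - by move=> x /FD0[].
have [j ij|i0] := unliftP ord0 i.
  rewrite (Fubini_rV1 Di) integral0_eq// => t _ /=.
  apply: (IH j (fun y => F (rV_cons (t, y)))) => //.
  - by move=> y; have := FD (rV_cons (t, y)); rewrite ij;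
      under eq_fun do rewrite rV_consD_lift.
  - move=> y; apply: (@continuous_comp _ _ _ (fun y => rV_cons (t, y)) D).
      exact: rV_cons_continuous2.
    exact: cD.
  - move=> y [k Mk]; apply: FD0; exists (lift ord0 k).
    by rewrite rV_cons_lift.
rewrite (Fubini_rV2 Di) integral0_eq// => y _ /=.
pose f t := F (rV_cons (t, y)); pose f' t := D (rV_cons (t, y)).
have df t : is_derive t (1 : R) f (f' t).
  have := FD (rV_cons (t, y)); rewrite i0; under eq_fun do rewrite rV_consD_ord0.
  exact: is_derive_translate.
have cf' : continuous f'.
  move=> t; apply: (@continuous_comp _ _ _ (fun t => rV_cons (t, y)) D).
    exact: rV_cons_continuous1.
  exact: cD.
have out t : M < `|t| -> f t = 0 /\ f' t = 0.
  by move=> Mt; apply: FD0; exists ord0; rewrite rV_cons_ord0.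
have -> : (\int[lam]_t (f' t)%:E = \int[lam]_(t in `[(- (M + 1))%R, (M + 1)%R]) (f' t)%:E)%E.
  rewrite [RHS]integral_mkcond; apply: eq_integral => t _.
  rewrite patchE; case: ifPn => // /negP tM.
  congr EFin; apply: (out t _).2; rewrite ltNge; apply/negP => h; apply: tM.
  by apply/mem_set; rewrite /= in_itv/= -ler_norml (le_trans h)// lerDl.
rewrite (@continuous_FTC2 _ f' f).
- rewrite !(out _ _).1 ?subee//.
  + by rewrite normrN gtr0_norm ?ltrDl// addr_gt0.
  + by rewrite gtr0_norm ?ltrDl// addr_gt0.
- by lra.
- by apply: continuous_subspaceT.
- split.
  + by move=> t _; have [] := df t.
  + apply: cvg_at_right_filter; apply: differentiable_continuous.
    by apply/derivable1_diffP; have [] := df (- (M + 1)).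
  + apply: cvg_at_left_filter; apply: differentiable_continuous.
    by apply/derivable1_diffP; have [] := df (M + 1).
- by move=> t _; rewrite derive1E; have [_] := df t.
Qed.

End measure_rV.

(** * The Euclidean ball, test functions and weak gradients *)

Section euclid.
Context {R : realType} {N : nat}.
Local Notation E := 'rV[R]_N.
Local Notation mu := (@lebesgue_rV R N).
Implicit Types (x y z : E) (f : E -> R).

Lemma dotvC x y : dotv x y = dotv y x.
Proof. by apply: eq_bigr => i _; rewrite mulrC. Qed.

Lemma dotvDl x y z : dotv (x + y) z = dotv x z + dotv y z.
Proof. by rewrite /dotv -big_split/=; apply: eq_bigr => i _; rewrite mxE mulrDl. Qed.

Lemma dotvDr x y z : dotv z (x + y) = dotv z x + dotv z y.
Proof. by rewrite dotvC dotvDl !(dotvC z). Qed.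

Lemma dotvZl a x y : dotv (a *: x) y = a * dotv x y.
Proof. by rewrite /dotv mulr_sumr; apply: eq_bigr => i _; rewrite mxE mulrA. Qed.

Lemma dotvZr a x y : dotv y (a *: x) = a * dotv y x.
Proof. by rewrite dotvC dotvZl dotvC. Qed.

Lemma dotvNl x y : dotv (- x) y = - dotv x y.
Proof. by rewrite -scaleN1r dotvZl mulN1r. Qed.

Lemma dotvNr x y : dotv y (- x) = - dotv y x.
Proof. by rewrite dotvC dotvNl dotvC. Qed.

Lemma dotv0l x : dotv 0 x = 0.
Proof. by rewrite -(scale0r 0) dotvZl mul0r. Qed.

Lemma dotv_ge0 x : 0 <= dotv x x.
Proof. by apply: sumr_ge0 => i _; rewrite -expr2 sqr_ge0. Qed.

Lemma enorm_ge0 x : 0 <= enorm x. Proof. exact: sqrtr_ge0. Qed.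

Lemma sqr_enorm x : enorm x ^+ 2 = dotv x x.
Proof. by rewrite sqr_sqrtr// dotv_ge0. Qed.

Lemma enorm0 : enorm (0 : E) = 0.
Proof. by rewrite /enorm dotv0l sqrtr0. Qed.

Lemma normr_coor_le x i : `|x ord0 i| <= enorm x.
Proof.
rewrite -sqrtr_sqr ler_wsqrtr// /dotv (bigD1 i)//= -expr2 lerDl.
by apply: sumr_ge0 => j _; rewrite -expr2 sqr_ge0.
Qed.

Lemma enorm_eq0 x : enorm x = 0 -> x = 0.
Proof.
move=> x0; apply/rowP => i; apply/eqP; rewrite mxE -normr_le0 -x0.
exact: normr_coor_le.
Qed.

Lemma enormZ a x : enorm (a *: x) = `|a| * enorm x.
Proof.
rewrite /enorm dotvZl dotvZr mulrA -expr2 sqrtrM ?sqr_ge0//.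
by rewrite sqrtr_sqr.
Qed.

Lemma enormN x : enorm (- x) = enorm x.
Proof. by rewrite -scaleN1r enormZ normrN1 mul1r. Qed.

Lemma dotv_le x y : dotv x y <= enorm x * enorm y.
Proof.
have [x0|x0] := eqVneq (enorm x) 0.
  by rewrite x0 mul0r (enorm_eq0 x0) dotv0l.
have [y0|y0] := eqVneq (enorm y) 0.
  by rewrite y0 mulr0 (enorm_eq0 y0) dotvC dotv0l.
have ? : 0 < enorm x by rewrite lt_neqAle eq_sym x0 enorm_ge0.
have ? : 0 < enorm y by rewrite lt_neqAle eq_sym y0 enorm_ge0.
have := dotv_ge0 (enorm y *: x - enorm x *: y).
rewrite !(dotvDl, dotvDr, dotvNl, dotvNr, dotvZl, dotvZr) -!sqr_enorm (dotvC y x).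
set a := enorm x; set b := enorm y; set c := dotv x y.
rewrite [X in 0 <= X](_ : _ = (2 * a * b) * (a * b - c)); last by ring.
by rewrite pmulr_rge0 ?subr_ge0// !mulr_gt0.
Qed.

Lemma enormD x y : enorm (x + y) <= enorm x + enorm y.
Proof.
rewrite -(@ler_pXn2r _ 2)// ?nnegrE ?addr_ge0 ?enorm_ge0//.
rewrite sqr_enorm dotvDl !dotvDr -!sqr_enorm (dotvC y x) sqrrD.
by have := dotv_le x y; lra.
Qed.

Lemma enormB_le x y : `|enorm x - enorm y| <= enorm (x - y).
Proof.
rewrite ler_norml; apply/andP; split.
  have := enormD x (y - x); rewrite subrKC -(enormN (x - y)) opprB; lra.
by have := enormD y (x - y); rewrite subrKC; lra.
Qed.

Lemma cvg_sumR (X : Type) (F : set_system X) (FF : Filter F) (I : Type)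
    (r : seq I) (f : I -> X -> R) (a : I -> R) :
  (forall i, f i x @[x --> F] --> a i) ->
  \sum_(i <- r) f i x @[x --> F] --> \sum_(i <- r) a i.
Proof.
move=> fa; elim: r => [|i r IH].
  by rewrite big_nil; under eq_fun do rewrite big_nil; exact: cvg_cst.
rewrite big_cons; under eq_fun do rewrite big_cons.
by apply: cvgD; [exact: fa|exact: IH].
Qed.

Lemma enorm_continuous : continuous (@enorm R N).
Proof.
move=> x; apply: (@continuous_comp _ _ _ (fun x : E => dotv x x) Num.sqrt).
  apply: (@cvg_sumR _ (nbhs x)) => i.
  by apply: cvgM; exact: coor_continuous.
exact: sqrt_continuous.
Qed.

Lemma oball_open : open (@oball R N).
Proof.
have := enorm_continuous => /continuousP /(_ _ (@open_lt R 1)).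
by rewrite /oball.
Qed.

Lemma measurable_oball : measurable (@oball R N).
Proof. exact: open_measurable_rV oball_open. Qed.

Lemma cball_compact : compact (@cball R N).
Proof.
apply: bounded_closed_compact.
  exists 1; split; first exact: num_real.
  move=> r r1 x x1 /=; have r0 : 0 <= r by rewrite ltW// (lt_trans _ r1).
  have [->//|/mx_norm_neq0[[i j] /= nx]] := eqVneq `|x| 0.
  rewrite [`|x|]nx (ord1 i) (le_trans (normr_coor_le x j))//.
  by rewrite (le_trans x1)// ltW.
have := enorm_continuous => /continuous_closedP /(_ _ (@closed_le R 1)).
by rewrite /cball.
Qed.

Lemma oball_cball : @oball R N `<=` cball.
Proof. by move=> x /ltW. Qed.

Lemma oball_finite : (mu oball < +oo)%E.
Proof.
apply: (@le_lt_trans _ _ (mu [set x | forall i, x ord0 i \in `[-1, 1]])).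
  apply: le_measure; rewrite ?inE.
  - exact: measurable_oball.
  - exact: (@measurable_rV_cube R N (fun=> -1) (fun=> 1)).
  - move=> x /ltW x1 i; rewrite in_itv/= -ler_norml.
    exact: le_trans (normr_coor_le x i) x1.
rewrite (@lebesgue_rV_cube R N (fun=> -1) (fun=> 1)) ?ltry//.
Qed.

Lemma oball_gt0 : (0 < mu oball)%E.
Proof.
apply: lebesgue_rV_open_gt0; first exact: oball_open.
by exists 0; rewrite /oball/= enorm0.
Qed.

Lemma measurable_enorm : measurable_fun setT (@enorm R N).
Proof. by apply: continuous_measurable_rV; exact: enorm_continuous. Qed.

Lemma measurable_radial (f : R -> R) : measurable_fun setT f ->
  measurable_fun oball (fun x : E => f (enorm x)).
Proof.
move=> mf; apply: measurable_funTS.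
by apply: measurableT_comp; [exact: mf|exact: measurable_enorm].
Qed.

Lemma continuous_bounded_on_compact (K : set E) f : compact K -> continuous f ->
  exists C, forall x, K x -> `|f x| <= C.
Proof.
move=> cK cf.
have /compact_bounded[C [_ hC]] : compact (f @` K).
  by apply: continuous_compact => //; exact: continuous_subspaceT.
exists (C + 1) => x Kx; apply: hC; first by rewrite ltrDl.
by exists x.
Qed.

Lemma integrable_continuous_compact (K : set E) f : compact K ->
  (mu K < +oo)%E -> continuous f -> mu.-integrable K (EFin \o f).
Proof.
move=> cK Koo cf; have [C hC] := continuous_bounded_on_compact cK cf.
apply: integrable_bounded hC => //; first exact: compact_measurable_rV.
by apply: measurable_funTS; exact: continuous_measurable_rV.
Qed.

Lemma integrable_continuous_oball f : continuous f ->
  mu.-integrable oball (EFin \o f).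
Proof.
move=> cf; have [C hC] := continuous_bounded_on_compact cball_compact cf.
apply: integrable_bounded.
- exact: measurable_oball.
- exact: oball_finite.
- by apply: measurable_funTS; exact: continuous_measurable_rV.
- by move=> x /oball_cball; exact: hC.
Qed.

Lemma is_derive_line (phi : E -> R) (x v : E) :
  derivable phi x v ->
  is_derive (0 : R) (1 : R) (fun t : R => phi (x + t *: v)) ('D_v phi x).
Proof.
have e : (fun h : R => h^-1 *: (((fun t : R => phi (x + t *: v)) \o shift 0) (h *: (1 : R)) -
    phi (x + (0 : R) *: v))) = (fun h : R => h^-1 *: ((phi \o shift x) (h *: v) - phi x)).
  by apply/funext => h /=; rewrite addr0 scale0r addr0 [x + _]addrC [_ *: 1]mulr1.
by move=> d; split; [rewrite /derivable e|rewrite /derive e].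
Qed.

Lemma derive_line (phi : E -> R) (x v : E) (d : R) :
  is_derive (0 : R) (1 : R) (fun t : R => phi (x + t *: v)) d ->
  is_derive x v phi d.
Proof.
have e : (fun h : R => h^-1 *: (((fun t : R => phi (x + t *: v)) \o shift 0) (h *: (1 : R)) -
    phi (x + (0 : R) *: v))) = (fun h : R => h^-1 *: ((phi \o shift x) (h *: v) - phi x)).
  by apply/funext => h /=; rewrite addr0 scale0r addr0 [x + _]addrC [_ *: 1]mulr1.
by case=> d1 d2; split; [rewrite /derivable -e|rewrite /derive -e].
Qed.

Section test_functions.
Variable phi : E -> R.
Hypothesis tphi : test_function phi.

Let K := closure [set x | phi x != 0].

Lemma test_out x : ~ oball x -> phi x = 0.
Proof.
move=> nx; apply: contrapT => px; apply: nx; have [_ _ h] := tphi; apply: h.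
by apply: subset_closure; apply/eqP.
Qed.

Lemma test_partial_out i x : ~ oball x -> partial i phi x = 0.
Proof.
move=> nx; rewrite /partial.
have [_ _ h] := tphi.
have nK : nbhs x (~` K).
  apply: open_nbhs_nbhs; split; first exact/closed_openC/closed_closure.
  by move=> Kx; apply: nx; exact: h.
have [->//|v0] := eqVneq (delta_mx ord0 i : E) 0; first by rewrite derive0.
rewrite (@near_eq_derive _ _ _ phi (cst 0)) ?derive_cst//.
apply: filterS nK => y ny; apply: contrapT => py; apply: ny.
by apply: subset_closure; apply/eqP.
Qed.

Lemma test_continuous : continuous phi.
Proof.
by move=> x; apply: differentiable_continuous; have [/(_ [::] x)] := tphi.
Qed.

Lemma test_partial_continuous i : continuous (partial i phi).
Proof.
by move=> x; apply: differentiable_continuous; have [/(_ [:: i] x)] := tphi.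
Qed.

Lemma test_is_derive_line i x :
  is_derive (0 : R) (1 : R) (fun t : R => phi (x + t *: delta_mx ord0 i))
    (partial i phi x).
Proof.
apply: is_derive_line; apply: diff_derivable.
by have [/(_ [::] x)] := tphi.
Qed.

End test_functions.

(** Classical partial derivatives are weak ones: extended by zero, the product
    with a test function has partial derivatives of integral zero. *)
Lemma weak_gradient_C1 (f : E -> R) (G : E -> E) :
  continuous f -> (forall i, continuous (fun x => G x ord0 i)) ->
  (forall i x, is_derive (0 : R) (1 : R)
     (fun t : R => f (x + t *: delta_mx ord0 i)) (G x ord0 i)) ->
  weak_gradient f G.
Proof.
move=> cf cG fG i; split.
  move=> K cK KB; apply: integrable_continuous_compact => //.
  apply: le_lt_trans oball_finite; apply: le_measure; rewrite ?inE//.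
  - exact: compact_measurable_rV.
  - exact: measurable_oball.
move=> phi tphi.
pose D x := f x * partial i phi x + G x ord0 i * phi x.
have c1 : continuous (fun x => f x * partial i phi x).
  move=> x; have h1 := cf x; have h2 := @test_partial_continuous _ tphi i x.
  exact: (cvgM h1 h2).
have c2 : continuous (fun x => G x ord0 i * phi x).
  move=> x; have h1 := cG i x; have h2 := @test_continuous _ tphi x.
  exact: (cvgM h1 h2).
have cD : continuous D by move=> x; exact: (cvgD (c1 x) (c2 x)).
have D0 x : ~ oball x -> D x = 0.
  by move=> nx; rewrite /D (test_out tphi nx) (test_partial_out tphi _ nx) !mulr0 addr0.
have [C hC] := continuous_bounded_on_compact cball_compact cD.
have C0 : 0 <= C.
  by apply: le_trans (hC 0 _); rewrite ?normr_ge0// /cball/= enorm0.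
have ID : (\int[mu]_x (D x)%:E = 0)%E.
  apply: (@integral_partial_eq0 _ _ i (fun x => f x * phi x) D 1 C) => //.
  - move=> x; rewrite /D.
    have h := is_deriveM (fG i x) (test_is_derive_line tphi i x).
    apply: (is_derive_eq h); rewrite scale0r addr0 /GRing.scale/=.
    by rewrite [G x ord0 i * _]mulrC.
  - move=> x; have [xB|xB] := pselect (oball x); first exact/hC/oball_cball.
    by rewrite D0// normr0.
  - move=> x [j xj]; have nx : ~ oball x.
      by rewrite /oball/= => /ltW/(le_trans (normr_coor_le x j)); rewrite leNgt xj.
    by rewrite D0// (test_out tphi nx) mulr0.
have {}ID : \int[mu]_(x in oball) D x = 0.
  rewrite Rintegral_mkcond /Rintegral (_ : (fun x => ((D \_ oball) x)%:E) = (fun x => (D x)%:E)) ?ID//.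
  apply/funext => x; rewrite patchE; case: ifPn => // /negP xB.
  by rewrite D0// => h; apply: xB; apply/mem_set.
move: ID; rewrite RintegralD.
- by move=> /eqP; rewrite addr_eq0 => /eqP.
- exact: measurable_oball.
- exact: integrable_continuous_oball.
- exact: integrable_continuous_oball.
Qed.

End euclid.

(** * A supply of smooth functions *)

Section smooth_functions.
Context {R : realType}.

Lemma is_derive_sqr_bound (f : R -> R) (t d C e : R) : 0 < e ->
  (forall h, `|h| < e -> `|f (h + t) - f t - d * h| <= C * h ^+ 2) ->
  is_derive t (1 : R) f d.
Proof.
move=> e0 fC.
suff c : (fun h : R => h^-1 *: ((f \o shift t) (h *: (1 : R)) - f t)) @ 0^' --> d.
  by split; [apply/cvg_ex; exists d|apply/cvg_lim].
apply/cvgrPdist_le => /= eps eps0.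
have C1 : 0 < `|C| + 1 by rewrite ltr_wpDl.
near=> h.
have h0 : h != 0 by near: h; exact: nbhs_dnbhs_neq.
have he : `|h| < e by near: h; apply: dnbhs0_lt.
have hd : `|h| < eps / (`|C| + 1) by near: h; apply: dnbhs0_lt; exact: divr_gt0.
rewrite [h *: 1]mulr1 distrC (_ : _ - d = h^-1 * (f (h + t) - f t - d * h)); last first.
  by rewrite mulrBr mulrCA mulVf ?mulr1.
rewrite normrM normfV ler_pdivrMl ?normr_gt0// (le_trans (fC h he))//.
rewrite -(real_normK (num_real h)) expr2 mulrA [leRHS]mulrC ler_wpM2r//.
rewrite (@le_trans _ _ ((`|C| + 1) * `|h|))//.
  by rewrite ler_wpM2r// (le_trans (ler_norm C))// lerDl.
by rewrite mulrC -ler_pdivlMr// ltW.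
Unshelve. all: by end_near. Qed.

(** The functions t^-k exp(-1/t), extended by zero to t <= 0: a family closed
    under differentiation, from which all test functions below are built. *)
Definition flat (k : nat) (t : R) : R :=
  if 0 < t then t^-1 ^+ k * expR (- t^-1) else 0.

Lemma flat_ge0 k t : 0 <= flat k t.
Proof.
by rewrite /flat; case: ifPn => // t0; rewrite mulr_ge0 ?expR_ge0// exprn_ge0// invr_ge0 ltW.
Qed.

Lemma flat0_le1 t : flat 0 t <= 1.
Proof.
rewrite /flat; case: ifPn => // t0; rewrite expr0 mul1r -expR0 ler_expR.
by rewrite oppr_le0 invr_ge0 ltW.
Qed.

Lemma flat_le0 k t : t <= 0 -> flat k t = 0.
Proof. by rewrite /flat; case: ltP. Qed.

(** From exp(y) >= y^n / n! with y = 1/t. So [flat k] has derivative 0 at 0. *)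
Lemma flat_bound k t : flat k t <= (k.+2)`!%:R * t ^+ 2.
Proof.
have [t0|t0] := leP t 0.
  by rewrite flat_le0// mulr_ge0// sqr_ge0.
rewrite /flat t0 expRN -ler_pdivlMr ?invr_gt0 ?expR_gt0// invrK.
have y0 : 0 < t^-1 by rewrite invr_gt0.
have h := expR_ge1Dxn k.+1 (ltW y0).
have h2 : t^-1 ^+ k.+2 / k.+2`!%:R <= expR t^-1 by apply: le_trans h; rewrite lerDr.
have F0 : (0 : R) < k.+2`!%:R by rewrite ltr0n fact_gt0.
rewrite (@le_trans _ _ (k.+2`!%:R * t ^+ 2 * (t^-1 ^+ k.+2 / k.+2`!%:R)))//.
  rewrite (_ : _ * _ * (_ / _) = t ^+ 2 * t^-1 ^+ k.+2 * (k.+2`!%:R / k.+2`!%:R)); last by ring.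
  rewrite divff ?gt_eqF// mulr1 -[k.+2]addn2 exprD mulrCA -exprMn divff ?gt_eqF//.
  by rewrite expr1n mulr1.
by rewrite ler_wpM2l// mulr_ge0// sqr_ge0.
Qed.

Lemma is_derive_flat k t :
  is_derive t (1 : R) (flat k) (flat k.+2 t - k%:R * flat k.+1 t).
Proof.
have [t0|t0|t0] := ltgtP t 0.
- rewrite !flat_le0 ?ltW// mulr0 subr0.
  have dc : is_derive t (1 : R) (cst 0 : R -> R) 0 by exact: is_derive_cst.
  apply: near_eq_is_derive dc.
  by near=> s; rewrite flat_le0//; near: s; exact: lt_le_nbhsl.
- have tn0 : t != 0 by rewrite gt_eqF.
  have dV : is_derive t (1 : R) (fun s : R => s^-1) (- t^-1 ^+ 2).
    split; first exact: (derivableV (f := id)).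
    by rewrite (deriveV (f := id))// derive_id /GRing.scale/= mulr1 exprVn.
  have dX : is_derive t (1 : R) (fun s : R => s^-1 ^+ k)
      ((k%:R * t^-1 ^+ k.-1) *: - t^-1 ^+ 2).
    by have := is_deriveX k dV; rewrite exprfctE.
  have dE : is_derive t (1 : R) (fun s : R => expR (- s^-1)) (expR (- t^-1) * t^-1 ^+ 2).
    have dN : is_derive t (1 : R) (fun s : R => - s^-1) (t^-1 ^+ 2).
      by have := is_deriveN dV; rewrite opprK.
    exact: (@is_derive1_comp R expR (fun s : R => - s^-1) t).
  have dM := is_deriveM dX dE.
  suff dF : is_derive t (1 : R) (fun s : R => s^-1 ^+ k * expR (- s^-1))
      (flat k.+2 t - k%:R * flat k.+1 t).
    apply: near_eq_is_derive dF.
    near=> s; rewrite /flat ifT//; near: s; exact: lt_nbhsr.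
  apply: (is_derive_eq dM).
  rewrite /flat t0 /GRing.scale/=; case: k {dX dM} => [|k].
    by rewrite /= !mul0r subr0 mulr0 addr0; ring.
  by rewrite /= !exprS; ring.
- rewrite t0 !flat_le0// mulr0 subr0.
  apply: (@is_derive_sqr_bound _ _ _ (k.+2)`!%:R 1) => // h _.
  rewrite addr0 mul0r (@flat_le0 k 0)// !subr0 ger0_norm ?flat_ge0//.
  exact: flat_bound.
Unshelve. all: by end_near. Qed.

(** A class of functions that is closed under differentiation by its syntax, so
    that its members are smooth. Antiderivatives are included for the test
    functions whose radial derivative is prescribed. *)
Inductive smooth1 : (R -> R) -> Prop :=
| smooth1_id : smooth1 id
| smooth1_cst c : smooth1 (fun=> c)
| smooth1_add f g : smooth1 f -> smooth1 g -> smooth1 (fun t => f t + g t)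
| smooth1_mul f g : smooth1 f -> smooth1 g -> smooth1 (fun t => f t * g t)
| smooth1_flat k f : smooth1 f -> smooth1 (fun t => flat k (f t))
| smooth1_prim c C : smooth1 c -> (forall t, is_derive t (1 : R) C (c t)) ->
    smooth1 C.

Lemma smooth1_derive f : smooth1 f ->
  exists2 f', smooth1 f' & forall t, is_derive t (1 : R) f (f' t).
Proof.
elim=> [|c|{}f g sf [f' sf' df] sg [g' sg' dg]|{}f g sf [f' sf' df] sg [g' sg' dg]
  |k {}f sf [f' sf' df]|c C sc _ dC].
- by exists (fun=> 1); [exact: smooth1_cst|move=> t; exact: is_derive_id].
- by exists (fun=> 0); [exact: smooth1_cst|move=> t; exact: is_derive_cst].
- exists (fun t => f' t + g' t); first exact: smooth1_add.
  by move=> t; exact: is_deriveD (df t) (dg t).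
- exists (fun t => f t * g' t + g t * f' t).
    by apply: smooth1_add; exact: smooth1_mul.
  by move=> t; exact: is_deriveM (df t) (dg t).
- exists (fun t => (flat k.+2 (f t) + - k%:R * flat k.+1 (f t)) * f' t).
    apply: smooth1_mul => //; apply: smooth1_add; first exact: smooth1_flat.
    by apply: smooth1_mul; [exact: smooth1_cst|exact: smooth1_flat].
  move=> t; rewrite mulNr.
  exact: is_derive1_comp (is_derive_flat k (f t)) (df t).
- by exists c.
Qed.

Variable N : nat.
Local Notation E := 'rV[R]_N.

(** The analogue of [smooth1] for functions of several variables. *)
Inductive smoothN : (E -> R) -> Prop :=
| smoothN_coor i : smoothN (fun x => x ord0 i)
| smoothN_cst c : smoothN (fun=> c)
| smoothN_add f g : smoothN f -> smoothN g -> smoothN (fun x => f x + g x)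
| smoothN_mul f g : smoothN f -> smoothN g -> smoothN (fun x => f x * g x)
| smoothN_comp h f : smooth1 h -> smoothN f -> smoothN (fun x => h (f x)).

Lemma smoothN_differentiable f : smoothN f -> forall x, differentiable f x.
Proof.
elim=> [i|c|{}f g _ df _ dg|{}f g _ df _ dg|h {}f sh _ df] x.
- exact: differentiable_coord.
- exact: differentiable_cst.
- exact: differentiableD.
- exact: differentiableM.
- have [h' _ dh] := smooth1_derive sh.
  apply: (@differentiable_comp _ _ _ _ f h) => //.
  by apply/derivable1_diffP; have [] := dh (f x).
Qed.

Lemma smoothN_partial i f : smoothN f ->
  exists2 f', smoothN f' & forall x, is_derive x (delta_mx ord0 i : E) f (f' x).
Proof.
elim=> [j|c|{}f g sf [f' sf' df] sg [g' sg' dg]|{}f g sf [f' sf' df] sg [g' sg' dg]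
  |h {}f sh sf [f' sf' df]].
- exists (fun=> ((j == i)%:R)); first exact: smoothN_cst.
  move=> x; apply: derive_line.
  have -> : (fun t : R => (x + t *: delta_mx ord0 i) ord0 j) =
      (fun t : R => x ord0 j + t * (j == i)%:R).
    by apply/funext => t; rewrite !mxE eqxx.
  have d1 : is_derive (0 : R) (1 : R) (fun t : R => t * (j == i)%:R) ((j == i)%:R).
    have := is_deriveM (is_derive_id (0 : R) (1 : R)) (is_derive_cst ((j == i)%:R : R) (0 : R) (1 : R)).
    by move=> h; apply: (is_derive_eq h); rewrite /GRing.scale/= mul0r add0r mulr1.
  have := is_deriveD (is_derive_cst (x ord0 j) (0 : R) (1 : R)) d1.
  by rewrite add0r.
- by exists (fun=> 0); [exact: smoothN_cst|move=> x; exact: is_derive_cst].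
- exists (fun t => f' t + g' t); first exact: smoothN_add.
  by move=> t; exact: is_deriveD (df t) (dg t).
- exists (fun t => f t * g' t + g t * f' t).
    by apply: smoothN_add; exact: smoothN_mul.
  by move=> t; exact: is_deriveM (df t) (dg t).
- have [h' sh' dh] := smooth1_derive sh.
  exists (fun x => h' (f x) * f' x).
    by apply: smoothN_mul => //; exact: smoothN_comp.
  move=> x; apply: derive_line.
  have [dfx dfE] := df x; have dl := is_derive_line dfx; rewrite dfE in dl.
  have dhx : is_derive (f (x + (0 : R) *: delta_mx ord0 i)) (1 : R) h (h' (f x)).
    by rewrite scale0r addr0; exact: dh.
  exact: (is_derive1_comp (f := h) (g := fun t : R => f (x + t *: delta_mx ord0 i)) dhx dl).
Qed.

Lemma smoothN_smooth f : smoothN f -> smooth f.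
Proof.
move=> sf s; suff : smoothN (foldr partial f s) by exact: smoothN_differentiable.
elim: s => //= i s /(smoothN_partial i)[g sg dg].
rewrite (_ : partial i _ = g)//.
by apply/funext => x; have [_] := dg x.
Qed.

Lemma smoothN_prod (I : Type) (r : seq I) (f : I -> E -> R) :
  (forall i, smoothN (f i)) -> smoothN (fun x => \prod_(i <- r) f i x).
Proof.
move=> sf; elim: r => [|i r IH].
  by under eq_fun do rewrite big_nil; exact: smoothN_cst.
by under eq_fun do rewrite big_cons; exact: smoothN_mul.
Qed.

Lemma smoothN_test f (K : set E) : smoothN f -> closed K -> K `<=` oball ->
  (forall x, ~ K x -> f x = 0) -> test_function f.
Proof.
move=> sf cK KB f0; have sK : closure [set x | f x != 0] `<=` K.
  rewrite [X in _ `<=` X](iffLR (closure_id K))//.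
  apply: closure_subset => x /= fx; apply: contrapT => /f0 fx0.
  by move: fx; rewrite fx0 eqxx.
split; first exact: smoothN_smooth.
- apply: (subclosed_compact _ cball_compact); first exact: closed_closure.
  by move=> x /sK /KB /oball_cball.
- by move=> x /sK /KB.
Qed.

End smooth_functions.

(** * Uniqueness of the weak gradient *)

Section uniqueness.
Context {R : realType} {N : nat}.
Local Notation E := 'rV[R]_N.
Local Notation mu := (@lebesgue_rV R N).
Implicit Types (a b : 'I_N -> R) (d : E -> R).

Definition obox a b : set E := [set x | forall i, x ord0 i \in `]a i, b i[].
Definition cbox a b : set E := [set x | forall i, x ord0 i \in `[a i, b i]].

Lemma measurable_obox a b : measurable (obox a b).
Proof.
by apply: (@measurable_rV_box R N (fun i => [set` `]a i, b i[])) => i;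
  exact: measurable_itv.
Qed.

Lemma cbox_closed a b : closed (cbox a b).
Proof.
have -> : cbox a b = \bigcap_(i in [set: 'I_N]) ((fun x : E => x ord0 i) @^-1` [set` `[a i, b i]]).
  by apply/seteqP; split => x h i; [move=> _|]; exact: h.
apply: closed_bigI => i _; apply: closed_comp.
  by move=> x _; exact: coor_continuous.
exact: interval_closed.
Qed.

Lemma obox_cbox a b : obox a b `<=` cbox a b.
Proof. by move=> x h i; have := h i; rewrite !in_itv/= => /andP[/ltW -> /ltW ->]. Qed.

Lemma cvg_prodR (X : Type) (F : set_system X) (FF : Filter F) (I : Type)
    (r : seq I) (f : I -> X -> R) (l : I -> R) :
  (forall i, f i x @[x --> F] --> l i) ->
  \prod_(i <- r) f i x @[x --> F] --> \prod_(i <- r) l i.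
Proof.
move=> fa; elim: r => [|i r IH].
  by rewrite big_nil; under eq_fun do rewrite big_nil; exact: cvg_cst.
rewrite big_cons; under eq_fun do rewrite big_cons.
by apply: cvgM; [exact: fa|exact: IH].
Qed.

Lemma flat0_cvg1 (s : R) : 0 < s -> flat 0 (k.+1%:R * s) @[k --> \oo] --> (1 : R).
Proof.
move=> s0; apply: (@squeeze_cvgr _ _ _ _ (fun k => 1 - s^-1 * harmonic k) (fun=> 1)).
- near=> k; apply/andP; split; last exact: flat0_le1.
  rewrite /flat ifT ?mulr_gt0// expr0 mul1r invfM mulrC /harmonic/=.
  exact: expR_ge1Dx.
- rewrite -[X in _ --> X]subr0; apply: cvgB; first exact: cvg_cst.
  rewrite -[X in _ --> X](mulr0 s^-1); apply: cvgM; first exact: cvg_cst.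
  exact: cvg_harmonic.
- exact: cvg_cst.
Unshelve. all: by end_near. Qed.

(** A smooth function that is positive on the open box and zero outside, and
    tends to its indicator function as k grows. *)
Definition box_bump a b (k : nat) (x : E) : R :=
  \prod_(i < N) (flat 0 (k.+1%:R * (x ord0 i - a i)) *
                 flat 0 (k.+1%:R * (b i - x ord0 i))).

Lemma box_bump_out a b k x : ~ obox a b x -> box_bump a b k x = 0.
Proof.
move=> /existsNP[i /negP]; rewrite in_itv/= negb_and -!leNgt => h.
rewrite /box_bump (bigD1 i)//=.
case/orP : h => h; [rewrite [X in X * _ * _]flat_le0|rewrite [X in _ * X * _]flat_le0];
  by rewrite ?mulr0 ?mul0r// mulr_ge0_le0// subr_le0.
Qed.

Lemma box_bump_le1 a b k x : `|box_bump a b k x| <= 1.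
Proof.
rewrite ger0_norm; last by apply: prodr_ge0 => i _; rewrite mulr_ge0// flat_ge0.
by apply: prodr_ile1 => i _; rewrite mulr_ge0 ?flat_ge0// mulr_ile1 ?flat_ge0// flat0_le1.
Qed.

Lemma box_bump_cvg a b x : obox a b x ->
  box_bump a b k x @[k --> \oo] --> (1 : R).
Proof.
move=> abx; have -> : (1 : R) = \prod_(i < N) (1 * 1) by rewrite big1// => i _; rewrite mulr1.
apply: cvg_prodR => i; have := abx i; rewrite in_itv/= => /andP[ax xb].
by apply: cvgM; apply: flat0_cvg1; rewrite subr_gt0.
Qed.

Lemma box_bump_smooth a b k : smoothN (box_bump a b k).
Proof.
apply: smoothN_prod => i; apply: smoothN_mul.
  apply: (smoothN_comp (h := fun s => flat 0 (k.+1%:R * (s - a i)))); last exact: smoothN_coor.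
  apply: smooth1_flat; apply: smooth1_mul; first exact: smooth1_cst.
  by apply: (smooth1_add (g := fun=> - a i)); [exact: smooth1_id|exact: smooth1_cst].
apply: (smoothN_comp (h := fun s => flat 0 (k.+1%:R * (b i - s)))); last exact: smoothN_coor.
apply: smooth1_flat; apply: smooth1_mul; first exact: smooth1_cst.
apply: smooth1_add; first exact: smooth1_cst.
have -> : -%R = (fun t : R => -1 * t) by apply/funext => t; rewrite mulN1r.
by apply: smooth1_mul; [exact: smooth1_cst|exact: smooth1_id].
Qed.

Lemma box_bump_test a b k : cbox a b `<=` oball -> test_function (box_bump a b k).
Proof.
move=> QB; apply: (smoothN_test (K := cbox a b)) => //.
- exact: box_bump_smooth.
- exact: cbox_closed.
- by move=> x nQ; apply: box_bump_out => /obox_cbox.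
Qed.

Let oboxes : set (set E) := [set A | exists a b, A = obox a b].

Lemma oboxI a b a' b' : obox a b `&` obox a' b' =
  obox (fun i => Num.max (a i) (a' i)) (fun i => Num.min (b i) (b' i)).
Proof.
apply/seteqP; split => [x [h h'] i|x h].
  have := h i; have := h' i; rewrite !in_itv/= => /andP[h1 h2] /andP[h3 h4].
  by rewrite gt_max lt_min h1 h2 h3 h4.
split=> i; have := h i; rewrite !in_itv/= gt_max lt_min => /andP[/andP[h1 h2] /andP[h3 h4]].
  by rewrite h1 h3.
by rewrite h2 h4.
Qed.

Let oboxes_setI : setI_closed oboxes.
Proof.
by move=> _ _ [a [b ->]] [a' [b' ->]]; rewrite oboxI; eexists; eexists.
Qed.

Let oboxes_generate : @measurable _ E = <<s oboxes >>.
Proof.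
apply/seteqP; split; last first.
  apply: smallest_sub; first exact: sigma_algebra_measurable.
  by move=> _ [a [b ->]]; exact: measurable_obox.
move=> A mA; have : measurable_fun [set: g_sigma_algebraType oboxes] (id : _ -> E).
  apply: measurable_fun_rV => i.
  apply: (measurability _ (RGenOInfty.measurableE R)) => //.
  move=> _ [_ [c ->] <-]; rewrite setTI.
  rewrite (_ : _ @^-1` _ = \bigcup_k obox (fun j => if j == i then c else - k%:R) (fun=> k%:R)).
    by apply: bigcupT_measurable => k; apply: sub_sigma_algebra; eexists; eexists.
  apply/seteqP; split => [x /=|x [k _ /(_ i)]]; rewrite /rV_coor in_itv/= ?andbT ?eqxx.
    move=> cx; exists (Num.bound (\sum_j `|x ord0 j|)) => // j; rewrite in_itv/=.
    have h : `|x ord0 j| < (Num.bound (\sum_j `|x ord0 j|))%:R.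
      apply: le_lt_trans (archi_boundP _); last exact: sumr_ge0.
      by rewrite (bigD1 j)//= lerDl sumr_ge0.
    move: h; rewrite ltr_norml => /andP[h1 h2]; rewrite h2 andbT.
    by case: eqP => [->|].
  by rewrite in_itv/= andbT => /andP[].
by move=> /(_ measurableT A mA); rewrite setTI.
Qed.

Section orthogonal_to_tests.
Variable d : E -> R.
Hypothesis dloc : loc_integrable d.
Hypothesis d0 : forall phi, test_function phi ->
  \int[mu]_(x in oball) (d x * phi x) = 0.

Let dint a b : cbox a b `<=` oball -> mu.-integrable (obox a b) (EFin \o d).
Proof.
move=> QB; have cQ : compact (cbox a b).
  apply: (subclosed_compact _ cball_compact); first exact: cbox_closed.
  by move=> x /QB /oball_cball.
apply: (integrableS _ _ (@obox_cbox a b)); last exact: dloc.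
- exact: compact_measurable_rV.
- exact: measurable_obox.
Qed.

Let dbox a b : cbox a b `<=` oball -> \int[mu]_(x in obox a b) d x = 0.
Proof.
move=> QB; have di := dint QB; have mS := measurable_obox a b.
have h : \int[mu]_(x in obox a b) (d x * box_bump a b k x) @[k --> \oo] -->
    \int[mu]_(x in obox a b) d x.
  apply: (Rintegral_cvg (g := fun x => `|d x|)) => //.
  - move=> k; apply: measurable_funM.
      by have /measurable_EFinP := measurable_int _ di.
    apply: measurable_funTS; apply: continuous_measurable_rV.
    by apply: test_continuous; exact: box_bump_test.
  - by have /measurable_EFinP := measurable_int _ di.
  - by apply: integrable_norm.
  - apply: aeW => x Sx; rewrite -[X in _ --> X]mulr1.
    by apply: cvgM; [exact: cvg_cst|exact: box_bump_cvg].
  - move=> k x Sx; rewrite normrM ler_piMr//; exact: box_bump_le1.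
apply/esym/(cvg_unique _ _ h) => //.
rewrite (_ : (fun k : nat => _) = fun=> 0); first exact: cvg_cst.
apply/funext => k; rewrite -[RHS](d0 (box_bump_test k QB)).
rewrite Rintegral_mkcond [RHS]Rintegral_mkcond; apply: eq_Rintegral => x _.
rewrite !patchE; case: ifPn => xS; case: ifPn => xB //.
- by case/negP: xB; apply/mem_set/QB/obox_cbox/set_mem.
- by rewrite box_bump_out ?mulr0// => h'; case/negP: xS; apply/mem_set.
Qed.

Let dmeas a b (A : set E) : cbox a b `<=` oball -> measurable A ->
  \int[mu]_(x in obox a b) (d x * \1_A x) = 0.
Proof.
move=> QB mA; have di := dint QB; have mS := measurable_obox a b.
have md : measurable_fun (obox a b) d by have /measurable_EFinP := measurable_int _ di.
have dAi B : measurable B -> mu.-integrable (obox a b) (EFin \o (fun x => d x * \1_B x)).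
  move=> mB; apply: le_integrable di => //.
    by apply/measurable_EFinP; apply: measurable_funM => //; exact: measurable_indic.
  move=> x _; rewrite /= lee_fin normrM ler_piMr// indicE.
  by case: (_ \in _); rewrite ?normr1 ?normr0.
apply: (dynkin_induction (P := fun A => \int[mu]_(x in obox a b) (d x * \1_A x) = 0) oboxes_generate oboxes_setI) => //.
- under eq_Rintegral do rewrite indicT mulr1.
  exact: dbox.
- move=> _ [a' [b' ->]].
  rewrite (_ : (fun x => _) = d \_ (obox a' b')); last first.
    by apply/funext => x; rewrite patchE indicE; case: ifPn; rewrite ?mulr1 ?mulr0.
  rewrite -Rintegral_mkcondr oboxI; apply: dbox => x h; apply: QB => i.
  have := h i; rewrite !in_itv/= ge_max le_min => /andP[/andP[-> _] /andP[-> _]].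
  by [].
- move=> S mS' S0; rewrite (_ : (fun x => _) = (fun x => d x - d x * \1_S x)).
    by rewrite RintegralB// ?S0 ?dbox ?subr0//; exact: dAi.
  apply/funext => x; rewrite !indicE in_setC; case: (x \in S); rewrite ?mulr1 ?mulr0 ?subrr ?subr0//.
- move=> F mF tF F0.
  pose U k := \big[setU/set0]_(i < k) F i.
  have mU k : measurable (U k) by exact: bigsetU_measurable.
  have IU k : \int[mu]_(x in obox a b) (d x * \1_(U k) x) = 0.
    elim: k => [|k IH].
      rewrite /U big_ord0 (_ : (fun x => _) = fun=> 0) ?Rintegral_cst ?mul0r//.
      by apply/funext => x; rewrite indicE in_set0 mulr0.
    rewrite (_ : (fun x => _) = (fun x => d x * \1_(U k) x + d x * \1_(F k) x)).
      by rewrite RintegralD// ?IH ?F0 ?addr0//; exact: dAi.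
    apply/funext => x; rewrite -mulrDr; congr (_ * _).
    rewrite /U big_ord_recr/= !indicE in_setU.
    have [xk|xk] := boolP (x \in F k); last by rewrite orbF addr0.
    case: (boolP (x \in _)) => [|_]; last by rewrite orbT add0r.
    rewrite -bigcup_mkord => /set_mem[j /= jk xj].
    have := tF j k I I; rewrite /setI/= => h.
    have jk' : j = k by apply: h; exists x; split => //; exact: set_mem.
    by rewrite jk' ltnn in jk.
  have h : \int[mu]_(x in obox a b) (d x * \1_(U k) x) @[k --> \oo] -->
      \int[mu]_(x in obox a b) (d x * \1_(\bigcup_k F k) x).
    apply: (Rintegral_cvg (g := fun x => `|d x|)) => //.
    - by move=> k; apply: measurable_funM => //; exact: measurable_indic.
    - apply: measurable_funM => //; apply: measurable_indic; exact: bigcupT_measurable.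
    - exact: integrable_norm.
    - apply: aeW => x _; apply: cvgM; first exact: cvg_cst.
      have [[j _ xj]|nx] := pselect ((\bigcup_k F k) x).
        apply: cvg_near_cst; exists j.+1 => // k /= jk.
        rewrite !indicE !mem_set//; first by exists j.
        by rewrite /U -bigcup_mkord; exists j.
      apply: cvg_near_cst; apply: nearW => k; rewrite !indicE !memNset//.
      by rewrite /U -bigcup_mkord => -[j _ xj]; apply: nx; exists j.
    - move=> k x _; rewrite normrM ler_piMr// indicE.
      by case: (_ \in _); rewrite ?normr1 ?normr0.
  apply/esym/(cvg_unique _ _ h) => //.
  rewrite (_ : (fun k : nat => _) = fun=> 0); first exact: cvg_cst.
  by apply/funext => k; exact: IU.
- by rewrite -oboxes_generate.
Qed.

(** The fundamental lemma of the calculus of variations: the test functions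
    determine the integrals over boxes, and the boxes generate the Borel sets. *)
Lemma orthogonal_to_tests_ae0 : {ae mu, forall x, oball x -> d x = 0}.
Proof.
have boxae a b : cbox a b `<=` oball -> {ae mu, forall x, obox a b x -> d x = 0}.
  move=> QB; have di := dint QB; have mS := measurable_obox a b.
  have : ae_eq mu (obox a b) (EFin \o d) (fun=> 0%E).
    apply: integral_ae_eq => // A AS mA; rewrite integral0.
    have := dmeas QB mA; rewrite (_ : (fun x => _) = d \_ A); last first.
      by apply/funext => x; rewrite patchE indicE; case: ifPn; rewrite ?mulr1 ?mulr0.
    rewrite -Rintegral_mkcondr (_ : _ `&` A = A); last exact: setIidr.
    rewrite /Rintegral => h; rewrite -[LHS]fineK.
      by congr EFin.
    apply: integrable_fin_num => //; exact: integrableS di.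
  by apply: filterS => x h Sx; have := h Sx => -[].
pose V (z : option ('rV[rat]_N * nat)) (x : E) := if z is Some (q, k) then
  cbox (fun i => ratr (q ord0 i) - k.+1%:R^-1) (fun i => ratr (q ord0 i) + k.+1%:R^-1) `<=` oball ->
  obox (fun i => ratr (q ord0 i) - k.+1%:R^-1) (fun i => ratr (q ord0 i) + k.+1%:R^-1) x ->
  d x = 0 else True.
have : {ae mu, forall x, forall n, V (unpickle n) x}.
  apply/ae_foralln => n; rewrite /V; case: (unpickle n) => [[q k]|]; last exact: aeW.
  by have [QB|QB] := pselect (cbox (fun i => ratr (q ord0 i) - k.+1%:R^-1) (fun i => ratr (q ord0 i) + k.+1%:R^-1) `<=` oball);
    [apply: filterS (boxae _ _ QB) => x h _|apply: aeW].
apply: filterS => x Vx xB.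
have [q [k [qx qU]]] := rational_box oball_open xB.
have := Vx (pickle (q, k)); rewrite pickleK /V; apply.
  move=> y h; apply: qU => i; have := h i; rewrite in_itv/=.
  by move: (k.+1%:R^-1) => c /andP[h1 h2]; rewrite ler_norml; lra.
move=> i; have := qx i; rewrite in_itv/=; move: (k.+1%:R^-1) => c.
by rewrite ltr_norml; lra.
Qed.

End orthogonal_to_tests.

Lemma weak_gradient_unique (u : E -> R) (g h : E -> E) :
  weak_gradient u g -> weak_gradient u h ->
  {ae mu, forall x, oball x -> g x = h x}.
Proof.
move=> ug uh.
have gh i : {ae mu, forall x, oball x -> g x ord0 i - h x ord0 i = 0}.
  have [gl gi] := ug i; have [hl hi] := uh i.
  apply: orthogonal_to_tests_ae0.
    move=> K cK KB; have mK := compact_measurable_rV cK.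
    have := integrableB mK (gl K cK KB) (hl K cK KB).
    by [].
  move=> phi tphi.
  have li f : loc_integrable f -> mu.-integrable oball (EFin \o (fun x => f x * phi x)).
    move=> fl; have [_ cK KB] := tphi; set K := closure _ in cK KB.
    have mK := compact_measurable_rV cK.
    have e : EFin \o (fun x => f x * phi x) = (EFin \o (fun x => f x * phi x)) \_ K.
      apply/funext => x; rewrite patchE; case: ifPn => // /negP xK /=.
      congr EFin; apply/eqP; rewrite mulf_eq0; apply/orP; right; apply: contrapT => px.
      by apply: xK; apply/mem_set; apply: subset_closure; apply/negP.
    have [C hC] := continuous_bounded_on_compact cK (test_continuous tphi).
    rewrite e; apply: (integrableS measurableT) => //; first exact: measurable_oball.
    apply/(integrable_mkcond _ mK).
    apply: (Rintegrable_mul_bounded mK (fl K cK KB) _ hC).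
    apply: measurable_funTS; apply: continuous_measurable_rV.
    exact: test_continuous.
  rewrite (_ : (fun x => _) = (fun x => g x ord0 i * phi x - h x ord0 i * phi x)).
    rewrite RintegralB; [|exact: measurable_oball|exact: li|exact: li].
    by apply/eqP; rewrite subr_eq0 -eqr_opp -gi// -hi.
  by apply/funext => x; rewrite mulrBl.
have : {ae mu, forall x, forall i, oball x -> g x ord0 i - h x ord0 i = 0}.
  exact: filter_forall.
apply: filterS => x ghx xB; apply/rowP => i; apply/eqP.
by rewrite -subr_eq0 ghx.
Qed.

Lemma weak_gradient_ae (u v : E -> R) (g : E -> E) :
  {ae mu, forall x, oball x -> u x = v x} ->
  weak_gradient u g -> weak_gradient v g.
Proof.
move=> uv ug i; have [gl gi] := ug i; split => // phi tphi.
rewrite -(gi phi tphi); apply: ae_Rintegral.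
by apply: filterS uv => x h xB; rewrite h.
Qed.

(** By uniqueness, every weak gradient is a representative of [wgrad]. *)
Lemma wgrad_ae (u : E -> R) (g : E -> E) : weak_gradient u g ->
  {ae mu, forall x, oball x -> wgrad u x = g x}.
Proof.
move=> ug; apply: weak_gradient_unique (ug).
by rewrite /wgrad; case: xgetP => [h -> //|/(_ g)].
Qed.

End uniqueness.

(** * Integrals on the line and radial averages *)

Section real_integrals.
Context {R : realType}.
Local Notation lam := (@lebesgue_measure R).
Implicit Types (f F b : R -> R).

Lemma max0_continuous : continuous (fun r : R => Num.max r 0).
Proof.
move=> r; have h1 : {for r, continuous (fun r : R => r)} by exact: cvg_id.
have h2 : {for r, continuous (fun=> 0 : R)} by exact: cvg_cst.
exact: (continuous_max h1 h2).
Qed.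

Lemma integrable_itv_cc f (a c : R) : continuous f ->
  lam.-integrable `[a, c] (EFin \o f).
Proof.
move=> cf; apply: continuous_compact_integrable; first exact: segment_compact.
exact: continuous_subspaceT.
Qed.

Lemma RFTC2 f F (a c : R) : a <= c -> continuous f ->
  (forall x, a < x < c -> is_derive x (1 : R) F (f x)) ->
  {for a, continuous F} -> {for c, continuous F} ->
  \int[lam]_(x in `[a, c]) f x = F c - F a.
Proof.
move=> ac cf dF Fa Fc; move: ac; rewrite le_eqVlt => /predU1P[<-|ac].
  by rewrite set_itv1 Rintegral_set1 subrr.
rewrite /Rintegral (@continuous_FTC2 _ f F)//.
- exact: continuous_subspaceT.
- split.
  + by move=> x; rewrite in_itv/= => /dF[].
  + exact: cvg_at_right_filter.
  + exact: cvg_at_left_filter.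
- by move=> x; rewrite in_itv/= => /dF[_ <-]; rewrite derive1E.
Qed.

Lemma is_derive_continuous f (x d : R) : is_derive x (1 : R) f d ->
  {for x, continuous f}.
Proof.
by move=> [dx _]; apply: differentiable_continuous; exact/derivable1_diffP.
Qed.

Lemma is_derive_integral f (a x : R) : a < x -> continuous f ->
  is_derive x (1 : R) (fun y => \int[lam]_(t in `[a, y]) f t) (f x).
Proof.
move=> ax cf.
have [||d1 d2] := @continuous_FTC1_closed R f a x (x + 1) _ _ ax (cf x).
- by rewrite ltrDl.
- exact: integrable_itv_cc.
split; first exact: d1.
by rewrite -derive1E; exact: d2.
Qed.

Lemma Rintegral_itv_cat f (a c e : R) : continuous f -> a <= c -> c <= e ->
  \int[lam]_(t in `[a, e]) f t =
  \int[lam]_(t in `[a, c]) f t + \int[lam]_(t in `[c, e]) f t.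
Proof.
move=> cf ac ce.
have h := @Rintegral_itvB R f (BLeft a) (BRight e) c (integrable_itv_cc a e cf).
rewrite -[LHS](subrK (\int[lam]_(t in `[a, c]) f t)) h ?bnd_simp// addrC.
congr (_ + _); rewrite Rintegral_itv_obnd_cbnd//.
apply: integrableS (integrable_itv_cc c e cf) => //.
exact: subset_itv_oc_cc.
Qed.

Lemma Rintegral_itv_max f (y : R) :
  \int[lam]_(t in `[0, y]) f t = \int[lam]_(t in `[0, Num.max y 0]) f t.
Proof.
have [y0|y0] := leP 0 y; first by [].
by rewrite set_itv1 Rintegral_set1 set_itv_ge ?Rintegral_set0// bnd_simp -ltNge.
Qed.

Lemma continuous_integral0 f : continuous f ->
  continuous (fun y : R => \int[lam]_(t in `[0, y]) f t).
Proof.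
move=> cf y.
pose G (y : R) := \int[lam]_(t in `[-1, y]) f t.
have -> : (fun y : R => \int[lam]_(t in `[0, y]) f t) = (fun y => G (Num.max y 0) - G 0).
  apply/funext => s; rewrite Rintegral_itv_max /G.
  rewrite (@Rintegral_itv_cat f (-1) 0 (Num.max s 0))//.
    by rewrite addrAC subrr add0r.
  by rewrite le_max lexx orbT.
apply: cvgB; last exact: cvg_cst.
apply: (@continuous_comp _ _ _ (fun r : R => Num.max r 0) G).
  exact: max0_continuous.
apply: (@is_derive_continuous G _ (f (Num.max y 0))); apply: is_derive_integral => //.
by rewrite lt_max orbC ltrN10.
Qed.

Lemma antiderivative f (a : R) : continuous f -> (forall t, t <= a -> f t = 0) ->
  exists F, forall t, is_derive t (1 : R) F (f t).
Proof.
move=> cf f0; exists (fun y => \int[lam]_(t in `[a - 1, y]) f t) => t.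
have [ta|ta] := ltP t a; last first.
  by apply: is_derive_integral => //; rewrite ltrBlDr (le_lt_trans ta)// ltrDl.
rewrite f0 ?ltW//.
have dc : is_derive t (1 : R) (cst 0 : R -> R) 0 by exact: is_derive_cst.
apply: near_eq_is_derive dc; near=> y.
have ya : y <= a by near: y; exact: lt_le_nbhsl.
rewrite (@eq_Rintegral _ _ _ _ _ (fun=> 0)) ?Rintegral_cst ?mul0r// => s.
by rewrite inE/= in_itv/= => /andP[_ sy]; rewrite f0// (le_trans sy).
Unshelve. all: by end_near. Qed.

Lemma integral_expr (n : nat) (r : R) : 0 <= r ->
  \int[lam]_(t in `[0, r]) (t ^+ n) = r ^+ n.+1 / n.+1%:R.
Proof.
move=> r0.
have d (x : R) : is_derive x (1 : R) (fun t => t ^+ n.+1 / n.+1%:R) (x ^+ n).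
  have h := is_deriveX n.+1 (is_derive_id x (1 : R)).
  rewrite exprfctE in h.
  have := is_deriveM h (is_derive_cst ((n.+1%:R)^-1 : R) x (1 : R)).
  move=> h2; apply: (is_derive_eq h2); rewrite /GRing.scale/= mulr0 add0r mulr1.
  by rewrite mulrA mulVf// mul1r.
rewrite (@RFTC2 _ (fun t => t ^+ n.+1 / n.+1%:R))//.
- by rewrite expr0n/= mul0r subr0.
- by move=> x; exact: exprn_continuous.
- exact: is_derive_continuous.
- exact: is_derive_continuous.
Qed.

Section radial_average.
Variables (N : nat) (N0 : (0 < N)%N).

(** N times [radavg b r] is the mean of the radial function b(|x|) over the ball
    of radius r of R^N; then x * radavg b |x| is a vector field with divergence
    b(|x|). *)
Definition radint b (r : R) : R := \int[lam]_(s in `[0, r]) (s ^+ N.-1 * b s).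
Definition radavg b (r : R) : R := radint b r / r ^+ N.

Lemma continuous_weight b : continuous b -> continuous (fun s : R => s ^+ N.-1 * b s).
Proof.
by move=> cb s; apply: cvgM; [exact: exprn_continuous|exact: cb].
Qed.

Lemma is_derive_radint b (r : R) : continuous b -> 0 < r ->
  is_derive r (1 : R) (radint b) (r ^+ N.-1 * b r).
Proof.
move=> cb r0.
by apply: (@is_derive_integral (fun s => s ^+ N.-1 * b s)) => //; exact: continuous_weight.
Qed.

Lemma continuous_radint b : continuous b -> continuous (radint b).
Proof.
move=> cb; apply: (@continuous_integral0 (fun s => s ^+ N.-1 * b s)).
exact: continuous_weight.
Qed.

(** The quotient need not be continuous at 0, so it is written as a limit of
    continuous ones. *)
Lemma measurable_radavg b : continuous b -> measurable_fun setT (radavg b).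
Proof.
move=> cb; have cX n : continuous (fun r : R => r ^+ n) by exact: exprn_continuous.
apply: (@measurable_fun_cvg _ _ _ _
  (fun k r => radint b r / (`|r ^+ N| + harmonic k))) => [k|r _].
  apply: continuous_measurable_fun => r; apply: cvgM.
    exact: continuous_radint.
  apply: cvgV; first by rewrite gt_eqF// ltr_wpDl// /harmonic/= invr_gt0.
  apply: cvgD; last exact: cvg_cst.
  by apply: cvg_norm; exact: cX.
have [r0|r0] := leP r 0.
  have J0 : radint b r = 0.
    rewrite /radint; move: r0; rewrite le_eqVlt => /predU1P[->|r0].
      by rewrite set_itv1 Rintegral_set1.
    by rewrite set_itv_ge ?Rintegral_set0// bnd_simp -ltNge.
  by rewrite /radavg J0 mul0r; under eq_fun do rewrite mul0r; exact: cvg_cst.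
have rN : 0 < r ^+ N by rewrite exprn_gt0.
apply: cvgM; first exact: cvg_cst.
apply: cvgV; first by rewrite gt_eqF.
rewrite (gtr0_norm rN) -[X in _ --> X]addr0; apply: cvgD; first exact: cvg_cst.
exact: cvg_harmonic.
Qed.

Lemma radint_bound b (r M : R) : continuous b -> 0 <= r ->
  (forall s, 0 <= s <= r -> `|b s| <= M) -> `|radint b r| <= M * (r ^+ N / N%:R).
Proof.
move=> cb r0 bM; have cw := continuous_weight cb.
have wi := integrable_itv_cc 0 r cw.
have ei := integrable_itv_cc 0 r (@exprn_continuous R N.-1).
apply: (le_trans (le_normr_Rintegral _ wi)) => //.
rewrite -[in X in _ <= X](prednK N0) -integral_expr// -RintegralZl//.
apply: le_Rintegral => //.
- exact: Rintegrable_norm.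
- exact: RintegrableZ.
- move=> s; rewrite /= in_itv/= => /andP[s0 sr].
  rewrite normrM ger0_norm ?exprn_ge0// mulrC ler_wpM2r ?exprn_ge0//.
  by rewrite bM// s0 sr.
Qed.

Lemma radavg_bound b (r M : R) : continuous b -> 0 <= M -> 0 <= r ->
  (forall s, 0 <= s <= r -> `|b s| <= M) -> `|radavg b r| <= M / N%:R.
Proof.
move=> cb M0 r0 bM; rewrite /radavg normrM normfV [X in _ / X]ger0_norm ?exprn_ge0//.
move: r0; rewrite le_eqVlt => /predU1P[<-|r0].
  by rewrite expr0n (gtn_eqF N0)/= invr0 mulr0 divr_ge0.
rewrite ler_pdivrMr ?exprn_gt0// mulrAC -mulrA.
by apply: radint_bound => //; exact: ltW.
Qed.

Lemma is_derive_radavg b (r : R) : continuous b -> 0 < r ->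
  is_derive r (1 : R) (radavg b) ((b r - N%:R * radavg b r) / r).
Proof.
move=> cb r0; have rn0 : r != 0 by rewrite gt_eqF.
have rN0 : r ^+ N != 0 by rewrite expf_neq0.
have dX : is_derive r (1 : R) (fun t => t ^+ N) (N%:R * r ^+ N.-1).
  have h := is_deriveX N (is_derive_id r (1 : R)).
  by rewrite exprfctE in h; apply: (is_derive_eq h); rewrite /GRing.scale/= mulr1.
have dV : is_derive r (1 : R) (fun t => (t ^+ N)^-1) (- (r ^+ N) ^- 2 * (N%:R * r ^+ N.-1)).
  have [d1 d2] := dX; split; first exact: (@derivableV _ _ (fun t : R => t ^+ N)).
  by rewrite (@deriveV _ _ (fun t : R => t ^+ N))// d2.
have h := is_deriveM (is_derive_radint cb r0) dV.
apply: (is_derive_eq h); rewrite /GRing.scale/= /radavg.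
have eN : r ^+ N = r * r ^+ N.-1 by rewrite -exprS prednK.
have : r ^+ N.-1 != 0 by rewrite expf_neq0.
rewrite eN; move: (r ^+ N.-1) (N%:R) (radint b r) (b r) => y M j c y0.
by field; rewrite rn0 y0.
Qed.

Lemma continuous_radavg b (r : R) : continuous b -> 0 < r ->
  {for r, continuous (radavg b)}.
Proof. by move=> cb r0; exact: is_derive_continuous (is_derive_radavg cb r0). Qed.

End radial_average.
End real_integrals.

(** * The weak divergence theorem for radial fields *)

Section divergence.
Context {R : realType} {N : nat}.
Local Notation E := 'rV[R]_N.
Local Notation mu := (@lebesgue_rV R N).
Local Notation lam := (@lebesgue_measure R).
Local Notation I01 := (`[(0 : R), (1 : R)[%classic).
Hypothesis N0 : (0 < N)%N.

Lemma continuous_sqn : continuous (fun x : E => dotv x x).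
Proof.
move=> x; apply: (@cvg_sumR _ _ (nbhs x)) => i.
by apply: cvgM; exact: coor_continuous.
Qed.

Lemma dotv_itv (x : E) : oball x -> I01 (dotv x x).
Proof.
move=> xB; rewrite /= in_itv/= dotv_ge0 -sqr_enorm/= expr_lt1//.
exact: enorm_ge0.
Qed.

Lemma dotv_line (x : E) i (t : R) :
  dotv (x + t *: delta_mx ord0 i) (x + t *: delta_mx ord0 i) =
  dotv x x + (2 * x ord0 i) * t + t ^+ 2.
Proof.
have dx (y : E) : dotv y (delta_mx ord0 i) = y ord0 i.
  rewrite /dotv (bigD1 i)//= mxE !eqxx mulr1 big1 ?addr0// => j ji.
  by rewrite mxE eqxx (negbTE ji) mulr0.
rewrite dotvDl !dotvDr dotvZl !dotvZr (dotvC (delta_mx _ _) x) !dx.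
by rewrite !mxE !eqxx/= mulr1; ring.
Qed.

Lemma is_derive_sqn_line (x : E) i :
  is_derive (0 : R) (1 : R)
    (fun t : R => dotv (x + t *: delta_mx ord0 i) (x + t *: delta_mx ord0 i))
    (2 * x ord0 i).
Proof.
under eq_fun do rewrite dotv_line.
apply: (@is_derive_sqr_bound _ _ _ _ 1 1) => // h _.
rewrite addr0 mulr0 expr0n/= !addr0 mul1r.
rewrite (_ : _ - _ - _ = h ^+ 2); last by ring.
by rewrite ger0_norm// sqr_ge0.
Qed.

Lemma smoothN_sum (I : Type) (r : seq I) (f : I -> E -> R) :
  (forall i, smoothN (f i)) -> smoothN (fun x => \sum_(i <- r) f i x).
Proof.
move=> sf; elim: r => [|i r IH].
  by under eq_fun do rewrite big_nil; exact: smoothN_cst.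
by under eq_fun do rewrite big_cons; exact: smoothN_add.
Qed.

Lemma smoothN_sqn : smoothN (fun x : E => dotv x x).
Proof. by apply: smoothN_sum => i; apply: smoothN_mul; exact: smoothN_coor. Qed.

Variables (v : E -> R) (g : E -> E).
Hypothesis vg : weak_gradient v g.
Hypothesis vi : mu.-integrable oball (EFin \o v).
Hypothesis gi : forall i, mu.-integrable oball (EFin \o (fun x => g x ord0 i)).

Let mB := @measurable_oball R N.

Lemma integrable_radial_part : mu.-integrable oball (EFin \o (fun x => dotv (g x) x)).
Proof.
apply: Rintegrable_sum => // i; apply: (@Rintegrable_mul_bounded _ _ _ _ _ mB _ _ 1) => //.
  by apply: measurable_funTS; exact: measurable_rV_coorE.
by move=> x /ltW x1; rewrite (le_trans (normr_coor_le x i)).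
Qed.

Definition tail (c : R -> R) (r : R) : R := - \int[lam]_(s in `[r, (1 : R)[) c s.

(** The weak divergence theorem for the field C(|x|^2) x, where C' = c and
    C(1) = 0. It holds for smooth c by the definition of the weak gradient, and
    the functions c that satisfy it are closed under bounded limits. *)
Definition flux_identity (c : R -> R) : Prop :=
  [/\ measurable_fun I01 c,
      exists M, forall r, I01 r -> `|c r| <= M,
      measurable_fun oball (fun x : E => tail c (dotv x x)) &
      \int[mu]_(x in oball)
        (v x * (N%:R * tail c (dotv x x) + 2 * dotv x x * c (dotv x x))) +
      \int[mu]_(x in oball) (dotv (g x) x * tail c (dotv x x)) = 0].

Lemma measurable_comp_sqn (c : R -> R) : measurable_fun I01 c ->
  measurable_fun oball (fun x : E => c (dotv x x)).
Proof.
move=> mc; apply: (measurable_comp (F := I01)) => //.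
- by move=> _ [x xB <-]; exact: dotv_itv.
- by apply: measurable_funTS; apply: continuous_measurable_rV; exact: continuous_sqn.
Qed.

Let itv_fin (r : R) : (lam (`[r, 1%R[%classic) < +oo)%E.
Proof. by rewrite lebesgue_measure_itv/=; case: ifP => _; rewrite ?ltry. Qed.

Let itv_sub (r : R) : 0 <= r -> `[r, (1 : R)[%classic `<=` I01.
Proof.
by move=> r0 s; rewrite /= !in_itv/= => /andP[rs ->]; rewrite (le_trans r0).
Qed.

Let integrable_tail (c : R -> R) (r M : R) : 0 <= r -> measurable_fun I01 c ->
  (forall r, I01 r -> `|c r| <= M) ->
  lam.-integrable `[r, (1 : R)[ (EFin \o c).
Proof.
move=> r0 mc cM; apply: (@integrable_bounded _ _ _ _ _ _ M).
- exact: measurable_itv.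
- exact: itv_fin.
- by apply: measurable_funS mc => //; exact: itv_sub.
- by move=> s /(itv_sub r0); exact: cM.
Qed.

Lemma tail_bound (c : R -> R) (r M : R) : 0 <= r -> r <= 1 -> measurable_fun I01 c ->
  (forall r, I01 r -> `|c r| <= M) -> `|tail c r| <= M.
Proof.
move=> r0 r1 mc cM; rewrite /tail normrN.
have M0 : 0 <= M by apply: le_trans (cM 0 _) => //; rewrite /= in_itv/= lexx ltr01.
have ci := integrable_tail r0 mc cM.
apply: (le_trans (le_normr_Rintegral _ ci)) => //.
have e := @lebesgue_measure_itv R `[r, (1 : R)[; rewrite /= lte_fin in e.
apply: (@le_trans _ _ (\int[lam]_(t in `[r, (1 : R)[) M)).
  apply: le_Rintegral => //.
  - exact: Rintegrable_norm.
  - by apply: (@integrable_bounded _ _ _ _ _ _ `|M|) => //; exact: itv_fin.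
  - by move=> s /(itv_sub r0); exact: cM.
rewrite Rintegral_cst// [X in fine X]e ler_piMr//.
by case: ifP => _ //=; rewrite gerBl.
Qed.

Let integrable_v (f : E -> R) C : measurable_fun oball f -> (forall x, oball x -> `|f x| <= C) ->
  mu.-integrable oball (EFin \o (fun x => v x * f x)).
Proof. by move=> mf fC; exact: Rintegrable_mul_bounded fC. Qed.

Let integrable_gx (f : E -> R) C : measurable_fun oball f -> (forall x, oball x -> `|f x| <= C) ->
  mu.-integrable oball (EFin \o (fun x => dotv (g x) x * f x)).
Proof.
by move=> mf fC; apply: Rintegrable_mul_bounded fC => //; exact: integrable_radial_part.
Qed.

Let measurable_sqn : measurable_fun oball (fun x : E => dotv x x).
Proof. by apply: measurable_funTS; apply: continuous_measurable_rV; exact: continuous_sqn. Qed.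

Let measurable_flux (c : R -> R) : measurable_fun I01 c ->
  measurable_fun oball (fun x : E => tail c (dotv x x)) ->
  measurable_fun oball
    (fun x : E => N%:R * tail c (dotv x x) + 2 * dotv x x * c (dotv x x)).
Proof.
move=> mc mt; apply: measurable_funD; first exact: measurable_funM.
apply: measurable_funM; last exact: measurable_comp_sqn.
exact: measurable_funM.
Qed.

Let flux_bound (c : R -> R) (M : R) (x : E) : oball x -> measurable_fun I01 c ->
  (forall r, I01 r -> `|c r| <= M) ->
  `|N%:R * tail c (dotv x x) + 2 * dotv x x * c (dotv x x)| <= N%:R * M + 2 * M.
Proof.
move=> xB mc cM; have := dotv_itv xB; rewrite /= in_itv/= => /andP[q0 q1].
apply: (le_trans (ler_normD _ _)); apply: lerD.
  by rewrite normrM ger0_norm// ler_wpM2l// tail_bound// ltW.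
rewrite !normrM (ger0_norm q0) (ger0_norm (_ : 0 <= 2))// -mulrA ler_wpM2l//.
apply: (@le_trans _ _ (1 * `|c (dotv x x)|)); first by rewrite ler_wpM2r// ltW.
by rewrite mul1r cM// /= in_itv/= q0.
Qed.

Lemma flux_identity_cvg (c_ : nat -> R -> R) (c : R -> R) (M : R) :
  (forall k, flux_identity (c_ k)) ->
  (forall k r, I01 r -> `|c_ k r| <= M) ->
  (forall r, I01 r -> c_ ^~ r @ \oo --> c r) ->
  flux_identity c.
Proof.
move=> fc cM cc.
have mc_ k : measurable_fun I01 (c_ k) by have [] := fc k.
have mc : measurable_fun I01 c by exact: measurable_fun_cvg mc_ cc.
have cM' r : I01 r -> `|c r| <= M.
  move=> r01; apply: (closed_cvg (fun y => y <= M) (@closed_le _ M) _ _ (cvg_norm (cc r r01))).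
  by apply: nearW => k; exact: cM.
have tc r : 0 <= r -> tail (c_ k) r @[k --> \oo] --> tail c r.
  move=> r0; apply: cvgN; apply: (Rintegral_cvg (g := fun=> M)) => //.
  - by move=> k; apply: measurable_funS (mc_ k) => //; exact: itv_sub.
  - by apply: measurable_funS mc => //; exact: itv_sub.
  - by apply: (@integrable_bounded _ _ _ _ _ _ `|M|) => //; exact: itv_fin.
  - by apply: aeW => s /(itv_sub r0); exact: cc.
  - by move=> k s /(itv_sub r0); exact: cM.
have mt : measurable_fun oball (fun x : E => tail c (dotv x x)).
  apply: (@measurable_fun_cvg _ _ _ _ (fun k x => tail (c_ k) (dotv x x))).
    by move=> k; have [] := fc k.
  by move=> x xB; apply: tc; exact: dotv_ge0.
split => //; first by exists M.
have h1 : \int[mu]_(x in oball)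
    (v x * (N%:R * tail (c_ k) (dotv x x) + 2 * dotv x x * c_ k (dotv x x)))
    @[k --> \oo] --> \int[mu]_(x in oball)
    (v x * (N%:R * tail c (dotv x x) + 2 * dotv x x * c (dotv x x))).
  apply: (Rintegral_cvg (g := fun x => (N%:R * M + 2 * M) * `|v x|)) => //.
  - move=> k; apply: measurable_funM; first exact: Rintegrable_measurable vi.
    by apply: measurable_flux => //; have [] := fc k.
  - apply: measurable_funM; first exact: Rintegrable_measurable vi.
    exact: measurable_flux.
  - by apply: RintegrableZ => //; exact: Rintegrable_norm.
  - apply: aeW => x xB; have x01 := dotv_itv xB.
    apply: cvgM; first exact: cvg_cst.
    apply: cvgD; first by apply: cvgM; [exact: cvg_cst|apply: tc; exact: dotv_ge0].
    by apply: cvgM; [exact: cvg_cst|exact: cc].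
  - move=> k x xB; rewrite normrM mulrC ler_wpM2r//.
    by apply: flux_bound => // r; exact: cM.
have h2 : \int[mu]_(x in oball) (dotv (g x) x * tail (c_ k) (dotv x x))
    @[k --> \oo] --> \int[mu]_(x in oball) (dotv (g x) x * tail c (dotv x x)).
  apply: (Rintegral_cvg (g := fun x => M * `|dotv (g x) x|)) => //.
  - move=> k; apply: measurable_funM; first exact: Rintegrable_measurable integrable_radial_part.
    by have [] := fc k.
  - by apply: measurable_funM; first exact: Rintegrable_measurable integrable_radial_part.
  - by apply: RintegrableZ => //; apply: Rintegrable_norm; exact: integrable_radial_part.
  - apply: aeW => x xB; apply: cvgM; first exact: cvg_cst.
    by apply: tc; exact: dotv_ge0.
  - move=> k x xB; rewrite normrM mulrC ler_wpM2r//.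
    have := dotv_itv xB; rewrite /= in_itv/= => /andP[q0 q1].
    by apply: tail_bound => //; [exact: ltW|move=> r; exact: cM].
apply: (cvg_cst_eq _ (cvgD h1 h2)) => k.
by have [] := fc k.
Qed.

Lemma flux_identity_lin (c1 c2 : R -> R) (a : R) :
  flux_identity c1 -> flux_identity c2 ->
  flux_identity (fun r => c1 r + a * c2 r).
Proof.
move=> [m1 [M1 b1] t1 e1] [m2 [M2 b2] t2 e2].
have tE r : 0 <= r -> tail (fun r => c1 r + a * c2 r) r = tail c1 r + a * tail c2 r.
  move=> r0; have i1 := integrable_tail r0 m1 b1; have i2 := integrable_tail r0 m2 b2.
  rewrite /tail RintegralD//; last exact: RintegrableZ.
  by rewrite RintegralZl// opprD mulrN.
have tEx (x : E) : tail (fun r => c1 r + a * c2 r) (dotv x x) = tail c1 (dotv x x) + a * tail c2 (dotv x x).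
  by apply: tE; exact: dotv_ge0.
split.
- by apply: measurable_funD => //; apply: measurable_funM.
- exists (M1 + `|a| * M2) => r r01; rewrite (le_trans (ler_normD _ _))// lerD// ?b1//.
  by rewrite normrM ler_wpM2l// b2.
- under eq_fun do rewrite tEx.
  by apply: measurable_funD => //; apply: measurable_funM.
have iv (c : R -> R) M : measurable_fun I01 c -> (forall r, I01 r -> `|c r| <= M) ->
    measurable_fun oball (fun x : E => tail c (dotv x x)) ->
    mu.-integrable oball (EFin \o (fun x : E => v x * (N%:R * tail c (dotv x x) + 2 * dotv x x * c (dotv x x)))).
  move=> mc cM mt; apply: (@integrable_v _ (N%:R * M + 2 * M)).
    exact: measurable_flux.
  by move=> x xB; exact: flux_bound.
have ig (c : R -> R) M : measurable_fun I01 c -> (forall r, I01 r -> `|c r| <= M) ->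
    measurable_fun oball (fun x : E => tail c (dotv x x)) ->
    mu.-integrable oball (EFin \o (fun x : E => dotv (g x) x * tail c (dotv x x))).
  move=> mc cM mt; apply: (@integrable_gx _ M) => // x xB.
  have := dotv_itv xB; rewrite /= in_itv/= => /andP[q0 q1].
  by apply: tail_bound => //; exact: ltW.
have iv1 := iv _ _ m1 b1 t1; have iv2 := iv _ _ m2 b2 t2.
have ig1 := ig _ _ m1 b1 t1; have ig2 := ig _ _ m2 b2 t2.
have -> : (fun x : E => dotv (g x) x * tail (fun r => c1 r + a * c2 r) (dotv x x)) =
    (fun x : E => dotv (g x) x * tail c1 (dotv x x) + a * (dotv (g x) x * tail c2 (dotv x x))).
  by apply/funext => x; rewrite tEx; ring.
have -> : (fun x : E => v x * (N%:R * tail (fun r => c1 r + a * c2 r) (dotv x x) + 2 * dotv x x * (c1 (dotv x x) + a * c2 (dotv x x)))) =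
    (fun x : E => v x * (N%:R * tail c1 (dotv x x) + 2 * dotv x x * c1 (dotv x x)) +
      a * (v x * (N%:R * tail c2 (dotv x x) + 2 * dotv x x * c2 (dotv x x)))).
  by apply/funext => x; rewrite tEx; ring.
rewrite !RintegralD ?RintegralZl//; try exact: RintegrableZ.
by rewrite addrACA e1 -mulrDr e2 mulr0 addr0.
Qed.

Lemma smooth1_continuous (c : R -> R) : smooth1 c -> continuous c.
Proof.
by move=> /smooth1_derive[c' _ dc] x; exact: is_derive_continuous (dc x).
Qed.

(** With eta the antiderivative of c that vanishes at 1, eta(|x|^2) x_i is a test
    function, since eta is zero near 1; the identity is the sum over i of the
    equations that define the weak gradient. Since c also vanishes far to the left,
    it has an antiderivative on the whole line. *)
Lemma flux_identity_smooth (c : R -> R) (e : R) : smooth1 c -> 0 < e ->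
  (forall t, t <= -1 -> c t = 0) -> (forall t, 1 - e <= t -> c t = 0) ->
  flux_identity c.
Proof.
move=> sc e0 cl cr; have cc := smooth1_continuous sc.
have [F dF] := antiderivative cc cl.
have cF : continuous F by move=> x; exact: is_derive_continuous (dF x).
have RF (a b : R) : a <= b -> \int[lam]_(x in `[a, b]) c x = F b - F a.
  by move=> ab; apply: RFTC2 => //; exact: cF.
have zint (a b : R) : 1 - e <= a -> a <= b -> F b = F a.
  move=> ea ab; apply/eqP; rewrite -subr_eq0 -RF//.
  rewrite (@eq_Rintegral _ _ _ _ _ (fun=> 0)) ?Rintegral_cst ?mul0r// => s.
  by rewrite inE/= in_itv/= => /andP[sa _]; rewrite cr// (le_trans ea).
pose eta r := F r + - F 1.
have etaE r : 1 - e <= r -> eta r = 0.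
  move=> er; rewrite /eta; case: (leP r 1) => r1.
    by rewrite (zint r 1)// subrr.
  have e1 : 1 - e <= 1 by rewrite gerBl ltW.
  by rewrite (zint 1 r e1 (ltW r1)) subrr.
have seta : smooth1 eta.
  apply: (@smooth1_prim _ c) => // t.
  by have := is_deriveD (dF t) (is_derive_cst (- F 1 : R) t (1 : R)); rewrite addr0.
have deta t : is_derive t (1 : R) eta (c t).
  by have := is_deriveD (dF t) (is_derive_cst (- F 1 : R) t (1 : R)); rewrite addr0.
have ceta := smooth1_continuous seta.
have tailE r : r <= 1 -> tail c r = eta r.
  move=> r1; rewrite /tail Rintegral_itv_bndo_bndc; last first.
    apply: integrableS (integrable_itv_cc r 1 cc) => //.
    exact: subset_itv_co_cc.
  by rewrite RF// opprB.
have tailEx (x : E) : oball x -> tail c (dotv x x) = eta (dotv x x).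
  by move=> /dotv_itv; rewrite /= in_itv/= => /andP[_ /ltW /tailE].
pose phi (i : 'I_N) (x : E) := eta (dotv x x) * x ord0 i.
have tphi i : test_function (phi i).
  apply: (smoothN_test (K := [set x | dotv x x <= 1 - e])).
  - apply: smoothN_mul; last exact: smoothN_coor.
    by apply: (smoothN_comp (h := eta)) => //; exact: smoothN_sqn.
  - have := continuous_sqn => /continuous_closedP /(_ _ (@closed_le R (1 - e))).
    by [].
  - move=> x /= xe; rewrite /oball/= -(@expr_lt1 _ 2) ?enorm_ge0// sqr_enorm.
    by rewrite (le_lt_trans xe)// gtrBl.
  - move=> x /= /negP; rewrite -ltNge => /ltW xe.
    by rewrite /phi etaE ?mul0r.
have pphi i x : partial i (phi i) x = eta (dotv x x) + 2 * x ord0 i ^+ 2 * c (dotv x x).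
  rewrite /partial; apply: derive_val.
  apply: derive_line.
  have d1 : is_derive (0 : R) (1 : R) (fun t : R => eta (dotv (x + t *: delta_mx ord0 i) (x + t *: delta_mx ord0 i)))
      (c (dotv x x) * (2 * x ord0 i)).
    apply: (@is_derive1_comp R eta (fun t : R => dotv (x + t *: delta_mx ord0 i) (x + t *: delta_mx ord0 i))).
      by rewrite scale0r addr0; exact: deta.
    exact: is_derive_sqn_line.
  have d2 : is_derive (0 : R) (1 : R) (fun t : R => (x + t *: delta_mx ord0 i) ord0 i) 1.
    have -> : (fun t : R => (x + t *: delta_mx ord0 i) ord0 i) = (fun t => t + x ord0 i).
      by apply/funext => t; rewrite !mxE !eqxx mulr1 addrC.
    by have := is_deriveD (is_derive_id (0 : R) (1 : R)) (is_derive_cst (x ord0 i) (0 : R) (1 : R)); rewrite addr0.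
  have h := is_deriveM d1 d2; apply: (is_derive_eq h).
  by rewrite !scale0r !addr0 /GRing.scale/=; ring.
have mc : measurable_fun I01 c.
  by apply: measurable_funTS; exact: continuous_measurable_fun.
have mt : measurable_fun oball (fun x : E => tail c (dotv x x)).
  apply: (eq_measurable_fun (fun x : E => eta (dotv x x))).
    by move=> x /set_mem xB; rewrite tailEx.
  apply: measurable_funTS; apply: continuous_measurable_rV => x.
  apply: (@continuous_comp _ _ _ (fun x : E => dotv x x) eta); first exact: continuous_sqn.
  exact: ceta.
have [C cC] : exists C, forall r, I01 r -> `|c r| <= C.
  have /compact_bounded[C [_ hC]] : compact (c @` `[0 : R, 1]).
    by apply: continuous_compact; [exact: continuous_subspaceT|exact: segment_compact].
  exists (C + 1) => r; rewrite /= in_itv/= => /andP[r0 r1].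
  apply: (hC (C + 1)); first by rewrite ltrDl.
  by exists r => //=; rewrite in_itv/= r0 ltW.
split => //; first by exists C.
have -> : \int[mu]_(x in oball) (v x * (N%:R * tail c (dotv x x) + 2 * dotv x x * c (dotv x x))) =
    \int[mu]_(x in oball) (\sum_(i < N) v x * partial i (phi i) x).
  apply: eq_Rintegral => x /set_mem xB; rewrite -mulr_sumr; congr (_ * _).
  under eq_bigr do rewrite pphi.
  rewrite big_split/= sumr_const card_ord tailEx//; congr (_ + _).
    by rewrite mulr_natl.
  by rewrite -mulr_suml -mulr_sumr; congr (2 * _ * _).
have -> : \int[mu]_(x in oball) (dotv (g x) x * tail c (dotv x x)) =
    \int[mu]_(x in oball) (\sum_(i < N) g x ord0 i * phi i x).
  apply: eq_Rintegral => x /set_mem xB; rewrite tailEx// /dotv mulr_suml.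
  by apply: eq_bigr => i _; rewrite /phi /dotv; ring.
have cont_int (f h : E -> R) : mu.-integrable oball (EFin \o f) -> continuous h ->
    mu.-integrable oball (EFin \o (fun x => f x * h x)).
  move=> fi ch; have [C' hC'] := continuous_bounded_on_compact cball_compact ch.
  apply: (@Rintegrable_mul_bounded _ _ _ _ _ mB _ _ C') => //.
    by apply: measurable_funTS; exact: continuous_measurable_rV.
  by move=> x /oball_cball; exact: hC'.
rewrite !Rintegral_sum//.
- rewrite -big_split/= big1// => i _.
  by have [_ ->//] := vg i; rewrite addNr.
- by move=> i; apply: cont_int => //; exact: test_continuous.
- by move=> i; apply: cont_int => //; exact: test_partial_continuous.
Qed.

Let indic_bound (A : set R) (r : R) : `|\1_A r| <= (1 : R).
Proof. by rewrite indicE; case: (_ \in _); rewrite ?normr1 ?normr0. Qed.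

Let flux_identity_oo (a b : R) : -1 <= a -> b < 1 -> flux_identity (\1_(`]a, b[)).
Proof.
move=> a1 b1.
pose c_ (k : nat) (t : R) := flat 0 (k.+1%:R * (t - a)) * flat 0 (k.+1%:R * (b - t)).
apply: (@flux_identity_cvg c_ _ 1).
- move=> k; apply: (@flux_identity_smooth _ (1 - b)).
  + apply: smooth1_mul; apply: smooth1_flat; apply: smooth1_mul;
      try exact: smooth1_cst; apply: smooth1_add; try exact: smooth1_cst.
      exact: smooth1_id.
    have -> : -%R = (fun t : R => -1 * t) by apply/funext => t; rewrite mulN1r.
    by apply: smooth1_mul; [exact: smooth1_cst|exact: smooth1_id].
  + by rewrite subr_gt0.
  + move=> t t1; rewrite /c_ (@flat_le0 _ 0 (_ * (t - a))) ?mul0r// mulr_ge0_le0// subr_le0.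
    exact: le_trans a1.
  + move=> t; rewrite subKr => bt.
    by rewrite /c_ (@flat_le0 _ 0 (_ * (b - t))) ?mulr0// mulr_ge0_le0// subr_le0.
- move=> k r _; rewrite ger0_norm ?mulr_ge0 ?flat_ge0//.
  by rewrite mulr_ile1 ?flat_ge0// flat0_le1.
- move=> r _; rewrite indicE; case: (boolP (r \in _)).
    move=> /set_mem; rewrite /= in_itv/= => /andP[ar rb].
    by rewrite -[X in _ --> X](mulr1 1); apply: cvgM; apply: flat0_cvg1; rewrite subr_gt0.
  move=> /negP rab; apply: cvg_near_cst; apply: nearW => k.
  have [ra|ar] := leP r a.
    by rewrite /c_ (@flat_le0 _ 0 (_ * (r - a))) ?mul0r// mulr_ge0_le0// subr_le0.
  rewrite /c_ (@flat_le0 _ 0 (_ * (b - r))) ?mulr0// mulr_ge0_le0// subr_le0 leNgt.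
  by apply/negP => rb; apply: rab; apply/mem_set; rewrite /= in_itv/= ar rb.
Qed.

Let flux_identity_co (a b : R) : 0 <= a -> b <= 1 -> flux_identity (\1_(`[a, b[)).
Proof.
move=> a0 b1.
have h0 (x y : R) : x < y -> \forall k \near \oo, x + harmonic k < y.
  move=> xy; have := @cvg_harmonic R => /cvgrPdist_lt /(_ (y - x)).
  rewrite subr_gt0 => /(_ xy); apply: filterS => k.
  by rewrite sub0r normrN /harmonic/= ger0_norm ?invr_ge0// ltrBrDl.
apply: (@flux_identity_cvg (fun k => \1_(`]a - harmonic k, b - harmonic k[)) _ 1).
- move=> k; apply: flux_identity_oo.
    have : harmonic k <= (1 : R) by rewrite /harmonic/= invf_le1// ler1n.
    by lra.
  have : (0 : R) < harmonic k by rewrite /harmonic/= invr_gt0.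
  by lra.
- by move=> k r _; exact: indic_bound.
- move=> r _; rewrite [X in _ --> X]indicE; case: (boolP (r \in _)).
    move=> /set_mem; rewrite /= in_itv/= => /andP[ar rb].
    apply: cvg_near_cst; apply: filterS (h0 _ _ rb) => k hk.
    rewrite indicE mem_set//= in_itv/=.
    have : (0 : R) < harmonic k by rewrite /harmonic/= invr_gt0.
    by move: hk; rewrite /harmonic/=; move: (k.+1%:R^-1) => y; lra.
  move=> /negP rab; have [ra|ar] := ltP r a.
    apply: cvg_near_cst; apply: filterS (h0 _ _ ra) => k hk.
    rewrite indicE memNset//= in_itv/= => /andP[+ _].
    by move: hk; rewrite /harmonic/=; move: (k.+1%:R^-1) => y; lra.
  apply: cvg_near_cst; apply: nearW => k; rewrite indicE memNset//= in_itv/= => /andP[_ rb].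
  apply: rab; apply/mem_set; rewrite /= in_itv/= ar (lt_le_trans rb)//.
  by rewrite gerBl /harmonic/= invr_ge0.
Qed.

Let flux_identity_sum (I : Type) (s : seq I) (a : I -> R) (c : I -> R -> R) :
  (forall i, flux_identity (c i)) ->
  flux_identity (fun r => \sum_(i <- s) a i * c i r).
Proof.
move=> fc; elim: s => [|i s IH].
  have -> : (fun r => \sum_(i <- [::]) a i * c i r) = \1_(`[0 : R, 0 : R[).
    apply/funext => r; rewrite big_nil indicE memNset//= in_itv/= => /andP[r0].
    by rewrite ltNge r0.
  exact: flux_identity_co.
have -> : (fun r => \sum_(j <- i :: s) a j * c j r) =
    (fun r => (\sum_(j <- s) a j * c j r) + a i * c i r).
  by apply/funext => r; rewrite big_cons addrC.
exact: flux_identity_lin.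
Qed.

(** The indicator functions of intervals are bounded limits of smooth bumps, and
    a continuous function is the limit of its step approximations. *)
Lemma flux_identity_continuous (c : R -> R) : continuous c -> flux_identity c.
Proof.
move=> cc.
have [C cC] : exists C, forall r, 0 <= r <= 1 -> `|c r| <= C.
  have /compact_bounded[C [_ hC]] : compact (c @` `[0 : R, 1]).
    by apply: continuous_compact; [exact: continuous_subspaceT|exact: segment_compact].
  exists (C + 1) => r r01; apply: (hC (C + 1)); first by rewrite ltrDl.
  by exists r => //=; rewrite in_itv/=.
pose t k j : R := j%:R / k.+1%:R.
pose c_ k r := \sum_(j < k.+1) c (t k j) * \1_(`[t k j, t k j.+1[) r.
have c_E k r : I01 r -> c_ k r = c (t k (Num.truncn (k.+1%:R * r))).
  rewrite /= in_itv/= => /andP[r0 r1].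
  have k0 : (0 : R) < k.+1%:R by [].
  have kr0 : 0 <= k.+1%:R * r by rewrite mulr_ge0.
  have [/andP[j1 j2]] := (truncn_itv kr0).
  set j := Num.truncn _ in j1 j2 *.
  have jk : (j < k.+1)%N.
    by rewrite -(ltr_nat R) (le_lt_trans j1)// gtr_pMr.
  rewrite /c_ (bigD1 (Ordinal jk))//= indicE mem_set ?mulr1; last first.
    by rewrite /= in_itv/= /t ler_pdivrMr// ltr_pdivlMr// mulrC j1 j2.
  rewrite big1 ?addr0// => i ij; rewrite indicE memNset ?mulr0//= in_itv/= /t.
  rewrite ler_pdivrMr// ltr_pdivlMr// mulrC => /andP[i1 i2].
  have h1 := le_lt_trans i1 j2; have h2 := le_lt_trans j1 i2.
  move: h1 h2; rewrite !ltr_nat !ltnS => h1 h2; case/negP: ij.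
  by apply/eqP/val_inj/eqP; rewrite /= eqn_leq h1 h2.
apply: (@flux_identity_cvg c_ _ C).
- move=> k; apply: (@flux_identity_sum _ _ (fun j : 'I_k.+1 => c (t k j))
    (fun j : 'I_k.+1 => \1_(`[t k j, t k j.+1[))) => j.
  apply: flux_identity_co; first by rewrite divr_ge0.
  by rewrite /t ler_pdivrMr// mul1r ler_nat.
- move=> k r r01; rewrite c_E//; move: r01; rewrite /= in_itv/= => /andP[r0 r1].
  have kr0 : 0 <= k.+1%:R * r by rewrite mulr_ge0.
  have /andP[j1 j2] := truncn_itv kr0.
  apply: cC; rewrite /t divr_ge0//= ler_pdivrMr// mul1r (le_trans j1)//.
  by rewrite ler_piMr// ltW.
- move=> r r01; under eq_fun do rewrite c_E//.
  move: r01; rewrite /= in_itv/= => /andP[r0 r1].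
  suff h : t k (Num.truncn (k.+1%:R * r)) @[k --> \oo] --> r.
    exact: (cvg_comp _ _ h (cc r)).
  apply: (@squeeze_cvgr _ _ _ _ (fun k => r - harmonic k) (fun=> r)).
  + near=> k; have kr0 : 0 <= k.+1%:R * r by rewrite mulr_ge0.
    have /andP[j1 j2] := truncn_itv kr0.
    have k0 : (0 : R) < k.+1%:R by [].
    apply/andP; split; last by rewrite /t ler_pdivrMr// [leRHS]mulrC.
    rewrite /t ler_pdivlMr// mulrBl /harmonic/= mulVf ?gt_eqF//.
    by rewrite lerBlDr natr1 [leLHS]mulrC ltW.
  + rewrite -[X in _ --> X]subr0; apply: cvgB; first exact: cvg_cst.
    exact: cvg_harmonic.
  + exact: cvg_cst.
Unshelve. all: by end_near. Qed.

End divergence.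

Section divergence_radial.
Context {R : realType} {N : nat}.
Local Notation E := 'rV[R]_N.
Local Notation mu := (@lebesgue_rV R N).
Local Notation lam := (@lebesgue_measure R).
Hypothesis N0 : (0 < N)%N.

Lemma ae_neq0 : {ae mu, forall x : E, x != 0}.
Proof.
exists [set x : E | forall i, x ord0 i \in `[0, 0]]; split.
- exact: (@measurable_rV_cube R N (fun=> 0) (fun=> 0)).
- rewrite (@lebesgue_rV_cube R N (fun=> 0) (fun=> 0))//.
  by rewrite (bigD1 (Ordinal N0))//= subrr mul0r.
- move=> x /= /negP; rewrite negbK => /eqP -> i.
  by rewrite mxE in_itv/= lexx.
Qed.

Variables (v : E -> R) (g : E -> E).
Hypothesis vg : weak_gradient v g.
Hypothesis vi : mu.-integrable oball (EFin \o v).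
Hypothesis gi : forall i, mu.-integrable oball (EFin \o (fun x => g x ord0 i)).

Let mB := @measurable_oball R N.

Variables (b : R -> R) (M : R).
Hypothesis cb : continuous b.
Hypothesis bM : forall r, `|b r| <= M.

Let A := radavg N b.
(* As a function of |x|^2 the average A is singular at 0. It is evaluated at
   sqrt(|x|^2 + e) instead, and c is the derivative of A(sqrt(r + e)). *)
Let S (e r : R) : R := Num.sqrt (Num.max r 0 + e).
Let c (e r : R) : R := (b (S e r) - N%:R * A (S e r)) / (2 * (Num.max r 0 + e)).

Let M0 : 0 <= M. Proof. exact: le_trans (bM 0). Qed.

Let A_bound r : 0 <= r -> `|A r| <= M / N%:R.
Proof. by move=> r0; apply: radavg_bound => //. Qed.

Let A_boundM r : 0 <= r -> `|A r| <= M.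
Proof.
move=> r0; apply: (le_trans (A_bound r0)).
by rewrite ler_pdivrMr ?ltr0n// ler_peMr// ler1n.
Qed.

Let NA_bound r : 0 <= r -> `|N%:R * A r| <= M.
Proof.
move=> r0; rewrite normrM ger0_norm// mulrC -ler_pdivlMr ?ltr0n//.
exact: A_bound.
Qed.

Let me_gt0 (e r : R) : 0 < e -> 0 < Num.max r 0 + e.
Proof. by move=> e0; rewrite ltr_wpDl// le_max lexx orbT. Qed.

Let S_gt0 (e r : R) : 0 < e -> 0 < S e r.
Proof. by move=> e0; rewrite sqrtr_gt0 me_gt0. Qed.

Let max_continuous (e : R) : continuous (fun r : R => Num.max r 0 + e).
Proof.
by move=> r; apply: cvgD; [exact: max0_continuous|exact: cvg_cst].
Qed.

Let S_continuous (e : R) : continuous (S e).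
Proof.
move=> r; apply: (@continuous_comp _ _ _ (fun r : R => Num.max r 0 + e) Num.sqrt).
  exact: max_continuous.
exact: sqrt_continuous.
Qed.

Let AS_continuous (e : R) : 0 < e -> continuous (fun r => A (S e r)).
Proof.
move=> e0 r; apply: (@continuous_comp _ _ _ (S e) A); first exact: S_continuous.
by apply: continuous_radavg => //; exact: S_gt0.
Qed.

Let c_continuous (e : R) : 0 < e -> continuous (c e).
Proof.
move=> e0 r; apply: cvgM.
  apply: cvgB.
    by apply: (@continuous_comp _ _ _ (S e) b); [exact: S_continuous|exact: cb].
  by apply: cvgM; [exact: cvg_cst|exact: AS_continuous].
apply: cvgV; first by rewrite gt_eqF// mulr_gt0// me_gt0.
by apply: cvgM; [exact: cvg_cst|exact: max_continuous].
Qed.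

Let tail_c (e r : R) : 0 < e -> 0 <= r -> r <= 1 -> tail (c e) r = A (S e r) - A (S e 1).
Proof.
move=> e0 r0 r1; have cc := c_continuous e0.
rewrite /tail Rintegral_itv_bndo_bndc; last first.
  apply: integrableS (integrable_itv_cc r 1 cc) => //.
  exact: subset_itv_co_cc.
suff -> : \int[lam]_(s in `[r, 1]) c e s = A (S e 1) - A (S e r) by rewrite opprB.
apply: (@RFTC2 _ _ (fun t => A (S e t))) => //.
- move=> t /andP[rt t1]; have t0 : 0 < t by rewrite (le_lt_trans r0).
  have te0 : 0 < t + e by rewrite addr_gt0.
  have dS : is_derive t (1 : R) (S e) (2 * S e t)^-1.
    have SE : Num.sqrt (t + e) = S e t by rewrite /S max_l// ltW.
    have d1 : is_derive t (1 : R) (fun s : R => s + e) 1.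
      by have := is_deriveD (is_derive_id t (1 : R)) (is_derive_cst e t (1 : R)); rewrite addr0.
    have d2 : is_derive t (1 : R) (fun s : R => Num.sqrt (s + e)) (2 * S e t)^-1.
      rewrite -[X in is_derive _ _ _ X]mulr1 -SE.
      apply: (@is_derive1_comp R Num.sqrt (fun s : R => s + e)).
      exact: is_derive1_sqrt.
    apply: near_eq_is_derive d2.
    by near=> s; rewrite /S max_l//; near: s; exact: lt_le_nbhsr.
  have h := @is_derive1_comp R A (S e) t _ _ (is_derive_radavg N0 cb (S_gt0 t e0)) dS.
  apply: (is_derive_eq h).
  rewrite /c -(sqr_sqrtr (ltW (me_gt0 t e0))) -/(S e t) -mulrA -invfM.
  by congr (_ / _); ring.
- exact: AS_continuous.
- exact: AS_continuous.
Unshelve. all: by end_near. Qed.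

(** The weak divergence theorem for the radial field A(|x|) x of divergence
    b(|x|), corrected by a multiple of x so as to vanish on the sphere. *)
Lemma divergence_radial :
  \int[mu]_(x in oball) (v x * (b (enorm x) - N%:R * A 1)) =
  - \int[mu]_(x in oball) (dotv (g x) x * (A (enorm x) - A 1)).
Proof.
pose ep (k : nat) : R := harmonic k.
have ep0 k : 0 < ep k by rewrite /ep/= invr_gt0.
have epc : ep k @[k --> \oo] --> (0 : R) by exact: cvg_harmonic.
have fl k : flux_identity v g (c (ep k)).
  by apply: flux_identity_continuous => //; exact: c_continuous.
have sq01 (x : E) : oball x -> 0 <= dotv x x <= 1.
  by move=> /dotv_itv; rewrite /= in_itv/= => /andP[-> /ltW ->].
have tE k (x : E) : oball x ->
    tail (c (ep k)) (dotv x x) = A (S (ep k) (dotv x x)) - A (S (ep k) 1).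
  by move=> /sq01/andP[? ?]; exact: tail_c.
have Sc s : 0 <= s -> S (ep k) s @[k --> \oo] --> Num.sqrt s.
  move=> s0; have h : Num.max s 0 + ep k @[k --> \oo] --> s.
    rewrite max_l// -[X in _ --> X]addr0.
    by apply: cvgD; [exact: cvg_cst|exact: epc].
  exact: (cvg_comp _ _ h (@sqrt_continuous R s)).
have ASc s : 0 < s -> A (S (ep k) s) @[k --> \oo] --> A (Num.sqrt s).
  move=> s0; apply: (cvg_comp _ _ (Sc s (ltW s0))).
  by apply: continuous_radavg => //; rewrite sqrtr_gt0.
have AS1 : A (S (ep k) 1) @[k --> \oo] --> A 1.
  by have := ASc 1 ltr01; rewrite sqrtr1.
have q0 (x : E) : x != 0 -> 0 < dotv x x.
  move=> x0; rewrite lt_neqAle dotv_ge0 andbT eq_sym -sqr_enorm expf_eq0/=.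
  by apply: contra_neq x0; exact: enorm_eq0.
have tbound k (x : E) : oball x -> `|tail (c (ep k)) (dotv x x)| <= 2 * M.
  move=> xB; rewrite tE// (le_trans (ler_normB _ _))// mulr_natl mulr2n.
  by apply: lerD; apply: A_boundM; exact: sqrtr_ge0.
have tcvg (x : E) : x != 0 -> oball x ->
    tail (c (ep k)) (dotv x x) @[k --> \oo] --> A (enorm x) - A 1.
  move=> x0 xB; under eq_fun do rewrite tE//.
  by apply: cvgB; [exact: (ASc _ (q0 x x0))|exact: AS1].
have mA : measurable_fun oball (fun x : E => A (enorm x) - A 1).
  apply: measurable_funB => //; apply: measurable_radial.
  exact: measurable_radavg.
pose F (x : E) := b (enorm x) - N%:R * A 1.
pose F_ k (x : E) := N%:R * tail (c (ep k)) (dotv x x) + 2 * dotv x x * c (ep k) (dotv x x).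
have mF_ k : measurable_fun oball (F_ k).
  have [m1 _ m2 _] := fl k.
  apply: measurable_funD; first exact: measurable_funM.
  apply: measurable_funM; last exact: measurable_comp_sqn.
  apply: measurable_funM => //.
  by apply: measurable_funTS; apply: continuous_measurable_rV; exact: continuous_sqn.
have F_cvg (x : E) : x != 0 -> oball x -> F_ k x @[k --> \oo] --> F x.
  move=> x0 xB; have q := q0 x x0.
  rewrite /F_ /F (_ : b (enorm x) - _ = N%:R * (A (enorm x) - A 1) +
      dotv x x * ((b (enorm x) - N%:R * A (enorm x)) / dotv x x)); last first.
    by field; rewrite gt_eqF.
  apply: cvgD; first by apply: cvgM; [exact: cvg_cst|exact: tcvg].
  have -> : (fun k => 2 * dotv x x * c (ep k) (dotv x x)) = (fun k => dotv x x *
      ((b (S (ep k) (dotv x x)) - N%:R * A (S (ep k) (dotv x x))) / (Num.max (dotv x x) 0 + ep k))).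
    by apply/funext => k; rewrite /c; field; rewrite gt_eqF// me_gt0.
  apply: cvgM; first exact: cvg_cst.
  apply: cvgM.
    apply: cvgB.
      have hs := Sc _ (ltW q); have hb := @cb (Num.sqrt (dotv x x)).
      exact: (cvg_comp (fun k => S (ep k) (dotv x x)) b hs hb).
    by apply: cvgM; [exact: cvg_cst|exact: ASc].
  apply: cvgV; first by rewrite gt_eqF.
  rewrite max_l ?ltW// -[X in _ --> X]addr0.
  by apply: cvgD; [exact: cvg_cst|exact: epc].
have F_bound k (x : E) : oball x -> `|F_ k x| <= N%:R * (2 * M) + 2 * M.
  move=> xB; rewrite /F_ (le_trans (ler_normD _ _))// lerD//.
    by rewrite normrM ger0_norm// ler_wpM2l// tbound.
  have -> : 2 * dotv x x * c (ep k) (dotv x x) =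
      (b (S (ep k) (dotv x x)) - N%:R * A (S (ep k) (dotv x x))) *
      (dotv x x / (Num.max (dotv x x) 0 + ep k)).
    by rewrite /c; field; rewrite gt_eqF// me_gt0.
  rewrite normrM -[leRHS]mulr1; apply: ler_pM => //.
    rewrite (le_trans (ler_normB _ _))//.
    rewrite (_ : 2 * M = M + M); last by ring.
    apply: lerD => //.
    by apply: NA_bound; exact: sqrtr_ge0.
  rewrite ger0_norm; last by rewrite divr_ge0 ?dotv_ge0// ltW// me_gt0.
  by rewrite ler_pdivrMr ?me_gt0// mul1r max_l ?dotv_ge0// lerDl ltW.
have h1 : \int[mu]_(x in oball) (v x * F_ k x) @[k --> \oo] -->
    \int[mu]_(x in oball) (v x * F x).
  apply: (Rintegral_cvg (g := fun x => (N%:R * (2 * M) + 2 * M) * `|v x|)) => //.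
  - by move=> k; apply: measurable_funM => //; exact: Rintegrable_measurable vi.
  - apply: measurable_funM; first exact: Rintegrable_measurable vi.
    apply: measurable_funB => //; apply: measurable_radial.
    exact: continuous_measurable_fun.
  - by apply: RintegrableZ => //; exact: Rintegrable_norm.
  - apply: filterS ae_neq0 => x x0 xB; apply: cvgM; first exact: cvg_cst.
    exact: F_cvg.
  - by move=> k x xB; rewrite normrM mulrC ler_wpM2r// F_bound.
have gxi := integrable_radial_part gi.
have h2 : \int[mu]_(x in oball) (dotv (g x) x * tail (c (ep k)) (dotv x x)) @[k --> \oo] -->
    \int[mu]_(x in oball) (dotv (g x) x * (A (enorm x) - A 1)).
  apply: (Rintegral_cvg (g := fun x => (2 * M) * `|dotv (g x) x|)) => //.
  - move=> k; apply: measurable_funM; first exact: Rintegrable_measurable gxi.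
    by have [] := fl k.
  - by apply: measurable_funM => //; exact: Rintegrable_measurable gxi.
  - by apply: RintegrableZ => //; exact: Rintegrable_norm.
  - apply: filterS ae_neq0 => x x0 xB; apply: cvgM; first exact: cvg_cst.
    exact: tcvg.
  - by move=> k x xB; rewrite normrM mulrC ler_wpM2r// tbound.
apply/eqP; rewrite -addr_eq0; apply/eqP.
apply: (cvg_cst_eq _ (cvgD h1 h2)) => k.
by have [] := fl k.
Qed.

End divergence_radial.

(** * Radial Sobolev functions *)

Section radial_functions.
Context {R : realType} {N : nat}.
Local Notation E := 'rV[R]_N.
Local Notation mu := (@lebesgue_rV R N).
Local Notation lam := (@lebesgue_measure R).

(** The gradient of z(|x|), where h = z'. *)
Definition radial_field (h : R -> R) (x : E) : E := (h (enorm x) / enorm x) *: x.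

Lemma enorm_radial_field (h : R -> R) (x : E) : h 0 = 0 ->
  enorm (radial_field h x) = `|h (enorm x)|.
Proof.
move=> h0; rewrite /radial_field enormZ normrM normfV (ger0_norm (enorm_ge0 x)).
have [x0|x0] := eqVneq (enorm x) 0; first by rewrite x0 h0 mulr0 normr0.
by rewrite divfK.
Qed.

Lemma is_derive_normr_comp (z : R -> R) : is_derive (0 : R) (1 : R) z 0 ->
  is_derive (0 : R) (1 : R) (fun t : R => z `|t|) 0.
Proof.
move=> [dz ez].
have cz : (fun h : R => h^-1 *: (z h - z 0)) @ 0^' --> (0 : R).
  move: ez dz; rewrite /derive /derivable.
  have -> : (fun h : R => h^-1 *: ((z \o shift 0) (h *: (1 : R)) - z 0)) =
      (fun h : R => h^-1 *: (z h - z 0)).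
    by apply/funext => h /=; rewrite addr0 [h *: _]mulr1.
  by move=> e h; rewrite -[X in _ --> X]e.
have c1 : (fun h : R => h^-1 *: (((fun t : R => z `|t|) \o shift 0) (h *: (1 : R)) - z `|0 : R|)) @ 0^'
    --> (0 : R).
  apply/cvgrPdist_lt => e e0; move/cvgrPdist_lt : cz => /(_ e e0).
  rewrite !near_withinE => /nbhs_norm0P[d/= d0 hd].
  apply: filterS (nbhs0_lt d0) => h hd0 h0 /=.
  rewrite addr0 [h *: _]mulr1 normr0.
  have := hd `|h|; rewrite /= normr_id => /(_ hd0); rewrite normr_eq0 => /(_ h0).
  by rewrite !sub0r !normrN !normrM !normfV normr_id.
split; first by apply/cvg_ex; exists 0.
by apply: cvg_lim => //.
Qed.

Lemma radial_field_continuous (h : R -> R) i : continuous h -> h 0 = 0 ->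
  continuous (fun x => radial_field h x ord0 i).
Proof.
move=> ch h0 x; have ce := @enorm_continuous R N.
have che : continuous (fun x : E => h (enorm x)).
  by move=> y; apply: (@continuous_comp _ _ _ (@enorm R N) h); [exact: ce|exact: ch].
have [->|x0] := eqVneq x 0.
  rewrite /continuous_at mxE mxE mulr0.
  have FF : Filter (nbhs (0 : E)) by exact: nbhs_filter.
  apply/(@cvgrPdist_lt _ _ _ (nbhs (0 : E)) FF) => e e0.
  have := che 0; rewrite /continuous_at enorm0 h0.
  move=> /(@cvgrPdist_lt _ _ _ (nbhs (0 : E)) FF) /(_ e e0).
  apply: filterS => y; rewrite !sub0r !normrN => hy.
  apply: le_lt_trans hy; rewrite -enorm_radial_field//.
  exact: normr_coor_le.
have ex0 : enorm x != 0 by apply: contra_neq x0; exact: enorm_eq0.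
have -> : (fun x => radial_field h x ord0 i) =
    (fun x : E => h (enorm x) / enorm x * rV_coor i x).
  by apply/funext => y; rewrite mxE.
have FF : Filter (nbhs x) by exact: nbhs_filter.
apply: (@cvgM _ _ (nbhs x) FF); last exact: coor_continuous.
apply: (@cvgM _ _ (nbhs x) FF); first exact: che.
by apply: (@cvgV _ _ (nbhs x) FF) => //; exact: ce.
Qed.

(** By h 0 = 0 the function z(|x|) is differentiable at the origin too. *)
Lemma weak_gradient_radial (z h : R -> R) : continuous h -> h 0 = 0 ->
  (forall r, is_derive r (1 : R) z (h r)) ->
  weak_gradient (fun x : E => z (enorm x)) (radial_field h).
Proof.
move=> ch h0 zh; apply: weak_gradient_C1.
- move=> x; apply: (@continuous_comp _ _ _ (@enorm R N) z).
    exact: enorm_continuous.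
  exact: is_derive_continuous (zh _).
- by move=> i; exact: radial_field_continuous.
- move=> i x; have [->|x0] := eqVneq x 0.
    rewrite mxE mxE mulr0.
    have -> : (fun t : R => z (enorm (0 + t *: delta_mx ord0 i : E))) = (fun t : R => z `|t|).
      apply/funext => t; congr z.
      by rewrite /enorm dotv_line dotv0l mxE mulr0 mul0r !add0r sqrtr_sqr.
    by apply: is_derive_normr_comp; have := zh 0; rewrite h0.
  have ex0 : enorm x != 0 by apply: contra_neq x0; exact: enorm_eq0.
  have d1 := @is_derive_sqn_line R N x i.
  have q0 : 0 < dotv (x + (0 : R) *: delta_mx ord0 i) (x + (0 : R) *: delta_mx ord0 i).
    by rewrite scale0r addr0 -sqr_enorm exprn_gt0// lt_neqAle eq_sym ex0 enorm_ge0.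
  have d2 := @is_derive1_comp R Num.sqrt
    (fun t : R => dotv (x + t *: delta_mx ord0 i) (x + t *: delta_mx ord0 i)) 0 _ _
    (is_derive1_sqrt q0) d1.
  have d3 := @is_derive1_comp R z _ 0 _ _ (zh _) d2.
  apply: (is_derive_eq d3) => /=.
  rewrite /radial_field mxE scale0r addr0 -/(enorm x).
  by field.
Qed.

End radial_functions.

Section W1_radial.
Context {R : realType} {N : nat}.
Local Notation E := 'rV[R]_N.
Local Notation mu := (@lebesgue_rV R N).

Let mB := @measurable_oball R N.

(** The definition gives integrability on compact subsets of the ball, and the
    ball is a countable union of these. *)
Lemma weak_gradient_measurable (u : E -> R) (g : E -> E) i : weak_gradient u g ->
  measurable_fun oball (fun x => g x ord0 i).
Proof.
move=> /(_ i)[gl _].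
pose K (k : nat) : set E := [set x | enorm x <= 1 - harmonic k].
have KB k : K k `<=` oball.
  move=> x /le_lt_trans; apply; rewrite gtrBl.
  by rewrite /harmonic/= invr_gt0.
have cK k : compact (K k).
  have clK : closed (K k).
    have := @enorm_continuous R N => /continuous_closedP /(_ _ (@closed_le R (1 - harmonic k))).
    by rewrite /K.
  apply: (subclosed_compact clK (@cball_compact R N)).
  by move=> x /KB /oball_cball.
have -> : (oball : set E) = \bigcup_k K k.
  apply/seteqP; split => [x xB|x [k _ /KB//]].
  have /cvgrPdist_lt := @cvg_harmonic R => /(_ (1 - enorm x)).
  rewrite subr_gt0 => /(_ xB) [k _ /(_ k (leqnn k))].
  rewrite /= sub0r normrN ger0_norm ?invr_ge0// => h.
  by exists k => //; rewrite /K/=; move: h; move: (k.+1%:R^-1) => y; lra.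
apply/measurable_fun_bigcup => [k|k]; first exact: compact_measurable_rV.
by have /measurable_int/measurable_EFinP := gl _ (cK k) (KB k).
Qed.

Lemma le_powR_add1 (a m : R) : 1 <= m -> 0 <= a -> a <= 1 + a `^ m.
Proof.
move=> m1 a0; have [a1|/ltW a1] := leP a 1.
  by rewrite (le_trans a1)// lerDl powR_ge0.
by rewrite (le_trans (le1r_powR a1 m1))// lerDr.
Qed.

Lemma in_Lp_integrable_powR (m : R) (u : E -> R) : in_Lp m u ->
  mu.-integrable oball (EFin \o (fun x => `|u x| `^ m)).
Proof.
move=> [mu_ uoo]; apply/integrableP; split.
  apply/measurable_EFinP.
  by apply: (measurableT_comp (@measurable_powR R m)); exact: measurableT_comp.
rewrite (eq_integral (fun x => (`|u x| `^ m)%:E))// => x _ /=.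
by rewrite ger0_norm ?powR_ge0.
Qed.

Lemma in_Lp_integrable (m : R) (u : E -> R) : 1 <= m -> in_Lp m u ->
  mu.-integrable oball (EFin \o u).
Proof.
move=> m1 um; have ui := in_Lp_integrable_powR um.
apply: (@Rintegrable_le _ _ _ _ _ mB _ (fun x => 1 + `|u x| `^ m)).
- by have [] := um.
- by move=> x _; exact: le_powR_add1.
- apply: RintegrableD => //.
  by apply: (@integrable_bounded _ _ _ _ _ _ 1) => //; [exact: oball_finite|move=> x _; rewrite normr1].
Qed.

Lemma in_Lp_bounded (m C : R) (u : E -> R) : 0 <= m -> measurable_fun oball u ->
  (forall x, oball x -> `|u x| <= C) -> in_Lp m u.
Proof.
move=> m0 mu_ uC; split => //.
have h : mu.-integrable oball (EFin \o (fun x => `|u x| `^ m)).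
  apply: (@integrable_bounded _ _ _ _ _ _ (C `^ m)) => //.
  - exact: oball_finite.
  - by apply: (measurableT_comp (@measurable_powR R m)); exact: measurableT_comp.
  - move=> x xB; rewrite ger0_norm ?powR_ge0// ge0_ler_powR ?nnegrE//.
      exact: le_trans (uC x xB).
    exact: uC.
exact: (integrable_lty mB h).
Qed.

Lemma W1_gradient (m : R) (u : E -> R) : 1 <= m -> W1 m u -> exists g : E -> E,
  [/\ weak_gradient u g, forall i, mu.-integrable oball (EFin \o (fun x => g x ord0 i)),
      measurable_fun oball (fun x => enorm (g x)),
      mu.-integrable oball (EFin \o (fun x => enorm (g x) `^ m)) &
      mu.-integrable oball (EFin \o u)].
Proof.
move=> m1 [um [g [ug gm]]]; exists g.
have gi := in_Lp_integrable_powR gm.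
split => //.
- move=> i; apply: (@Rintegrable_le _ _ _ _ _ mB _ (fun x => enorm (g x))).
  + exact: weak_gradient_measurable ug.
  + by move=> x _; exact: normr_coor_le.
  + exact: (in_Lp_integrable m1 gm).
- by have [] := gm.
- apply: eq_integrable gi => // x _ /=.
  by rewrite ger0_norm// enorm_ge0.
- exact: in_Lp_integrable um.
Qed.

Lemma W1_radial (m : R) (z h : R -> R) : 0 <= m -> continuous h -> h 0 = 0 ->
  (forall r, is_derive r (1 : R) z (h r)) -> W1 m (fun x : E => z (enorm x)).
Proof.
move=> m0 ch h0 zh.
have cz : continuous z by move=> r; exact: is_derive_continuous (zh r).
have bnd (f : R -> R) : continuous f -> exists C, forall x : E, oball x -> `|f (enorm x)| <= C.
  move=> cf; have [||C hC] := @continuous_bounded_on_compact R N cball (fun x => f (enorm x)).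
  - exact: cball_compact.
  - move=> x; apply: (@continuous_comp _ _ _ (@enorm R N) f); last exact: cf.
    exact: enorm_continuous.
  - by exists C => x /oball_cball; exact: hC.
split.
  have [C hC] := bnd _ cz; apply: in_Lp_bounded hC => //.
  by apply: measurable_radial; exact: continuous_measurable_fun.
exists (radial_field h); split; first exact: weak_gradient_radial.
have [C hC] := bnd _ ch; apply: (@in_Lp_bounded _ C) => //.
  rewrite (_ : _ \o _ = fun x => `|h (enorm x)|); last first.
    by apply/funext => x /=; rewrite enorm_radial_field.
  apply: measurableT_comp => //; apply: measurable_radial.
  exact: continuous_measurable_fun.
by move=> x xB /=; rewrite enorm_radial_field// normr_id hC.
Qed.

Lemma weak_gradient_cst (c : R) : weak_gradient (fun _ : E => c) (fun=> 0).
Proof.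
apply: weak_gradient_C1.
- exact: cst_continuous.
- by move=> i; exact: cst_continuous.
- by move=> i x /=; rewrite mxE; exact: is_derive_cst.
Qed.

Lemma W1_cst (m c : R) : 0 <= m -> W1 m (fun _ : E => c).
Proof.
move=> m0; apply: (@W1_radial m (fun=> c) (fun=> 0)) => //.
exact: cst_continuous.
Qed.

(** A continuous radial function that vanishes almost everywhere vanishes, since
    every nonempty open set has positive measure. *)
Lemma radial_ae_eq0 (f : R -> R) : (0 < N)%N -> continuous f ->
  {ae mu, forall x : E, oball x -> f (enorm x) = 0} ->
  forall r, 0 <= r <= 1 -> f r = 0.
Proof.
move=> N0 cf [Z [mZ Z0 sZ]].
have h r : 0 <= r < 1 -> f r = 0.
  move=> /andP[r0 r1]; apply: contrapT => fr.
  pose U : set E := oball `&` [set x | f (enorm x) != 0].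
  have oU : open U.
    apply: openI; first exact: oball_open.
    have cfe : continuous (fun x : E => f (enorm x)).
      by move=> y; apply: (@continuous_comp _ _ _ (@enorm R N) f); [exact: enorm_continuous|exact: cf].
    have /continuousP := cfe => /(_ _ (@open_neq R 0)).
    by [].
  have eU : enorm (r *: delta_mx ord0 (Ordinal N0) : E) = r.
    rewrite enormZ ger0_norm// /enorm /dotv (bigD1 (Ordinal N0))//= big1 ?addr0.
      by rewrite !mxE !eqxx mulr1 sqrtr1 mulr1.
    by move=> i i0; rewrite mxE eqxx/= (negbTE i0) mul0r.
  have U0 : U !=set0.
    by exists (r *: delta_mx ord0 (Ordinal N0)); rewrite /U/oball/= eU; split => //; exact/eqP.
  have := lebesgue_rV_open_gt0 oU U0; rewrite ltNge => /negP; apply.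
  rewrite -Z0; apply: le_measure; rewrite ?inE//; first exact: open_measurable_rV.
  by move=> x [xB /eqP fx]; apply: sZ => /= /(_ xB).
move=> r /andP[r0]; rewrite le_eqVlt => /predU1P[->|r1]; last by rewrite h// r0.
have hc : 1 - harmonic k @[k --> \oo] --> (1 : R).
  rewrite -[X in _ --> X]subr0; apply: cvgB; first exact: cvg_cst.
  exact: cvg_harmonic.
apply: (cvg_cst_eq _ (cvg_comp (fun k => 1 - harmonic k : R) f hc (cf 1))) => k /=.
apply: h; rewrite subr_ge0 gtrBl invr_gt0 ltr0n andbT.
by rewrite invf_le1// ler1n.
Qed.

(** Integration in polar coordinates is the divergence theorem for v = 1. *)
Lemma Rintegral_radial (b : R -> R) (M : R) : (0 < N)%N -> continuous b ->
  (forall r, `|b r| <= M) ->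
  \int[mu]_(x in oball) (b (enorm x) - N%:R * radavg N b 1) = 0.
Proof.
move=> N0 cb bM.
have := @divergence_radial R N N0 (fun=> 1) (fun=> 0) (weak_gradient_cst 1) _ _ b M cb bM.
under eq_Rintegral do rewrite mul1r.
move=> ->.
- under eq_Rintegral do rewrite dotv0l mul0r.
  by rewrite Rintegral_cst// mul0r oppr0.
- by apply: (@integrable_bounded _ _ _ _ _ _ 1) => //; [exact: oball_finite|move=> x _; rewrite normr1].
- move=> i; apply: (@integrable_bounded _ _ _ _ _ _ 0) => //; first exact: oball_finite.
  by move=> x _; rewrite mxE normr0.
Qed.

End W1_radial.

(** * Powers, and the flux of a profile *)

Section powR_facts.
Context {R : realType}.

(** At x = 0 eventually f < 1 and g >= a / 2, so that f `^ g <= f `^ (a / 2). *)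
Lemma cvg_powR (X : Type) (F : set_system X) (FF : ProperFilter F) (f g : X -> R) (x a : R) :
  0 < a -> 0 <= x -> (forall t, 0 <= f t) -> f t @[t --> F] --> x -> g t @[t --> F] --> a ->
  f t `^ g t @[t --> F] --> x `^ a.
Proof.
move=> a0; rewrite le_eqVlt => /predU1P[<-|x0] f0 fx ga.
  rewrite powR0 ?gt_eqF//; apply/cvgrPdist_lt => e e0.
  pose d := Num.min 1 (e `^ (a / 2)^-1).
  have d0 : 0 < d by rewrite lt_min ltr01 powR_gt0.
  have a20 : 0 < a / 2 by rewrite divr_gt0.
  near=> t.
  have gt_ : a / 2 <= g t.
    near: t; apply: (cvgr_ge _ ga).
    by rewrite ltr_pdivrMr// ltr_pMr// ltr1n.
  have ft : f t < d by near: t; exact: (cvgr_lt _ fx).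
  rewrite sub0r normrN ger0_norm ?powR_ge0//.
  have [->|ft0] := eqVneq (f t) 0.
    by rewrite powR0// gt_eqF// (lt_le_trans a20).
  have ftp : 0 < f t by rewrite lt_neqAle eq_sym ft0 f0.
  apply: (@le_lt_trans _ _ (f t `^ (a / 2))).
    by apply: ger_powR => //; rewrite ftp ltW// (lt_le_trans ft)// ge_min lexx.
  have eE : e = (e `^ (a / 2)^-1) `^ (a / 2).
    by rewrite -powRrM mulVf ?gt_eqF// powRr1// ltW.
  rewrite [ltRHS]eE gt0_ltr_powR ?nnegrE ?powR_ge0// (lt_le_trans ft)//.
  by rewrite ge_min lexx orbT.
have xn : x != 0 by rewrite gt_eqF.
have h : expR (g t * ln (f t)) @[t --> F] --> expR (a * ln x).
  apply: (cvg_comp (fun t => g t * ln (f t)) expR _ (@continuous_expR R (a * ln x))).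
  apply: cvgM => //; apply: (cvg_comp f (@ln R) fx).
  exact: continuous_ln.
rewrite /powR (negbTE xn).
apply: cvg_trans h; apply: near_eq_cvg; near=> t.
by rewrite gt_eqF//; near: t; exact: (cvgr_gt _ fx).
Unshelve. all: by end_near. Qed.

Lemma continuous_powR_comp (T : topologicalType) (f : T -> R) (a : R) : 0 < a ->
  continuous f -> (forall t, 0 <= f t) -> continuous (fun t => f t `^ a).
Proof.
by move=> a0 cf f0 x; apply: cvg_powR => //; [exact: cf|exact: cvg_cst].
Qed.

Lemma le_powR_le1 (t a b : R) : 0 < a -> a <= b -> 0 <= t <= 1 -> t `^ b <= t `^ a.
Proof.
move=> a0 ab /andP[]; rewrite le_eqVlt => /predU1P[<- _|t0 t1].
  by rewrite !powR0 ?gt_eqF// (lt_le_trans a0).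
by apply: ger_powR => //; rewrite t0.
Qed.

Lemma powR1r (a : R) : 1 `^ a = 1. Proof. by rewrite powR1. Qed.

Lemma powR_le1 (t a : R) : 0 <= a -> 0 <= t <= 1 -> t `^ a <= 1.
Proof.
move=> a0 /andP[t0 t1]; rewrite -[leRHS](powR1r a).
by apply: ge0_ler_powR; rewrite ?nnegrE.
Qed.

End powR_facts.

Lemma radint_le (R : realType) (N : nat) (b : R -> R) (r M : R) : (0 < N)%N ->
  continuous b -> 0 <= r -> (forall s, 0 <= s <= r -> b s <= M) ->
  radint N b r <= M * (r ^+ N / N%:R).
Proof.
move=> N0 cb r0 bM; have ei := integrable_itv_cc 0 r (@exprn_continuous R N.-1).
rewrite -[in X in _ <= X](prednK N0) -integral_expr// -RintegralZl//.
apply: le_Rintegral; first exact: measurable_itv.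
- exact/integrable_itv_cc/continuous_weight.
- exact: RintegrableZ.
- move=> s; rewrite /= in_itv/= => /andP[s0 sr].
  by rewrite mulrC ler_wpM2r ?exprn_ge0// bM// s0.
Qed.

Section profiles.
Context {R : realType}.
Local Notation lam := (@lebesgue_measure R).
Implicit Types (W : R -> R) (m q : R).

Definition reaction m q W (s : R) : R := W s `^ (m - 1) - W s `^ (q - 1).

(** If u = W(|x|) solves -div(|u'|^(m-2) u' x/|x|) = reaction with u' >= 0, then
    u'^(m-1) is [flux], by integration of the equation over a ball; so u' is
    [slope]. Beyond r = 1 the slope keeps its value at 1, which is 0 by the Neumann
    condition. *)
Definition flux N m q W (r : R) : R := r * radavg N (reaction m q W) r.

Definition slope N m q W (r : R) : R := flux N m q W (Num.min r 1) `^ (m - 1)^-1.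

(** Profiles are extended to the whole line by constants, which leaves continuity
    and derivatives without endpoints. *)
Definition cone_profile W : Prop :=
  [/\ continuous W, {homo W : r s / r <= s}, forall r, 0 <= W r,
      forall r, r <= 0 -> W r = W 0 & forall r, 1 <= r -> W r = W 1].

Variables (N : nat) (m q : R) (W : R -> R).
Hypothesis N0 : (0 < N)%N.
Hypothesis m1 : 1 < m.
Hypothesis mq : m < q.
Hypothesis cW : cone_profile W.

Local Notation b := (reaction m q W).

Let cont_W : continuous W. Proof. by have [] := cW. Qed.
Let homo_W : {homo W : r s / r <= s}. Proof. by have [] := cW. Qed.
Let W_ge0 r : 0 <= W r. Proof. by have [] := cW. Qed.
Let W_0 r : r <= 0 -> W r = W 0. Proof. by have [_ _ _ h _] := cW; exact: h. Qed.
Let W_1 r : 1 <= r -> W r = W 1. Proof. by have [_ _ _ _ h] := cW; exact: h. Qed.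
Let m10 : 0 < m - 1. Proof. by rewrite subr_gt0. Qed.
Let q10 : 0 < q - 1. Proof. by rewrite subr_gt0 (lt_trans m1). Qed.

Lemma profile_le_W1 r : W r <= W 1.
Proof. by have [r1|/ltW r1] := leP r 1; [exact: homo_W|rewrite W_1]. Qed.

Lemma profile_ge_W0 r : W 0 <= W r.
Proof. by have [r1|/ltW r1] := leP 0 r; [exact: homo_W|rewrite (W_0 r1)]. Qed.

Lemma reaction_continuous : continuous b.
Proof.
move=> r; apply: cvgB; apply: continuous_powR_comp => //.
Qed.

Lemma reaction_bound r : `|b r| <= W 1 `^ (m - 1) + W 1 `^ (q - 1).
Proof.
rewrite (le_trans (ler_normB _ _))// !ger0_norm ?powR_ge0//.
by apply: lerD; apply: ge0_ler_powR; rewrite ?nnegrE ?profile_le_W1// ltW.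
Qed.

Lemma reaction_ge0 r : W r <= 1 -> 0 <= b r.
Proof.
move=> W1; rewrite subr_ge0; apply: le_powR_le1; rewrite ?W1 ?W_ge0//.
by rewrite lerD2r ltW.
Qed.

Lemma reaction_le0 r : 1 <= W r -> b r <= 0.
Proof.
by move=> W1; rewrite subr_le0; apply: ler_powR; rewrite ?W1// lerD2r ltW.
Qed.

Lemma reaction_le1 r : b r <= 1.
Proof.
have [W1|/ltW W1] := leP (W r) 1; last by rewrite (le_trans (reaction_le0 W1)).
rewrite lerBlDr (@le_trans _ _ 1)// ?lerDl ?powR_ge0//.
by apply: powR_le1; rewrite ?W_ge0// ltW.
Qed.

Lemma reaction_eq0 r : b r = 0 -> W r = 0 \/ W r = 1.
Proof.
move=> /eqP; rewrite subr_eq0 => /eqP h.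
have [W0|W0] := eqVneq (W r) 0; [by left|right].
have W0' : 0 < W r by rewrite lt_neqAle eq_sym W0 W_ge0.
have : ln (W r `^ (m - 1)) = ln (W r `^ (q - 1)) by rewrite h.
rewrite !ln_powR => /eqP; rewrite -subr_eq0 -mulrBl mulf_eq0 => /orP[|].
  by rewrite subr_eq0 => /eqP; move: mq; lra.
by rewrite ln_eq0// => /eqP.
Qed.

Let itv_int (r s : R) : lam.-integrable `[r, s] (EFin \o (fun t => t ^+ N.-1 * b t)).
Proof. exact/integrable_itv_cc/continuous_weight/reaction_continuous. Qed.

Let weight_ge0 (s : R) : 0 <= s -> 0 <= s ^+ N.-1.
Proof. by move=> s0; rewrite exprn_ge0. Qed.

Hypothesis J1 : radint N b 1 = 0.

(** The reaction is nonnegative as long as W <= 1 and nonpositive from then on; so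
    its weighted integral first increases and then decreases, from 0 to 0. *)
Lemma radint_ge0 r : 0 <= r <= 1 -> 0 <= radint N b r.
Proof.
move=> /andP[r0 r1]; have [W1|/ltW W1] := leP (W r) 1.
  apply: Rintegral_ge0 => s; rewrite /= in_itv/= => /andP[s0 sr].
  by rewrite mulr_ge0 ?weight_ge0// reaction_ge0// (le_trans (homo_W sr)).
have := Rintegral_itv_cat (continuous_weight (N := N) reaction_continuous) r0 r1.
rewrite -/(radint N b r) -/(radint N b 1) J1 => h.
suff : \int[lam]_(t in `[r, 1]) (t ^+ N.-1 * b t) <= 0 by lra.
rewrite -oppr_ge0 -mulN1r -RintegralZl; [|exact: measurable_itv|exact: itv_int].
apply: Rintegral_ge0 => s; rewrite /= in_itv/= => /andP[rs _].
rewrite mulN1r oppr_ge0 mulr_ge0_le0 ?weight_ge0 ?(le_trans r0)//.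
by rewrite reaction_le0// (le_trans W1)// homo_W.
Qed.

Lemma flux_ge0 r : r <= 1 -> 0 <= flux N m q W r.
Proof.
move=> r1; have [r0|r0] := leP 0 r.
  by rewrite mulr_ge0// divr_ge0 ?exprn_ge0// radint_ge0// r0.
by rewrite /flux /radavg /radint set_itv_ge ?Rintegral_set0 ?mul0r ?mulr0// bnd_simp -ltNge.
Qed.

Lemma flux_le_max (r M : R) : 0 <= r -> 0 <= M ->
  (forall s, 0 <= s <= r -> b s <= M) -> flux N m q W r <= r * M.
Proof.
move=> + M0 bM; rewrite le_eqVlt => /predU1P[<-|r0]; first by rewrite /flux !mul0r.
rewrite /flux /radavg ler_wpM2l ?(ltW r0)// ler_pdivrMr ?exprn_gt0//.
apply: (le_trans (radint_le N0 reaction_continuous (ltW r0) bM)).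
rewrite ler_wpM2l// ler_pdivrMr ?ltr0n// ler_peMr ?exprn_ge0 ?(ltW r0)//.
by rewrite ler1n.
Qed.

Lemma flux_le r : 0 <= r -> flux N m q W r <= r.
Proof.
move=> r0; rewrite -[leRHS]mulr1; apply: flux_le_max => // s _.
exact: reaction_le1.
Qed.

Lemma flux_le0 r : r <= 0 -> flux N m q W r = 0.
Proof.
rewrite le_eqVlt => /predU1P[->|r0]; first by rewrite /flux mul0r.
by rewrite /flux /radavg /radint set_itv_ge ?Rintegral_set0 ?mul0r ?mulr0// bnd_simp -ltNge.
Qed.

Lemma flux1 : flux N m q W 1 = 0.
Proof. by rewrite /flux /radavg J1 mul0r mulr0. Qed.

Lemma flux_continuous : continuous (flux N m q W).
Proof.
move=> r; have [r0|r0] := ltP 0 r.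
  apply: cvgM; first exact: cvg_id.
  by apply: continuous_radavg => //; exact: reaction_continuous.
pose M := W 1 `^ (m - 1) + W 1 `^ (q - 1).
have M0 : 0 <= M by rewrite addr_ge0 ?powR_ge0.
have fM s : `|flux N m q W s| <= Num.max s 0 * M.
  have [s0|s0] := leP s 0; first by rewrite flux_le0// normr0 mul0r.
  rewrite /flux normrM (gtr0_norm s0) ler_wpM2l ?(ltW s0)//.
  apply: (@le_trans _ _ (M / N%:R)).
    apply: radavg_bound => //; [exact: reaction_continuous|exact: ltW|].
    by move=> t _; exact: reaction_bound.
  by rewrite ler_pdivrMr ?ltr0n// ler_peMr// ler1n.
rewrite /continuous_at flux_le0//; apply/cvgr0Pnorm_le => e e0.
have : Num.max s 0 * M @[s --> r] --> 0 * M.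
  apply: cvgM; last exact: cvg_cst.
  by have := @max0_continuous R r; rewrite /continuous_at max_r.
rewrite mul0r => /cvgr0Pnorm_le /(_ e e0); apply: filterS => s; apply: le_trans.
by rewrite (le_trans (fM s))// ler_norm.
Qed.

Let flux_min_continuous : continuous (fun r : R => flux N m q W (Num.min r 1)).
Proof.
move=> r; apply: (@continuous_comp _ _ _ (fun r : R => Num.min r 1)).
  have h1 : {for r, continuous (fun r : R => r)} by exact: cvg_id.
  have h2 : {for r, continuous (fun=> 1 : R)} by exact: cvg_cst.
  exact: (continuous_min h1 h2).
exact: flux_continuous.
Qed.

Lemma slope_continuous : continuous (slope N m q W).
Proof.
apply: continuous_powR_comp => //; first by rewrite invr_gt0.
by move=> r; apply: flux_ge0; rewrite ge_min lexx orbT.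
Qed.

Lemma slope_ge0 r : 0 <= slope N m q W r. Proof. exact: powR_ge0. Qed.

Lemma slope_le0 r : r <= 0 -> slope N m q W r = 0.
Proof.
move=> r0; rewrite /slope flux_le0 ?ge_min ?r0//.
by rewrite powR0// invr_eq0 gt_eqF.
Qed.

Lemma slope_ge1 r : 1 <= r -> slope N m q W r = 0.
Proof. by move=> r1; rewrite /slope min_r// flux1 powR0// invr_eq0 gt_eqF. Qed.

Lemma slope_lt1 r : slope N m q W r < 1.
Proof.
have [r0|r0] := leP r 0; first by rewrite slope_le0.
have [r1|r1] := leP 1 r; first by rewrite slope_ge1.
rewrite /slope min_l ?ltW// -[ltRHS](powR1r (m - 1)^-1).
apply: gt0_ltr_powR; rewrite ?nnegrE ?invr_gt0 ?flux_ge0// ?ltW//.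
by apply: le_lt_trans r1; rewrite flux_le// ltW.
Qed.

Lemma powR_slope r : r <= 1 -> slope N m q W r `^ (m - 1) = flux N m q W r.
Proof.
by move=> r1; rewrite /slope min_l// -powRrM mulVf ?gt_eqF// powRr1// flux_ge0.
Qed.

End profiles.

(** * Solutions in the cone *)

Section cone.
Context {R : realType} {N : nat}.
Local Notation E := 'rV[R]_N.
Local Notation mu := (@lebesgue_rV R N).
Hypothesis N0 : (0 < N)%N.

Lemma within_continuous_min1 (w : R -> R) (r : R) : 0 < r ->
  {within `]0, 1], continuous w} ->
  {for r, continuous (fun s : R => w (Num.min s 1))}.
Proof.
move=> r0 /subspace_continuousP cw.
have r1 : (`]0, 1]%classic : set R) (Num.min r 1).
  by rewrite /= in_itv/= lt_min r0 ltr01 ge_min lexx orbT.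
have h1 : {for r, continuous (fun r : R => r)} by exact: cvg_id.
have h2 : {for r, continuous (fun=> 1 : R)} by exact: cvg_cst.
have h := continuous_min h1 h2.
apply: (cvg_comp (fun s : R => Num.min s 1) w _ (cw _ r1)).
have pos : \forall s \near r, 0 < s by exact: lt_nbhsr.
move=> P /h hP.
have hP' : \forall s \near r, `]0, 1]%classic (Num.min s 1) -> P (Num.min s 1) := hP.
apply: filterS (filterI hP' pos) => s [hs s0].
by apply: hs; rewrite /= in_itv/= lt_min ltr01 s0 ge_min lexx orbT.
Qed.

(** The profile is extended by its limit at 0 and by its value at 1. *)
Lemma in_cone_profile (m : R) (u : E -> R) : in_cone m u ->
  exists2 W, cone_profile W & has_profile u W.
Proof.
move=> [_ [w [uw cw w_ge0 w_homo]]].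
pose I : set R := w @` `]0, 1].
have I0 : I !=set0 by exists (w 1); exists 1 => //=; rewrite in_itv/= ltr01 lexx.
have lbI : lbound I 0.
  by move=> y [r r01 <-]; apply: w_ge0; move: r01; rewrite /= in_itv.
have hI : has_inf I by split => //; exists 0.
pose W r := if r <= 0 then inf I else w (Num.min r 1).
have W_gt0 r : 0 < r -> W r = w (Num.min r 1) by move=> r0; rewrite /W leNgt r0.
have min01 (r : R) : 0 < r -> 0 < Num.min r 1 <= 1.
  by move=> r0; rewrite lt_min r0 ltr01 ge_min lexx orbT.
have infW r : 0 < r -> inf I <= W r.
  move=> r0; rewrite W_gt0//; apply: ge_inf; first by exists 0.
  by exists (Num.min r 1) => //=; rewrite in_itv/=; exact: min01.
have homoW : {homo W : r s / r <= s}.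
  move=> r s rs; have [s0|s0] := leP s 0.
    by rewrite /W s0 (le_trans rs).
  have [r0|r0] := leP r 0; first by rewrite {1}/W r0 infW.
  rewrite !W_gt0//; apply: w_homo; first by case/andP: (min01 _ r0).
    by rewrite le_min !ge_min rs lexx orbT.
  by case/andP: (min01 _ s0).
exists W; last first.
  apply: filterS2 uw (ae_neq0 N0) => x h x0 xB; rewrite h// W_gt0.
    by rewrite min_l// ltW.
  rewrite lt_neqAle enorm_ge0 andbT eq_sym.
  by apply: contra_neq x0; exact: enorm_eq0.
split => //.
- move=> r; have [r0|r0] := ltP 0 r.
    have h := within_continuous_min1 r0 cw.
    rewrite /continuous_at (W_gt0 r r0); apply: cvg_trans h.
    apply: near_eq_cvg; near=> s; rewrite W_gt0//; near: s; exact: lt_nbhsr.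
  have Wr : W r = inf I by rewrite /W r0.
  rewrite /continuous_at Wr; apply/cvgrPdist_le => e e0.
  have [_ [s /= s01 <-] ws] := inf_adherent e0 hI.
  move: s01; rewrite in_itv/= => /andP[s0 s1].
  near=> t; rewrite distrC ger0_norm ?subr_ge0; last first.
    have [t0|t0] := leP t 0; first by rewrite /W t0.
    exact: infW.
  rewrite lerBlDl (le_trans _ (ltW ws))//.
  have -> : w s = W s by rewrite W_gt0// min_l.
  by apply: homoW; near: t; apply: lt_le_nbhsl; rewrite (le_lt_trans r0).
- move=> r; have [r0|r0] := leP r 0.
    rewrite /W r0; apply: lb_le_inf => //.
  by rewrite W_gt0// w_ge0// min01.
- by move=> r r0; rewrite /W r0 lexx.
- move=> r r1; rewrite !W_gt0// ?(lt_le_trans _ r1)//.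
  by rewrite !min_r.
Unshelve. all: by end_near. Qed.

End cone.

Section monotone_operator.
Context {R : realType} {N : nat}.
Local Notation E := 'rV[R]_N.
Implicit Types (x y : E) (m : R).

Lemma powR_split m (t : R) : 1 < m -> 0 <= t ->
  t `^ (m - 2) * t = t `^ (m - 1) /\ t `^ (m - 1) * t = t `^ m.
Proof.
move=> m1 t0; have m10 : 0 < m - 1 by rewrite subr_gt0.
have m0 : 0 < m by rewrite (lt_trans _ m1).
split; last by rewrite mulrC mulr_powRB1.
rewrite mulrC -(mulr_powRB1 t0 m10); congr (_ * _ `^ _).
by rewrite -addrA -opprD.
Qed.

Lemma mlaplace_flux_le m x y : 1 < m ->
  `|enorm x `^ (m - 2) * dotv x y| <= enorm x `^ (m - 1) * enorm y.
Proof.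
move=> m1; have [<- _] := powR_split m1 (enorm_ge0 x).
rewrite normrM ger0_norm ?powR_ge0// -mulrA ler_wpM2l ?powR_ge0//.
rewrite ler_norml dotv_le andbT lerNl -dotvNl -(enormN x).
exact: dotv_le.
Qed.

Lemma powR_young m (s t : R) : 1 < m -> 0 <= s -> 0 <= t ->
  s `^ (m - 1) * t <= s `^ m + t `^ m.
Proof.
move=> m1 s0 t0; have m10 : 0 <= m - 1 by rewrite subr_ge0 ltW.
have [_ es] := powR_split m1 s0; have [_ et] := powR_split m1 t0.
have [st|/ltW ts] := leP s t.
  apply: (@le_trans _ _ (t `^ m)); last by rewrite lerDr powR_ge0.
  by rewrite -et ler_wpM2r// ge0_ler_powR// nnegrE.
apply: (@le_trans _ _ (s `^ m)); last by rewrite lerDl powR_ge0.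
by rewrite -es ler_wpM2l// powR_ge0.
Qed.

(** Monotonicity of x |-> |x|^(m-2) x, by the Cauchy-Schwarz inequality and
    monotonicity of the power t^(m-1). *)
Lemma mlaplace_monotone m x y : 1 < m ->
  let d := enorm x `^ (m - 2) * dotv x (x - y) - enorm y `^ (m - 2) * dotv y (x - y) in
  0 <= d /\ (d = 0 -> x = y).
Proof.
move=> m1; rewrite !dotvDr !dotvNr -!sqr_enorm (dotvC y x) /=.
have cs := dotv_le x y.
have nE : enorm (x - y) ^+ 2 = enorm x ^+ 2 - 2 * dotv x y + enorm y ^+ 2.
  rewrite sqr_enorm dotvDl !dotvDr !dotvNl !dotvNr (dotvC y x) -!sqr_enorm; ring.
have x0 := enorm_ge0 x; have y0 := enorm_ge0 y.
have xz := @enorm_eq0 R N x; have yz := @enorm_eq0 R N y.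
have xyz := @enorm_eq0 R N (x - y).
move: (enorm x) (enorm y) (dotv x y) (enorm (x - y)) x0 y0 xz yz xyz cs nE.
move=> s t d e s0 t0 xz yz xyz cs nE.
have [s1 _] := powR_split m1 s0; have [t1 _] := powR_split m1 t0.
have m10 : 0 < m - 1 by rewrite subr_gt0.
have mono : 0 <= (s `^ (m - 1) - t `^ (m - 1)) * (s - t).
  have [st|/ltW ts] := leP s t.
    by rewrite mulr_le0// subr_le0// ge0_ler_powR ?nnegrE// ltW.
  by rewrite mulr_ge0// subr_ge0// ge0_ler_powR ?nnegrE// ltW.
have p1 := powR_ge0 s (m - 2); have p2 := powR_ge0 t (m - 2).
have dE : s `^ (m - 2) * (s ^+ 2 - d) - t `^ (m - 2) * (d - t ^+ 2) =
    (s `^ (m - 1) - t `^ (m - 1)) * (s - t) + s `^ (m - 2) * (s * t - d) +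
    t `^ (m - 2) * (s * t - d).
  by rewrite -s1 -t1; ring.
have q1 : 0 <= s `^ (m - 2) * (s * t - d) by rewrite mulr_ge0// subr_ge0.
have q2 : 0 <= t `^ (m - 2) * (s * t - d) by rewrite mulr_ge0// subr_ge0.
rewrite dE; split; first by rewrite !addr_ge0.
move=> h0; have mono0 : (s `^ (m - 1) - t `^ (m - 1)) * (s - t) = 0 by lra.
have q10 : s `^ (m - 2) * (s * t - d) = 0 by lra.
have st : s = t.
  move/eqP : mono0; rewrite mulf_eq0 !subr_eq0 => /orP[/eqP h|/eqP//].
  by apply: (powR_injective m10); rewrite ?inE ?nnegrE.
subst t; have [s00|sn0] := eqVneq s 0; first by rewrite (xz s00) (yz s00).
apply/eqP; rewrite -subr_eq0; apply/eqP/xyz/eqP.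
rewrite -sqrf_eq0 nE; move/eqP: q10; rewrite mulf_eq0 powR_eq0 (negbTE sn0)/= subr_eq0.
by move=> /eqP <-; apply/eqP; ring.
Qed.

Lemma measurable_dotv (D : set E) (g h : E -> E) :
  (forall i, measurable_fun D (fun x => g x ord0 i)) ->
  (forall i, measurable_fun D (fun x => h x ord0 i)) ->
  measurable_fun D (fun x => dotv (g x) (h x)).
Proof.
by move=> mg mh; apply: measurable_sum => i; apply: measurable_funM.
Qed.

End monotone_operator.

Section weak_form.
Context {R : realType} {N : nat}.
Local Notation E := 'rV[R]_N.
Local Notation mu := (@lebesgue_rV R N).
Hypothesis N0 : (0 < N)%N.
Variables (m q : R).
Hypothesis m1 : 1 < m.
Hypothesis mq : m < q.

Let mB := @measurable_oball R N.

Lemma mlaplace_integrable (g h : E -> E) :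
  (forall i, mu.-integrable oball (EFin \o (fun x => g x ord0 i))) ->
  (forall i, mu.-integrable oball (EFin \o (fun x => h x ord0 i))) ->
  measurable_fun oball (fun x => enorm (g x)) ->
  mu.-integrable oball (EFin \o (fun x => enorm (g x) `^ m)) ->
  mu.-integrable oball (EFin \o (fun x => enorm (h x) `^ m)) ->
  mu.-integrable oball (EFin \o (fun x => enorm (g x) `^ (m - 2) * dotv (g x) (h x))).
Proof.
move=> gi hi mg gm hm.
apply: (@Rintegrable_le _ _ _ _ _ mB _ (fun x => enorm (g x) `^ m + enorm (h x) `^ m)).
- apply: measurable_funM.
    exact: (measurableT_comp (@measurable_powR R (m - 2))).
  by apply: measurable_dotv => i; exact: Rintegrable_measurable.
- move=> x _; apply: le_trans (mlaplace_flux_le _ _ m1) _.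
  by apply: powR_young => //; exact: enorm_ge0.
- exact: RintegrableD.
Qed.

Variable W : R -> R.
Hypothesis cW : cone_profile W.
Local Notation b := (reaction m q W).

Section neumann_profile.
Hypothesis J1 : radint N b 1 = 0.

Local Notation F := (radial_field (slope N m q W)).

Lemma slope0 : slope N m q W 0 = 0.
Proof. exact: (slope_le0 N q W m1). Qed.

Lemma mlaplace_slope_field (x y : E) : enorm x <= 1 ->
  enorm (F x) `^ (m - 2) * dotv (F x) y = radavg N b (enorm x) * dotv x y.
Proof.
move=> x1; rewrite enorm_radial_field ?slope0// ger0_norm ?slope_ge0//.
have e := powR_slope m1 mq cW J1 x1.
have [x0|x0] := eqVneq (enorm x) 0.
  by rewrite (enorm_eq0 x0) /radial_field scaler0 dotv0l !mulr0.
have [s1 _] := powR_split m1 (slope_ge0 N m q W (enorm x)).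
rewrite dotvZl !mulrA s1 e /flux; congr (_ * _).
by rewrite mulrAC mulfV// mul1r.
Qed.

Lemma slope_field_integrable :
  [/\ forall i, mu.-integrable oball (EFin \o (fun x : E => F x ord0 i)),
      measurable_fun oball (fun x : E => enorm (F x)) &
      mu.-integrable oball (EFin \o (fun x : E => enorm (F x) `^ m))].
Proof.
have cs := slope_continuous N0 m1 mq cW J1.
have eF (x : E) : enorm (F x) = slope N m q W (enorm x).
  by rewrite enorm_radial_field ?slope0// ger0_norm ?slope_ge0.
have F1 (x : E) : enorm (F x) <= 1.
  by rewrite eF ltW// (slope_lt1 N0 m1 mq cW J1).
split.
- move=> i; apply: integrable_continuous_oball.
  by apply: radial_field_continuous => //; exact: slope0.
- under eq_fun do rewrite eF.
  by apply: measurable_radial; exact: continuous_measurable_fun.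
- apply: (@integrable_bounded _ _ _ _ _ _ 1) => //; first exact: oball_finite.
    apply: (measurableT_comp (@measurable_powR R m)).
    under eq_fun do rewrite eF.
    by apply: measurable_radial; exact: continuous_measurable_fun.
  move=> x _; rewrite ger0_norm ?powR_ge0//; apply: powR_le1.
    by rewrite ltW// (lt_trans _ m1).
  by rewrite enorm_ge0 F1.
Qed.

(** The radial field with modulus [slope] solves the equation weakly, by the
    divergence theorem for the flux. *)
Lemma slope_field_weak (v : E -> R) (g : E -> E) : weak_gradient v g ->
  mu.-integrable oball (EFin \o v) ->
  (forall i, mu.-integrable oball (EFin \o (fun x => g x ord0 i))) ->
  \int[mu]_(x in oball) (enorm (F x) `^ (m - 2) * dotv (F x) (g x)) =
  - \int[mu]_(x in oball) (v x * b (enorm x)).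
Proof.
move=> vg vi gi.
have cb := reaction_continuous m1 mq cW.
have A1 : radavg N b 1 = 0 by rewrite /radavg J1 mul0r.
have := divergence_radial N0 vg vi gi cb (reaction_bound m1 mq cW).
rewrite A1 mulr0; under eq_Rintegral do rewrite subr0.
move=> ->; rewrite opprK; apply: eq_Rintegral => x /set_mem xB.
by rewrite subr0 mlaplace_slope_field ?(ltW xB)// dotvC mulrC.
Qed.

End neumann_profile.
End weak_form.

Section structure.
Context {R : realType} {N : nat}.
Local Notation E := 'rV[R]_N.
Local Notation mu := (@lebesgue_rV R N).
Local Notation lam := (@lebesgue_measure R).
Hypothesis N0 : (0 < N)%N.
Variables (m q : R).
Hypothesis m1 : 1 < m.
Hypothesis mq : m < q.

Let mB := @measurable_oball R N.

(** The radial form of the problem: the first condition is the cone, the second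
    one the Neumann condition, and the last one the equation, integrated once. *)
Definition radial_profile W : Prop :=
  [/\ cone_profile W, radint N (reaction m q W) 1 = 0, W 0 <= 1 <= W 1 &
      forall r, is_derive r (1 : R) W (slope N m q W r)].

Let oballC (c : R) : mu.-integrable oball (EFin \o (fun _ : E => c)).
Proof.
by apply: (@integrable_bounded _ _ _ _ _ _ `|c|) => //; exact: oball_finite.
Qed.

Lemma radial_mul_integrable (f : R -> R) (M : R) (v : E -> R) : continuous f ->
  (forall r, `|f r| <= M) -> mu.-integrable oball (EFin \o v) ->
  mu.-integrable oball (EFin \o (fun x => v x * f (enorm x))).
Proof.
move=> cf fM vi; apply: (@Rintegrable_mul_bounded _ _ _ _ _ mB _ _ M) => //.
by apply: measurable_radial; exact: continuous_measurable_fun.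
Qed.

Lemma radial_integrable (f : R -> R) : continuous f ->
  mu.-integrable oball (EFin \o (fun x : E => f (enorm x))).
Proof.
move=> cf; apply: integrable_continuous_oball => x.
apply: (@continuous_comp _ _ _ (@enorm R N) f); last exact: cf.
exact: enorm_continuous.
Qed.

Lemma antiderivative_out (z h : R -> R) : continuous h ->
  (forall r, is_derive r (1 : R) z (h r)) ->
  (forall r, r <= 0 -> h r = 0) -> (forall r, 1 <= r -> h r = 0) ->
  (forall r, r <= 0 -> z r = z 0) /\ (forall r, 1 <= r -> z r = z 1).
Proof.
move=> ch zh h0 h1; have cz r : {for r, continuous z} by exact: is_derive_continuous (zh r).
have zero (a c : R) : a <= c -> (forall t, a <= t <= c -> h t = 0) -> z c = z a.
  move=> ac hac; apply/eqP; rewrite -subr_eq0 -(@RFTC2 R h z a c)//.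
  rewrite (@eq_Rintegral _ _ _ _ _ (fun=> 0)) ?Rintegral_cst ?mul0r// => t.
  by rewrite inE/= in_itv/=; exact: hac.
split => r hr; first by symmetry; apply: zero => // t /andP[_]; exact: h0.
by apply: zero => // t /andP[+ _]; exact: h1.
Qed.

(** Two radial functions whose weak gradients agree differ by a constant c: the
    divergence theorem for the radial field with divergence y - c, where y is
    the difference and c its mean, gives that the integral of (y - c)^2 is 0. *)
Lemma radial_gradient_eq (y : R -> R) (M : R) (u v : E -> R) (G F : E -> E) :
  continuous y -> (forall r, `|y r| <= M) ->
  weak_gradient u G -> weak_gradient v F ->
  mu.-integrable oball (EFin \o u) -> mu.-integrable oball (EFin \o v) ->
  (forall i, mu.-integrable oball (EFin \o (fun x => G x ord0 i))) ->
  (forall i, mu.-integrable oball (EFin \o (fun x => F x ord0 i))) ->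
  {ae mu, forall x, oball x -> G x = F x} ->
  {ae mu, forall x, oball x -> u x - v x = y (enorm x)} ->
  exists c, forall r, 0 <= r <= 1 -> y r = c.
Proof.
move=> cy yM uG vF ui vi Gi Fi GF uv.
pose c := N%:R * radavg N y 1; exists c => r r01.
have du := divergence_radial N0 uG ui Gi cy yM.
have dv := divergence_radial N0 vF vi Fi cy yM.
have cyc : continuous (fun r => y r - c) by move=> t; apply: cvgB; [exact: cy|exact: cvg_cst].
have ycM t : `|y t - c| <= M + `|c| by rewrite (le_trans (ler_normB _ _))// lerD2r.
have e1 : \int[mu]_(x in oball) (u x * (y (enorm x) - c)) =
    \int[mu]_(x in oball) (v x * (y (enorm x) - c)).
  rewrite du dv; congr (- _); apply: ae_Rintegral.
  by apply: filterS GF => x h xB; rewrite h.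
have e2 : \int[mu]_(x in oball) (y (enorm x) * (y (enorm x) - c)) = 0.
  rewrite (ae_Rintegral (g := fun x => u x * (y (enorm x) - c) - v x * (y (enorm x) - c))).
    rewrite RintegralB//; first by rewrite e1 subrr.
    - exact: radial_mul_integrable cyc ycM ui.
    - exact: radial_mul_integrable cyc ycM vi.
  by apply: filterS uv => x h xB; rewrite -mulrBl h.
have e3 := Rintegral_radial N0 cy yM.
have cy2 : continuous (fun r => (y r - c) ^+ 2).
  move=> t; apply: (@continuous_comp _ _ _ (fun r => y r - c) (fun s => s ^+ 2)).
    exact: cyc.
  exact: exprn_continuous.
have e4 : \int[mu]_(x in oball) ((y (enorm x) - c) ^+ 2) = 0.
  transitivity (\int[mu]_(x in oball) (y (enorm x) * (y (enorm x) - c) - c * (y (enorm x) - c))).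
    by apply: eq_Rintegral => x _; ring.
  rewrite RintegralB//; last 2 first.
  - apply: (radial_integrable (f := fun r => y r * (y r - c))) => t.
    by apply: cvgM; [exact: cy|exact: cyc].
  - by apply: RintegrableZ => //; exact: (radial_integrable cyc).
  by rewrite e2 RintegralZl// ?e3 ?mulr0 ?subr0//; exact: (radial_integrable cyc).
have h : {ae mu, forall x, oball x -> (y (enorm x) - c) ^+ 2 = 0}.
  apply: Rintegral_eq0_ae => //; first exact: radial_integrable cy2.
  by move=> x _; exact: sqr_ge0.
have /eqP := radial_ae_eq0 N0 cy2 h r01.
by rewrite sqrf_eq0 subr_eq0 => /eqP.
Qed.

Section solution.
Variable u : E -> R.
Hypothesis us : cone_solution m q u.
Variable W : R -> R.
Hypothesis cW : cone_profile W.
Hypothesis uW : has_profile u W.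
Variable G : E -> E.
Hypothesis uG : weak_gradient u G.
Hypothesis Gi : forall i, mu.-integrable oball (EFin \o (fun x => G x ord0 i)).
Hypothesis mG : measurable_fun oball (fun x => enorm (G x)).
Hypothesis Gm : mu.-integrable oball (EFin \o (fun x => enorm (G x) `^ m)).
Hypothesis ui : mu.-integrable oball (EFin \o u).
Local Notation b := (reaction m q W).

Let m10 : 0 < m - 1. Proof. by rewrite subr_gt0. Qed.
Let q10 : 0 < q - 1. Proof. by rewrite subr_gt0 (lt_trans m1). Qed.

Lemma cone_solution_weak (v : E -> R) (g : E -> E) : W1 m v -> weak_gradient v g ->
  mu.-integrable oball (EFin \o v) ->
  (forall i, mu.-integrable oball (EFin \o (fun x => g x ord0 i))) ->
  mu.-integrable oball (EFin \o (fun x => enorm (g x) `^ m)) ->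
  \int[mu]_(x in oball) (enorm (G x) `^ (m - 2) * dotv (G x) (g x)) =
  - \int[mu]_(x in oball) (v x * b (enorm x)).
Proof.
move=> vW vg vi gi gm; have [_ _ /(_ v vW)] := us.
have [cWc _ W_ge0 _ _] := cW.
have Wi (a : R) : 0 < a -> mu.-integrable oball (EFin \o (fun x : E => v x * W (enorm x) `^ a)).
  move=> a0; apply: (radial_mul_integrable (f := fun r => W r `^ a) (M := W 1 `^ a)) => //.
    exact: continuous_powR_comp.
  move=> r; rewrite ger0_norm ?powR_ge0// ge0_ler_powR ?nnegrE ?(ltW a0)//.
  exact: profile_le_W1.
have Xi := mlaplace_integrable m1 Gi gi mG Gm gm.
rewrite (ae_Rintegral (g := fun x => enorm (G x) `^ (m - 2) * dotv (G x) (g x) +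
    v x * W (enorm x) `^ (m - 1))); last first.
  apply: filterS3 uW (wgrad_ae uG) (wgrad_ae vg) => x h1 h2 h3 xB.
  by rewrite h1// h2// h3// [X in _ + X]mulrC.
rewrite [RHS](ae_Rintegral (g := fun x => v x * W (enorm x) `^ (q - 1))); last first.
  by apply: filterS uW => x h1 xB; rewrite h1// mulrC.
rewrite RintegralD//; last exact: Wi.
under [X in _ -> _ = - X]eq_Rintegral do rewrite mulrBr.
by rewrite RintegralB//; [lra|exact: Wi|exact: Wi].
Qed.

(** The equation tested with the constant 1. *)
Lemma cone_solution_balance : radint N b 1 = 0.
Proof.
have m0 : 0 <= m by rewrite ltW// (lt_trans ltr01).
have h := cone_solution_weak (W1_cst 1 m0) (@weak_gradient_cst R N 1) (oballC 1)
  (fun i => oballC ((0 : E) ord0 i)) (oballC (enorm (0 : E) `^ m)).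
have e0 : \int[mu]_(x in oball) b (enorm x) = 0.
  apply/eqP; rewrite -oppr_eq0; apply/eqP; move: h.
  under eq_Rintegral do rewrite dotvC dotv0l mulr0.
  under [X in _ = - X]eq_Rintegral do rewrite mul1r.
  by rewrite Rintegral_cst// mul0r => <-.
have cb := reaction_continuous m1 mq cW.
have := Rintegral_radial N0 cb (reaction_bound m1 mq cW).
rewrite RintegralB//; last exact: radial_integrable.
rewrite e0 Rintegral_cst// sub0r => /eqP; rewrite oppr_eq0 mulf_eq0 => /orP[|].
  by rewrite mulf_eq0 pnatr_eq0 (gtn_eqF N0)/= /radavg expr1n divr1 => /eqP.
rewrite fine_eq0 ?gt_eqF ?oball_gt0//.
by rewrite ge0_fin_numE// oball_finite.
Qed.

Let J1 := cone_solution_balance.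
Local Notation F := (radial_field (slope N m q W)).

(** The two fields satisfy the same weak equation, so the integral of the
    monotone expression in G and F, tested with u and with the antiderivative of
    the slope, is 0; its integrand is nonnegative, and 0 only where G = F. *)
Lemma cone_solution_gradient : {ae mu, forall x, oball x -> G x = F x}.
Proof.
have [Fi mF Fm] := @slope_field_integrable R N N0 m q m1 mq W cW J1.
have cs := slope_continuous N0 m1 mq cW J1.
have s0 : slope N m q W 0 = 0 by exact: (slope0 (N := N) q m1 W).
have [z zs] := antiderivative cs (fun t h => slope_le0 N q W m1 h).
have zF := @weak_gradient_radial R N z _ cs s0 zs.
have zW : W1 m (fun x : E => z (enorm x)).
  by apply: (W1_radial _ cs s0 zs); rewrite ltW// (lt_trans ltr01).
have cz : continuous z by move=> r; exact: is_derive_continuous (zs r).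
have zi := radial_integrable cz.
have uW1 : W1 m u by have [[[]]] := us.
have e1 := cone_solution_weak uW1 uG ui Gi Gm.
rewrite -(slope_field_weak N0 m1 mq cW J1 uG ui Gi) in e1.
have e2 := cone_solution_weak zW zF zi Fi Fm.
rewrite -(slope_field_weak N0 m1 mq cW J1 zF zi Fi) in e2.
have i1 := mlaplace_integrable m1 Gi Gi mG Gm Gm.
have i2 := mlaplace_integrable m1 Gi Fi mG Gm Fm.
have i3 := mlaplace_integrable m1 Fi Gi mF Fm Gm.
have i4 := mlaplace_integrable m1 Fi Fi mF Fm Fm.
pose d x := enorm (G x) `^ (m - 2) * dotv (G x) (G x - F x) -
  enorm (F x) `^ (m - 2) * dotv (F x) (G x - F x).
have dE : d = (fun x =>
    (enorm (G x) `^ (m - 2) * dotv (G x) (G x) - enorm (G x) `^ (m - 2) * dotv (G x) (F x)) -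
    (enorm (F x) `^ (m - 2) * dotv (F x) (G x) - enorm (F x) `^ (m - 2) * dotv (F x) (F x))).
  by apply/funext => x; rewrite /d !dotvDr !dotvNr; ring.
have di : mu.-integrable oball (EFin \o d).
  by rewrite dE; apply: RintegrableB => //; apply: RintegrableB.
have d0 : \int[mu]_(x in oball) d x = 0.
  rewrite dE RintegralB//; [|exact: RintegrableB|exact: RintegrableB].
  by rewrite RintegralB// RintegralB// e1 e2 subrr.
have := Rintegral_eq0_ae mB di (fun x _ => proj1 (mlaplace_monotone (G x) (F x) m1)) d0.
by apply: filterS => x h xB; apply: (proj2 (mlaplace_monotone (G x) (F x) m1)); exact: h.
Qed.

Lemma cone_solution_derive r : is_derive r (1 : R) W (slope N m q W r).
Proof.
have [Fi mF Fm] := @slope_field_integrable R N N0 m q m1 mq W cW J1.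
have cs := slope_continuous N0 m1 mq cW J1.
have s0 : slope N m q W 0 = 0 by exact: (slope0 (N := N) q m1 W).
have [z zs] := antiderivative cs (fun t h => slope_le0 N q W m1 h).
have zF := @weak_gradient_radial R N z _ cs s0 zs.
have cz : continuous z by move=> t; exact: is_derive_continuous (zs t).
have zi := radial_integrable cz.
have [z0 z1] := antiderivative_out cs zs (fun t h => slope_le0 N q W m1 h)
  (fun t h => slope_ge1 m1 J1 h).
have [cWc _ W_ge0 W_0 W_1] := cW.
pose y t := W t - z t.
have cy : continuous y by move=> t; apply: cvgB; [exact: cWc|exact: cz].
have clamp t : exists2 s, 0 <= s <= 1 & y t = y s.
  have [t0|t0] := leP t 0.
    by exists 0; rewrite ?lexx ?ler01// /y W_0// z0.
  have [t1|t1] := leP 1 t.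
    by exists 1; rewrite ?lexx ?ler01// /y W_1// z1.
  by exists t; rewrite ?(ltW t0) ?(ltW t1).
have [M yM] : exists M, forall t, `|y t| <= M.
  have [C [_ hC]] : bounded_set (y @` `[0, 1]).
    apply: compact_bounded; apply: continuous_compact; last exact: segment_compact.
    exact: continuous_subspaceT.
  exists (C + 1) => t; have [s s01 ->] := clamp t.
  by apply: (hC (C + 1)); rewrite ?ltrDl//; exists s => //=; rewrite in_itv.
have [c yc] : exists c, forall r, 0 <= r <= 1 -> y r = c.
  apply: (radial_gradient_eq cy yM uG zF ui zi Gi Fi cone_solution_gradient).
  by apply: filterS uW => x h xB; rewrite h.
have zW : z + cst c = W.
  apply/funext => t; have [s s01 e] := clamp t.
  have h : W t - z t = c by rewrite -(yc s s01) -e.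
  by change (z t + c = W t); rewrite -h subrKC.
have := is_deriveD (zs r) (is_derive_cst c r (1 : R)).
by rewrite addr0 zW.
Qed.

(** If W > 1 everywhere, or W < 1 everywhere, then the reaction has one sign and
    integral 0, so it vanishes; but its zeros are the values 0 and 1 of W. *)
Lemma cone_solution_range : W 0 <= 1 <= W 1.
Proof.
have cb := reaction_continuous m1 mq cW.
have bi := radial_integrable cb.
have [cWc _ W_ge0 W_0 W_1] := cW.
have b0 : \int[mu]_(x in oball) b (enorm x) = 0.
  have := Rintegral_radial N0 cb (reaction_bound m1 mq cW).
  by rewrite /radavg J1 mul0r mulr0; under eq_Rintegral do rewrite subr0.
apply/andP; split; rewrite leNgt; apply/negP => h.
  have : {ae mu, forall x : E, oball x -> - b (enorm x) = 0}.
    apply: Rintegral_eq0_ae => //.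
    - by rewrite (_ : (fun x => _) = (fun x => -1 * b (enorm x))); [exact: RintegrableZ|apply/funext => x; rewrite mulN1r].
    - move=> x _; rewrite oppr_ge0; apply: (reaction_le0 mq).
      by rewrite (le_trans (ltW h))// profile_ge_W0.
    - under eq_Rintegral do rewrite -mulN1r.
      by rewrite RintegralZl// b0 mulr0.
  have cb' : continuous (fun r => - b r) by move=> r; apply: cvgN; exact: cb.
  move=> /(radial_ae_eq0 N0 cb')/(_ 0); rewrite lexx ler01 => /(_ isT)/eqP.
  rewrite oppr_eq0 => /eqP /(reaction_eq0 mq cW)[] W0; move: h; rewrite W0 ?ltxx//.
  by rewrite ltr10.
have : {ae mu, forall x : E, oball x -> b (enorm x) = 0}.
  apply: Rintegral_eq0_ae => // x _; apply: (reaction_ge0 m1 mq cW).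
  by rewrite (le_trans (profile_le_W1 cW _))// ltW.
move=> /(radial_ae_eq0 N0 cb)/(_ 1); rewrite lexx ler01 => /(_ isT).
move=> /(reaction_eq0 mq cW)[] W1; last by move: h; rewrite W1 ltxx.
have [_ upos _] := us.
have : {ae mu, forall x : E, ~ oball x}.
  apply: filterS2 upos uW => x h1 h2 xB; move: (h1 xB); rewrite h2// ltNge => /negP; apply.
  by rewrite -W1 profile_le_W1.
move=> [Z [mZ Z0 sZ]]; have := @oball_gt0 R N; rewrite ltNge => /negP; apply.
by rewrite -Z0; apply: le_measure; rewrite ?inE// => x xB; apply: sZ => /= nB; exact: nB xB.
Qed.

End solution.

Lemma cone_solution_profile (u : E -> R) : cone_solution m q u ->
  exists2 W, radial_profile W & has_profile u W.
Proof.
move=> us; have [uc _ _] := us; have [[uW1 _] _] := uc.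
have [W cW uW] := in_cone_profile N0 uc.
have [G [uG Gi mG Gm ui]] := W1_gradient (ltW m1) uW1.
exists W => //; split => //.
- by apply: cone_solution_balance; [exact: us|exact: cW|exact: uW|exact: uG|..].
- by apply: cone_solution_range; [exact: us|exact: cW|exact: uW|exact: uG|..].
- by apply: cone_solution_derive; [exact: us|exact: cW|exact: uW|exact: uG|..].
Qed.

End structure.

(** * Energy and Nehari identity of radial profiles *)

Section one_dimensional_energy.
Context {R : realType}.
Local Notation lam := (@lebesgue_measure R).
Implicit Types m q l t : R.

Lemma s0_gt2 m q : 0 < m -> m < q -> 2 < s0 m q.
Proof.
move=> m0 mq; rewrite /s0 (_ : 2 = 1 + 1 :> R) ?ltrD2r; last by ring.
rewrite -[ltLHS](powR1r (q - m)^-1); apply: gt0_ltr_powR.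
- by rewrite invr_gt0 subr_gt0.
- by rewrite nnegrE.
- by rewrite nnegrE divr_ge0// ltW// (lt_trans m0).
- by rewrite ltr_pdivlMr// mul1r.
Qed.

Lemma fq_le m q l t : t <= s0 m q -> fq m q l t = t `^ (q - 1).
Proof. by rewrite /fq => ->. Qed.

Lemma Fq_le m q l t : 1 < q -> 0 <= t -> t <= s0 m q -> Fq m q l t = t `^ q / q.
Proof.
move=> q1 t0 ts; have q0 : 0 < q by rewrite (lt_trans _ q1).
have q10 : 0 < q - 1 by rewrite subr_gt0.
have cmax : continuous (fun s : R => Num.max s 0) by exact: max0_continuous.
have cp a : 0 < a -> continuous (fun s : R => Num.max s 0 `^ a).
  move=> a0; apply: continuous_powR_comp => // s.
  by rewrite le_max lexx orbT.
have cF : continuous (fun s : R => Num.max s 0 `^ q / q).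
  by move=> s; apply: cvgM; [exact: cp|exact: cvg_cst].
transitivity (\int[lam]_(s in `[0, t]) (Num.max s 0 `^ (q - 1))).
  apply: eq_Rintegral => s /set_mem; rewrite /= in_itv/= => /andP[s0' st].
  by rewrite fq_le ?(le_trans st)// max_l.
have dF s : 0 < s < t -> is_derive s (1 : R) (fun s : R => Num.max s 0 `^ q / q)
    (Num.max s 0 `^ (q - 1)).
  move=> /andP[s_gt0 _]; rewrite max_l ?ltW//.
  have d1 : is_derive s (1 : R) (fun s : R => s `^ q / q) (s `^ (q - 1)).
    have s_itv : s \in `]0, +oo[ by rewrite in_itv/= s_gt0.
    have dp : is_derive s (1 : R) (fun s : R => s `^ q) (q * s `^ (q - 1)).
      split; first exact: derivable_powR.
      by rewrite -derive1E powR_derive1.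
    have h := is_deriveM dp (is_derive_cst (q^-1) s (1 : R)).
    apply: (is_derive_eq h); rewrite /GRing.scale/= mulr0 add0r.
    by rewrite mulrA mulVf ?gt_eqF// mul1r.
  apply: near_eq_is_derive d1.
  by near=> r; rewrite max_l//; near: r; exact: lt_le_nbhsr.
rewrite (RFTC2 t0 (cp _ q10) dF (cF 0) (cF t)).
by rewrite max_l// maxxx powR0 ?gt_eqF// mul0r subr0.
Unshelve. all: by end_near. Qed.

End one_dimensional_energy.

Section profile_integrals.
Context {R : realType} {N : nat}.
Local Notation E := 'rV[R]_N.
Local Notation mu := (@lebesgue_rV R N).
Hypothesis N0 : (0 < N)%N.

Let mB := @measurable_oball R N.

Definition C1_profile (W h : R -> R) : Prop :=
  [/\ cone_profile W, continuous h, h 0 = 0, forall r, 0 <= h r &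
      forall r, is_derive r (1 : R) W (h r)].

Lemma radial_powR_integrable (f : R -> R) (a : R) : 0 < a -> continuous f ->
  (forall r, 0 <= f r) ->
  mu.-integrable oball (EFin \o (fun x : E => f (enorm x) `^ a)).
Proof.
move=> a0 cf f0; apply: (radial_integrable (f := fun r => f r `^ a)).
exact: continuous_powR_comp.
Qed.

Section C1.
Variables (W h : R -> R).
Hypothesis cW : C1_profile W h.

Let cone_W : cone_profile W. Proof. by have [] := cW. Qed.
Let cont_W : continuous W. Proof. by have [] := cone_W. Qed.
Let W0 r : 0 <= W r. Proof. by have [] := cone_W. Qed.
Let h0 r : 0 <= h r. Proof. by have [] := cW. Qed.
Let cont_h : continuous h. Proof. by have [] := cW. Qed.

Lemma C1_profileZ (t : R) : 0 <= t -> C1_profile (fun r => t * W r) (fun r => t * h r).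
Proof.
move=> t0; have [[_ homoW _ W_0 W_1] _ h00 _ dW] := cW; split.
- split.
  + by move=> r; apply: cvgM; [exact: cvg_cst|exact: cont_W].
  + by move=> r s rs; rewrite ler_wpM2l// homoW.
  + by move=> r; rewrite mulr_ge0.
  + by move=> r r0; rewrite W_0.
  + by move=> r r1; rewrite W_1.
- by move=> r; apply: cvgM; [exact: cvg_cst|exact: cont_h].
- by rewrite h00 mulr0.
- by move=> r; rewrite mulr_ge0.
- by move=> r; have := is_deriveZ t (dW r).
Qed.

Lemma C1_weak_gradient : weak_gradient (fun x : E => W (enorm x)) (radial_field h).
Proof. by have [_ ch hz _ dW] := cW; exact: weak_gradient_radial. Qed.

Lemma C1_W1 (m : R) : 0 <= m -> W1 m (fun x : E => W (enorm x)).
Proof. by move=> m0; have [_ ch hz _ dW] := cW; apply: (W1_radial m0 ch hz dW). Qed.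

Lemma C1_in_cone (m : R) : 0 <= m -> in_cone m (fun x : E => W (enorm x)).
Proof.
move=> m0; have hp : has_profile (fun x : E => W (enorm x)) W by apply: aeW.
split; first by split; [exact: C1_W1|exists W].
have [_ homoW _ _ _] := cone_W.
exists W; split => //; first exact: continuous_subspaceT.
by move=> r s _ rs _; exact: homoW.
Qed.

Section integrals.
Variable u : E -> R.
Hypothesis uW : has_profile u W.

Lemma profile_weak_gradient : weak_gradient u (radial_field h).
Proof.
apply: weak_gradient_ae C1_weak_gradient.
by apply: filterS uW => x e xB; rewrite e.
Qed.

Lemma profile_wgrad : {ae mu, forall x, oball x -> enorm (wgrad u x) = h (enorm x)}.
Proof.
have [_ _ hz _ _] := cW.
apply: filterS (wgrad_ae profile_weak_gradient) => x e xB.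
by rewrite e// enorm_radial_field// ger0_norm.
Qed.

Lemma nehari_lhs_profile (m : R) :
  \int[mu]_(x in oball) (enorm (wgrad u x) `^ m + `|u x| `^ m) =
  \int[mu]_(x in oball) (h (enorm x) `^ m + W (enorm x) `^ m).
Proof.
apply: ae_Rintegral; apply: filterS2 profile_wgrad uW => x e1 e2 xB.
by rewrite e1// e2// ger0_norm.
Qed.

Variables (m q l : R).
Hypothesis m1 : 1 < m.
Hypothesis mq : m < q.
Hypothesis Ws0 : W 1 <= s0 m q.

Let W_s0 r : W r <= s0 m q. Proof. exact: le_trans (profile_le_W1 cone_W r) Ws0. Qed.
Let m0 : 0 < m. Proof. exact: lt_trans m1. Qed.
Let q0 : 0 < q. Proof. exact: lt_trans mq. Qed.

Lemma nehari_rhs_profile :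
  \int[mu]_(x in oball) (fq m q l (u x) * u x) =
  \int[mu]_(x in oball) (W (enorm x) `^ q).
Proof.
apply: ae_Rintegral; apply: filterS uW => x e xB.
by rewrite e// fq_le// mulrC mulr_powRB1.
Qed.

Lemma energy_profile :
  \int[mu]_(x in oball) (h (enorm x) `^ m + W (enorm x) `^ m) =
  \int[mu]_(x in oball) (W (enorm x) `^ q) ->
  energy m q l u = (m^-1 - q^-1) * \int[mu]_(x in oball) (W (enorm x) `^ q).
Proof.
move=> neh; rewrite /energy.
rewrite (ae_Rintegral (g := fun x => m^-1 * (h (enorm x) `^ m + W (enorm x) `^ m) -
    q^-1 * W (enorm x) `^ q)); last first.
  apply: filterS2 profile_wgrad uW => x e1 e2 xB.
  rewrite e1// e2// ger0_norm// Fq_le//; first by ring.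
  exact: lt_trans mq.
have hi := radial_powR_integrable m0 cont_h h0.
have Wi := radial_powR_integrable m0 cont_W W0.
have Wq := radial_powR_integrable q0 cont_W W0.
rewrite RintegralB//; [|by apply: RintegrableZ => //; exact: RintegrableD|exact: RintegrableZ].
rewrite RintegralZl//; last exact: RintegrableD.
by rewrite RintegralZl// neh mulrBl.
Qed.

Lemma nehari_profile :
  \int[mu]_(x in oball) (h (enorm x) `^ m + W (enorm x) `^ m) =
  \int[mu]_(x in oball) (W (enorm x) `^ q) ->
  0 < W 1 -> in_cone m u -> nehari m q l u.
Proof.
move=> neh W1 uc; split => //; last by rewrite nehari_lhs_profile nehari_rhs_profile.
move=> u0; have : {ae mu, forall x : E, oball x -> W (enorm x) = 0}.
  by apply: filterS2 uW u0 => x e1 e2 xB; rewrite -e1// e2.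
move=> /(radial_ae_eq0 N0 cont_W)/(_ 1); rewrite ler01 lexx => /(_ isT) W10.
by move: W1; rewrite W10 ltxx.
Qed.

End integrals.
End C1.
End profile_integrals.

Section radial_profiles.
Context {R : realType} {N : nat}.
Local Notation E := 'rV[R]_N.
Local Notation mu := (@lebesgue_rV R N).
Hypothesis N0 : (0 < N)%N.
Variables (m q : R).
Hypothesis m1 : 1 < m.
Hypothesis mq : m < q.
Variable W : R -> R.
Hypothesis WP : @radial_profile R N m q W.

Let mB := @measurable_oball R N.
Let cW : cone_profile W. Proof. by have [] := WP. Qed.
Let J1 : radint N (reaction m q W) 1 = 0. Proof. by have [] := WP. Qed.
Let dW r : is_derive r (1 : R) W (slope N m q W r). Proof. by have [_ _ _ h] := WP; exact: h. Qed.
Let cont_W : continuous W. Proof. by have [] := cW. Qed.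
Let W_ge0 r : 0 <= W r. Proof. by have [] := cW. Qed.
Let m0 : 0 < m. Proof. exact: lt_trans m1. Qed.
Let q0 : 0 < q. Proof. exact: lt_trans mq. Qed.

Lemma radial_profile_C1 : C1_profile W (slope N m q W).
Proof.
split => //.
- exact: (slope_continuous N0 m1 mq cW J1).
- exact: (slope0 (N := N) q m1 W).
- exact: slope_ge0.
Qed.

Lemma radial_profile_MVT (a c : R) : a < c ->
  exists2 x, a < x < c & W c - W a = slope N m q W x * (c - a).
Proof.
move=> ac; have [x] := MVT ac (fun x _ => dW x) (continuous_subspaceT cont_W).
by rewrite in_itv/=; exists x.
Qed.

Lemma radial_profile_lipschitz r s : `|W r - W s| <= `|r - s|.
Proof.
wlog sr : r s / s <= r => [hw|].
  by have [/hw//|/ltW/hw] := leP s r; rewrite distrC [leRHS]distrC.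
move: sr; rewrite le_eqVlt => /predU1P[->|sr]; first by rewrite !subrr.
have [x _ ->] := radial_profile_MVT sr.
rewrite normrM ger0_norm ?slope_ge0// ler_piMl//.
by rewrite ltW// (slope_lt1 N0 m1 mq cW J1).
Qed.

(** The values of a solution stay below the level s0 > 2 from which on the
    nonlinearity is modified. *)
Lemma radial_profile_lt2 r : W r < 2.
Proof.
apply: (le_lt_trans (profile_le_W1 cW r)).
have [x x01] := radial_profile_MVT (ltr01 : (0 : R) < 1).
rewrite subr0 mulr1 => e; have := slope_lt1 N0 m1 mq cW J1 x.
by have [_ _ /andP[W0 _] _] := WP; lra.
Qed.

Lemma radial_profile_le_s0 : W 1 <= s0 m q.
Proof. by rewrite ltW// (lt_trans (radial_profile_lt2 _))// s0_gt2. Qed.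

Lemma radial_profile_gt0 : 0 < W 1.
Proof. by have [_ _ /andP[_ W1] _] := WP; rewrite (lt_le_trans _ W1). Qed.

(** The weak equation tested with the solution itself. *)
Lemma radial_profile_nehari :
  \int[mu]_(x in oball) (slope N m q W (enorm x) `^ m + W (enorm x) `^ m) =
  \int[mu]_(x in oball) (W (enorm x) `^ q).
Proof.
have [_ cs s0 sp _] := radial_profile_C1.
have [Fi mF Fm] := @slope_field_integrable R N N0 m q m1 mq W cW J1.
have := slope_field_weak N0 m1 mq cW J1 (C1_weak_gradient radial_profile_C1)
  (radial_integrable cont_W) Fi.
under eq_Rintegral => x _.
  rewrite mulrC -sqr_enorm enorm_radial_field// ger0_norm// expr2 mulrAC -mulrA.
  have [e1 e2] := powR_split m1 (sp (enorm x)); rewrite e1 mulrC e2; over.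
have hi := radial_powR_integrable (N := N) m0 cs sp.
have Wi := radial_powR_integrable (N := N) m0 cont_W W_ge0.
have Wq := radial_powR_integrable (N := N) q0 cont_W W_ge0.
under [X in _ = - X -> _]eq_Rintegral => x _.
  rewrite mulrBr !mulr_powRB1 ?(lt_trans _ mq)//; over.
by rewrite RintegralB// RintegralD//; lra.
Qed.

Lemma radial_profile_solution : 0 < W 0 -> cone_solution m q (fun x : E => W (enorm x)).
Proof.
move=> W0; have [_ cs s0 sp _] := radial_profile_C1.
have m10 : 0 < m - 1 by rewrite subr_gt0.
have q10 : 0 < q - 1 by rewrite subr_gt0 (lt_trans m1).
have uF := C1_weak_gradient (N := N) radial_profile_C1.
split.
- by apply: (C1_in_cone radial_profile_C1); exact: ltW.
- by apply: aeW => x _; rewrite (lt_le_trans W0)// profile_ge_W0.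
- move=> v vW; have [g [vg gi mg gm vi]] := W1_gradient (ltW m1) vW.
  have [Fi mF Fm] := @slope_field_integrable R N N0 m q m1 mq W cW J1.
  have Wi (a : R) : 0 < a -> mu.-integrable oball (EFin \o (fun x : E => v x * W (enorm x) `^ a)).
    move=> a0; apply: (radial_mul_integrable (f := fun r => W r `^ a) (M := W 1 `^ a)) => //.
      exact: continuous_powR_comp.
    move=> r; rewrite ger0_norm ?powR_ge0// ge0_ler_powR ?nnegrE ?(ltW a0)//.
    exact: profile_le_W1.
  have := slope_field_weak N0 m1 mq cW J1 vg vi gi.
  have Xi := mlaplace_integrable m1 Fi gi mF Fm gm.
  under [X in _ = - X -> _]eq_Rintegral do rewrite mulrBr.
  rewrite RintegralB//; [|exact: Wi|exact: Wi] => h.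
  rewrite (ae_Rintegral (g := fun x => enorm (radial_field (slope N m q W) x) `^ (m - 2) *
      dotv (radial_field (slope N m q W) x) (g x) + v x * W (enorm x) `^ (m - 1))); last first.
    apply: filterS2 (wgrad_ae uF) (wgrad_ae vg) => x h1 h2 xB.
    by rewrite h1// h2// [X in _ + X]mulrC.
  rewrite RintegralD//; last exact: Wi.
  rewrite h; under [RHS]eq_Rintegral do rewrite mulrC.
  by rewrite opprB subrK.
Qed.

End radial_profiles.

(** For m = 2 the slope at x is at most x W(1), so by the mean value theorem
    W(1) - W(0) <= x W(1) with some x < 1. *)
Lemma radial_profile2_gt0 (R : realType) (N : nat) (q : R) (W : R -> R) :
  (0 < N)%N -> 2 < q -> @radial_profile R N 2 q W -> 0 < W 0.
Proof.
move=> N0 q2 WP; have m1 : (1 : R) < 2 by rewrite ltr1n.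
have [cW J1 /andP[_ W1] _] := WP; have [cWc homoW W_ge0 _ _] := cW.
have W1p : 0 < W 1 by rewrite (lt_le_trans _ W1).
have [x /andP[x0 x1]] := radial_profile_MVT WP (ltr01 : (0 : R) < 1).
rewrite subr0 mulr1 /slope min_l ?ltW// (_ : 2 - 1 = 1 :> R); last by ring.
rewrite invr1 powRr1; last by apply: (flux_ge0 m1 q2 cW J1); exact: ltW.
have fx : flux N 2 q W x <= x * W 1.
  apply: (flux_le_max N0 m1 q2 cW (ltW x0)) => // s _.
  rewrite /reaction (_ : 2 - 1 = 1 :> R); last by ring.
  rewrite powRr1// lerBlDr (le_trans (profile_le_W1 cW s))// lerDl powR_ge0//.
have : x * W 1 < W 1 by rewrite gtr_pMl.
by lra.
Qed.

(** * Compactness *)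

Section compactness.
Context {R : realType}.

(** The Arzela-Ascoli theorem for Lipschitz functions on the line: by Tychonoff's
    theorem the sequence has a cluster point for pointwise convergence, and a
    subsequence converges to it at the rationals, hence everywhere. *)
Lemma lipschitz_subsequence (w : nat -> R -> R) (C : R) :
  (forall n r, 0 <= w n r <= C) ->
  (forall n r s, `|w n r - w n s| <= `|r - s|) ->
  exists tau : nat -> nat, (forall k, (k <= tau k)%N) /\
    exists W : R -> R, forall r, w (tau k) r @[k --> \oo] --> W r.
Proof.
move=> wC wL.
pose T := prod_topology (fun _ : R => R).
pose K : set T := [set f | forall r, `[0, C]%classic (f r)].
have cK : compact K.
  by apply: (@tychonoff R (fun _ => R) (fun _ => `[0, C]%classic)) => r; exact: segment_compact.
pose F : set_system T := (w : nat -> T) @ \oo.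
have FF : ProperFilter F by exact: fmap_proper_filter.
have FK : F K.
  by exists 0%N => // n _ r; rewrite /= in_itv/=; exact: wC.
have [f [_ clf]] := cK F FF FK.
have nb (r e : R) : 0 < e -> nbhs (f : T) [set g : T | `|g r - f r| < e].
  move=> e0; have h : nbhs (f r) [set y | `|y - f r| < e].
    by apply/nbhs_ballP; exists e => // y; rewrite /ball/= distrC.
  exact: (@proj_continuous R (fun _ => R) r f _ h).
have hit (B : set T) k : nbhs (f : T) B -> exists2 n, (k <= n)%N & B (w n).
  move=> fB.
  pose A : set T := [set g | exists2 n, (k <= n)%N & w n = g].
  have FA : F A by exists k => // n kn; exists n.
  by have [g [[n kn <-] gB]] := clf A B FA fB; exists n.
have fL r s : `|f r - f s| <= `|r - s|.
  apply/ler_addgt0Pr => e e0; have e2 : 0 < e / 2 by rewrite divr_gt0.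
  have [n _ [h1 h2]] := hit _ 0%N (filterI (nb r _ e2) (nb s _ e2)).
  have h3 := wL n r s; move: h1 h2; rewrite /= distrC => h1 h2.
  have -> : f r - f s = (f r - w n r) + (w n s - f s) + (w n r - w n s) by ring.
  rewrite (le_trans (ler_normD _ _))// [leRHS]addrC lerD//.
  by rewrite (le_trans (ler_normD _ _))// (splitr e) lerD// ltW.
pose rho (i : nat) : R := if unpickle i is Some x then ratr (x : rat) else 0.
pose B k n : set T := [set g | forall i, (i < n)%N -> `|g (rho i) - f (rho i)| < k.+1%:R^-1].
have nB k n : nbhs (f : T) (B k n).
  elim: n => [|n IH]; first by apply: filterS filterT => g _ i.
  have kn : (0 : R) < k.+1%:R^-1 by rewrite invr_gt0.
  apply: filterS (filterI IH (nb (rho n) _ kn)) => g [h1 h2] i.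
  by rewrite ltnS leq_eqVlt => /predU1P[->//|]; exact: h1.
have /boolp.choice[tau tauP] : forall k, exists n, (k <= n)%N /\ B k k (w n).
  by move=> k; have [n ? ?] := hit _ k (nB k k); exists n.
exists tau; split; first by move=> k; have [] := tauP k.
exists f => r; apply/cvgrPdist_lt => e e0; have e3 : 0 < e / 3 by rewrite divr_gt0.
have [x] : exists x : rat, `|r - ratr x| < e / 3.
  have h : r - e / 3 < r + e / 3 by move: e3; lra.
  have [x] := rat_in_itvoo h; rewrite in_itv/= => /andP[h1 h2]; exists x.
  by rewrite ltr_norml; apply/andP; split; lra.
have rx : rho (pickle x) = ratr x by rewrite /rho pickleK.
rewrite -rx => rr.
near=> k.
have k1 : (pickle x < k)%N by near: k; exists (pickle x).+1.
have k2 : (k.+1%:R^-1 : R) < e / 3.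
  near: k; have /cvgrPdist_lt /(_ _ e3) := @cvg_harmonic R.
  by apply: filterS => k; rewrite sub0r normrN ger0_norm// invr_ge0.
have [_ /(_ _ k1) h1] := tauP k.
have h2 := fL r (rho (pickle x)); have h3 := wL (tau k) (rho (pickle x)) r.
have -> : f r - w (tau k) r = (f r - f (rho (pickle x))) +
   (f (rho (pickle x)) - w (tau k) (rho (pickle x))) +
   (w (tau k) (rho (pickle x)) - w (tau k) r) by ring.
rewrite distrC in h1; rewrite [in X in _ <= X]distrC in h3.
rewrite (le_lt_trans (ler_normD _ _))// (_ : e = e / 3 + e / 3 + e / 3); last by lra.
rewrite ltrD//; last exact: le_lt_trans h3 rr.
rewrite (le_lt_trans (ler_normD _ _))// ltrD//; first exact: le_lt_trans h2 rr.
exact: lt_trans h1 k2.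
Unshelve. all: by end_near. Qed.

End compactness.

Section limit_of_profiles.
Context {R : realType}.
Local Notation lam := (@lebesgue_measure R).
Variables (N : nat) (q m : R) (p : nat -> R) (w : nat -> R -> R) (W : R -> R).
Hypothesis N0 : (0 < N)%N.
Hypothesis m1 : 1 < m.
Hypothesis mq : m < q.
Hypothesis p1 : forall n, 1 < p n.
Hypothesis pq : forall n, p n < q.
Hypothesis pm : p n @[n --> \oo] --> m.
Hypothesis wP : forall n, @radial_profile R N (p n) q (w n).
Hypothesis wW : forall r, w n r @[n --> \oo] --> W r.

Let wC n : cone_profile (w n). Proof. by have [] := wP n. Qed.
Let w0 n r : 0 <= w n r. Proof. by have [_ _ h _ _] := wC n. Qed.
Let wJ n : radint N (reaction (p n) q (w n)) 1 = 0. Proof. by have [] := wP n. Qed.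

Let cvg_le (u : nat -> R) (a c : R) : u @ \oo --> a -> (forall n, u n <= c) -> a <= c.
Proof. by move=> ua uc; apply: (ler_cvg_to ua (cvg_cst c)); exact: nearW. Qed.

Let cvg_ge (u : nat -> R) (a c : R) : u @ \oo --> a -> (forall n, c <= u n) -> c <= a.
Proof. by move=> ua uc; apply: (ler_cvg_to (cvg_cst c) ua); exact: nearW. Qed.

Lemma profile_limit_lipschitz r s : `|W r - W s| <= `|r - s|.
Proof.
have h : `|w n r - w n s| @[n --> \oo] --> `|W r - W s|.
  by apply: cvg_norm; apply: cvgB; exact: wW.
apply: (cvg_le h) => n.
exact: (radial_profile_lipschitz N0 (p1 n) (pq n) (wP n)).
Qed.

Let limit_cone : cone_profile W.
Proof.
split.
- move=> r; apply/cvgrPdist_lt => e e0; near=> s.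
  apply: (le_lt_trans (profile_limit_lipschitz r s)).
  by near: s; exact: (@cvgr_dist_lt _ _ _ _ _ _ _ (@cvg_id _ (nbhs r))).
- move=> r s rs; have h1 := @wW r; have h2 := @wW s; apply: (ler_cvg_to h1 h2); apply: nearW => n.
  by have [_ g _ _ _] := wC n; exact: g.
- by move=> r; have h := @wW r; exact: (cvg_ge h).
- move=> r r0; have h := @wW r; apply: (cvg_unique _ h) => //.
  rewrite (_ : (fun n => w n r) = (fun n => w n 0)); first exact: wW.
  by apply/funext => n; have [_ _ _ g _] := wC n; exact: g.
- move=> r r1; have h := @wW r; apply: (cvg_unique _ h) => //.
  rewrite (_ : (fun n => w n r) = (fun n => w n 1)); first exact: wW.
  by apply/funext => n; have [_ _ _ _ g] := wC n; exact: g.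
Unshelve. all: by end_near. Qed.

Let W0 r : 0 <= W r. Proof. by have [] := limit_cone. Qed.

Let reaction_cvg s : reaction (p n) q (w n) s @[n --> \oo] --> reaction m q W s.
Proof.
have m10 : 0 < m - 1 by rewrite subr_gt0.
have q10 : 0 < q - 1 by rewrite subr_gt0 (lt_trans m1).
apply: cvgB; apply: cvg_powR => //; last exact: cvg_cst.
by apply: cvgB; [exact: pm|exact: cvg_cst].
Qed.

Let M : R := 2 * 2 `^ q.

Let reaction_le_M n s : `|reaction (p n) q (w n) s| <= M.
Proof.
have [_ _ /andP[_ w1] _] := wP n.
have w2 := ltW (radial_profile_lt2 N0 (p1 n) (pq n) (wP n) 1).
have q0 : 0 <= q by rewrite ltW// (lt_trans _ mq)// (lt_trans _ m1).
have h a : a <= q -> w n 1 `^ a <= 2 `^ q.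
  move=> aq; apply: (@le_trans _ _ (w n 1 `^ q)); first exact: ler_powR.
  by apply: ge0_ler_powR; rewrite ?nnegrE.
apply: (le_trans (reaction_bound (p1 n) (pq n) (wC n) s)).
rewrite /M (_ : 2 * _ = 2 `^ q + 2 `^ q); last by ring.
have := pq n => pqn.
by apply: lerD; apply: h; lra.
Qed.

Let radint_cvg r :
  radint N (reaction (p n) q (w n)) r @[n --> \oo] --> radint N (reaction m q W) r.
Proof.
have cw n := continuous_weight (N := N) (reaction_continuous (p1 n) (pq n) (wC n)).
have cW := continuous_weight (N := N) (reaction_continuous m1 mq limit_cone).
rewrite /radint; have := @Rintegral_cvg _ _ _ lam `[0, r]%classic (fun n (s : R) => s ^+ N.-1 * reaction (p n) q (w n) s)
  (fun s : R => s ^+ N.-1 * reaction m q W s) (fun s : R => s ^+ N.-1 * M).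
apply.
- exact: measurable_itv.
- by move=> n; apply: measurable_funTS; apply: continuous_measurable_fun; exact: cw.
- by apply: measurable_funTS; apply: continuous_measurable_fun; exact: cW.
- apply: integrable_itv_cc => s; apply: cvgM; last exact: cvg_cst.
  exact: exprn_continuous.
- apply: aeW => s _; apply: cvgM; first exact: cvg_cst.
  exact: reaction_cvg.
- move=> n s; rewrite /= in_itv/= => /andP[s0 _].
  by rewrite normrM ger0_norm ?exprn_ge0// ler_wpM2l ?exprn_ge0.
Qed.

Let limit_balance : radint N (reaction m q W) 1 = 0.
Proof. by have h := @radint_cvg 1; exact: (cvg_cst_eq wJ h). Qed.

Let flux_cvg r : flux N (p n) q (w n) r @[n --> \oo] --> flux N m q W r.
Proof.
apply: cvgM; first exact: cvg_cst.
by apply: cvgM; [exact: radint_cvg|exact: cvg_cst].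
Qed.

(** The slope is an explicit function of m and of an integral of the profile, so
    pointwise convergence of the profiles is enough. *)
Lemma slope_cvg r : slope N (p n) q (w n) r @[n --> \oo] --> slope N m q W r.
Proof.
have r1 : Num.min r 1 <= 1 by rewrite ge_min lexx orbT.
apply: cvg_powR.
- by rewrite invr_gt0 subr_gt0.
- exact: (flux_ge0 m1 mq limit_cone limit_balance).
- by move=> n; exact: (flux_ge0 (p1 n) (pq n) (wC n) (wJ n)).
- exact: flux_cvg.
- apply: cvgV; first by rewrite gt_eqF// subr_gt0.
  by apply: cvgB; [exact: pm|exact: cvg_cst].
Qed.

Let limit_slope_integral a c : a <= c ->
  W c = W a + \int[lam]_(s in `[a, c]) slope N m q W s.
Proof.
move=> ac.
have csn n : continuous (slope N (p n) q (w n)).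
  exact: (slope_continuous N0 (p1 n) (pq n) (wC n) (wJ n)).
have cs := slope_continuous N0 m1 mq limit_cone limit_balance.
have h1 : \int[lam]_(s in `[a, c]) slope N (p n) q (w n) s @[n --> \oo] -->
    \int[lam]_(s in `[a, c]) slope N m q W s.
  have := @Rintegral_cvg _ _ _ lam `[a, c]%classic (fun n (s : R) => slope N (p n) q (w n) s)
    (fun s : R => slope N m q W s) (fun s : R => 1).
  apply.
  - exact: measurable_itv.
  - by move=> n; apply: measurable_funTS; exact: (continuous_measurable_fun (csn n)).
  - by apply: measurable_funTS; exact: (continuous_measurable_fun cs).
  - by apply: (integrable_itv_cc (f := fun=> 1)); exact: cst_continuous.
  - by apply: aeW => s _; exact: slope_cvg.
  - move=> n s _; rewrite ger0_norm ?slope_ge0// ltW//.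
    exact: (slope_lt1 N0 (p1 n) (pq n) (wC n) (wJ n)).
have h2 : (fun n => \int[lam]_(s in `[a, c]) slope N (p n) q (w n) s) =
    (fun n => w n c - w n a).
  apply/funext => n; have [cwn _ _ _ _] := wC n; have [_ _ _ dw] := wP n.
  exact: (RFTC2 ac (csn n) (fun x _ => dw x) (cwn a) (cwn c)).
rewrite h2 in h1.
have h3 : w n c - w n a @[n --> \oo] --> W c - W a by apply: cvgB; exact: wW.
by rewrite (cvg_unique _ h1 h3)// subrKC.
Qed.

(** The equation is integrated once more, W(c) - W(a) = int_a^c slope, which is
    stable under pointwise limits, and differentiated again. *)
Lemma radial_profile_limit : @radial_profile R N m q W.
Proof.
have cs := slope_continuous N0 m1 mq limit_cone limit_balance.
split; [exact: limit_cone|exact: limit_balance| |].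
  apply/andP; have h0 := @wW 0; have h1 := @wW 1; split; [apply: (cvg_le h0)|apply: (cvg_ge h1)] => n;
    by have [_ _ /andP[]] := wP n.
(* Any point to the left of r can serve as the lower limit of integration. *)
move=> r; pose a := r - 1.
have ar : a < r by rewrite /a ltrBlDr ltrDl.
have d1 := is_derive_integral ar cs.
have d2 := is_deriveD (is_derive_cst (W a) r (1 : R)) d1.
rewrite add0r in d2.
apply: near_eq_is_derive d2; near=> y.
rewrite (@limit_slope_integral a y)//.
by near: y; exact: lt_le_nbhsr.
Unshelve. all: by end_near. Qed.

End limit_of_profiles.

(** * Ground states *)

Section ground_states.
Context {R : realType} {N : nat}.
Local Notation E := 'rV[R]_N.
Local Notation mu := (@lebesgue_rV R N).
Hypothesis N0 : (0 < N)%N.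

Let mB := @measurable_oball R N.

Lemma radial_powR_cvg (f_ : nat -> R -> R) (f : R -> R) (a_ : nat -> R) (a C K : R) :
  (forall n, continuous (f_ n)) -> continuous f ->
  (forall n r, 0 <= f_ n r <= C) -> (forall r, 0 <= f r) -> 1 <= C ->
  (forall r, f_ n r @[n --> \oo] --> f r) ->
  0 < a -> (forall n, 0 <= a_ n <= K) -> a_ n @[n --> \oo] --> a ->
  \int[mu]_(x in oball) (f_ n (enorm x) `^ a_ n) @[n --> \oo] -->
  \int[mu]_(x in oball) (f (enorm x) `^ a).
Proof.
move=> cf_ cf fC f0 C1 ff a0 aK aa.
have mp (g : R -> R) (e : R) : continuous g ->
    measurable_fun oball (fun x : E => g (enorm x) `^ e).
  move=> cg; apply: (measurableT_comp (@measurable_powR R e)).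
  by apply: measurable_radial; exact: continuous_measurable_fun.
apply: (Rintegral_cvg (g := fun _ : E => C `^ K)) => //.
- by move=> n; exact: mp.
- exact: mp.
- apply: (@integrable_bounded _ _ _ _ _ _ `|C `^ K|) => //; exact: oball_finite.
- apply: aeW => x _; apply: cvg_powR => // n.
  by case/andP: (fC n (enorm x)).
- move=> n x _; rewrite ger0_norm ?powR_ge0//.
  have /andP[fn0 fnC] := fC n (enorm x); have /andP[an0 anK] := aK n.
  apply: (@le_trans _ _ (C `^ a_ n)); last exact: ler_powR.
  by apply: ge0_ler_powR; rewrite ?nnegrE// (le_trans fn0).
Qed.

Lemma radial_integral_gt0 (f : R -> R) : continuous f -> (forall r, 0 <= f r) ->
  0 < f 1 -> 0 < \int[mu]_(x in oball) f (enorm x).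
Proof.
move=> cf f0 f1; rewrite lt_neqAle eq_sym; apply/andP; split; last first.
  by apply: Rintegral_ge0 => x _; exact: f0.
apply/eqP => h.
have /(radial_ae_eq0 N0 cf)/(_ 1) : {ae mu, forall x : E, oball x -> f (enorm x) = 0}.
  by apply: Rintegral_eq0_ae => //; exact: radial_integrable.
by rewrite ler01 lexx => /(_ isT) e; move: f1; rewrite e ltxx.
Qed.

Definition powR_norm (W h : R -> R) (m : R) : R :=
  \int[mu]_(x in oball) (h (enorm x) `^ m + W (enorm x) `^ m).
Definition powR_mass (W : R -> R) (q : R) : R :=
  \int[mu]_(x in oball) (W (enorm x) `^ q).

Lemma powR_mass_gt0 (W h : R -> R) (q : R) : 0 < q -> C1_profile W h -> 0 < W 1 ->
  0 < powR_mass W q.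
Proof.
move=> q0 [[cW _ W0 _ _] _ _ _ _] W1.
apply: (radial_integral_gt0 (f := fun r => W r `^ q)).
- exact: continuous_powR_comp.
- by move=> r; exact: powR_ge0.
- exact: powR_gt0.
Qed.

Lemma powR_norm_gt0 (W h : R -> R) (m : R) : 0 < m -> C1_profile W h -> 0 < W 1 ->
  0 < powR_norm W h m.
Proof.
move=> m0 [[cW _ W0 _ _] ch _ h0 _] W1.
apply: (radial_integral_gt0 (f := fun r => h r `^ m + W r `^ m)).
- by move=> r; apply: cvgD; apply: continuous_powR_comp.
- by move=> r; rewrite addr_ge0 ?powR_ge0.
- by rewrite ltr_wpDl ?powR_ge0// powR_gt0.
Qed.

Section one_exponent.
Variables (m q l : R) (u : E -> R) (W : R -> R).
Hypothesis m1 : 1 < m.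
Hypothesis mq : m < q.
Hypothesis uW : has_profile u W.
Hypothesis WP : @radial_profile R N m q W.

Let m0 : 0 < m. Proof. exact: lt_trans m1. Qed.
Let q0 : 0 < q. Proof. exact: lt_trans mq. Qed.

Lemma coef_gt0 : 0 < m^-1 - q^-1.
Proof. by rewrite subr_gt0 ltf_pV2// posrE. Qed.

Lemma radial_profile_energy : energy m q l u = (m^-1 - q^-1) * powR_mass W q.
Proof.
apply: (energy_profile (radial_profile_C1 N0 m1 mq WP) uW l m1 mq).
  exact: (radial_profile_le_s0 N0 m1 mq WP).
exact: (radial_profile_nehari N0 m1 mq WP).
Qed.

(** A ground state has the least energy on the Nehari set, which contains the
    multiple t V(|x|) of every competitor, for this value of t. *)
Lemma ground_state_le (V h : R -> R) (t : R) : ground_state m q l u ->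
  C1_profile V h -> 0 < V 1 ->
  t = (powR_norm V h m / powR_mass V q) `^ (q - m)^-1 ->
  t * V 1 <= s0 m q -> powR_mass W q <= t `^ q * powR_mass V q.
Proof.
move=> [_ gu] VC V1 tE ts.
have S0 := powR_norm_gt0 m0 VC V1; have Q0 := powR_mass_gt0 q0 VC V1.
have t_gt0 : 0 < t by rewrite tE powR_gt0// divr_gt0.
have t0 := ltW t_gt0.
have [[cV _ V0 _ _] ch _ h0 _] := VC.
have tq : t `^ q = t `^ m * (powR_norm V h m / powR_mass V q).
  have -> : powR_norm V h m / powR_mass V q = t `^ (q - m).
    rewrite tE -powRrM mulVf ?powRr1 ?divr_ge0 ?(ltW S0) ?(ltW Q0)//.
    by rewrite gt_eqF// subr_gt0.
  by rewrite -powRD ?subrKC// (gt_eqF t_gt0) implybT.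
have VZ := C1_profileZ VC t0.
pose v (x : E) := t * V (enorm x).
have vp : has_profile v (fun r => t * V r) by apply: aeW.
have iV := radial_powR_integrable (N := N) m0 cV V0.
have ih := radial_powR_integrable (N := N) m0 ch h0.
have iq := radial_powR_integrable (N := N) q0 cV V0.
have e1 : \int[mu]_(x in oball) ((t * h (enorm x)) `^ m + (t * V (enorm x)) `^ m) =
    t `^ m * powR_norm V h m.
  under eq_Rintegral do rewrite !powRM// -mulrDr.
  by rewrite RintegralZl//; exact: RintegrableD.
have e2 : \int[mu]_(x in oball) ((t * V (enorm x)) `^ q) = t `^ q * powR_mass V q.
  under eq_Rintegral do rewrite powRM//.
  by rewrite RintegralZl.
have neh : \int[mu]_(x in oball) ((t * h (enorm x)) `^ m + (t * V (enorm x)) `^ m) =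
    \int[mu]_(x in oball) ((t * V (enorm x)) `^ q).
  by rewrite e1 e2 tq; field; rewrite gt_eqF.
have vn : nehari m q l v.
  apply: (nehari_profile N0 VZ vp l m1 mq ts neh); first by rewrite mulr_gt0.
  by apply: (C1_in_cone VZ); exact: ltW.
have : ((energy m q l u)%:E <= (energy m q l v)%:E)%E.
  rewrite gu; apply: ereal_inf_lbound.
  exact: (ex_intro2 _ _ v vn erefl).
rewrite lee_fin radial_profile_energy (energy_profile VZ vp l m1 mq ts neh).
by rewrite ler_pM2l ?coef_gt0// e2.
Qed.

End one_exponent.

(** The energy of a solution is a multiple of its mass, so the competitor W is at
    the ground level as soon as its mass does not exceed that of V. *)
Lemma ground_state_of_mass (m q l : R) (u : E -> R) (W V : R -> R) :
  1 < m -> m < q -> has_profile u V -> @radial_profile R N m q V ->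
  ground_state m q l u -> @radial_profile R N m q W -> 0 < W 0 ->
  powR_mass W q <= powR_mass V q -> ground_state m q l (fun x : E => W (enorm x)).
Proof.
move=> m1 mq uV VP [_ gu] WP W0 WV.
have Ws : cone_solution m q (fun x : E => W (enorm x)).
  exact: (radial_profile_solution N0 m1 mq WP).
have WW : has_profile (fun x : E => W (enorm x)) W by apply: aeW.
split; first exact: Ws.
apply/eqP; rewrite eq_le; apply/andP; split; last first.
  apply: ereal_inf_lbound; exists (fun x : E => W (enorm x)) => //.
  apply: (nehari_profile N0 (radial_profile_C1 N0 m1 mq WP) WW l m1 mq).
  - exact: (radial_profile_le_s0 N0 m1 mq WP).
  - exact: (radial_profile_nehari N0 m1 mq WP).
  - exact: (radial_profile_gt0 WP).
  - by have [] := Ws.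
rewrite -gu lee_fin (radial_profile_energy l m1 mq uV VP).
by rewrite (radial_profile_energy l m1 mq WW WP) ler_pM2l// coef_gt0.
Qed.

End ground_states.

(** * Convergence of the profiles *)

Section convergence_of_profiles.
Context {R : realType} {N : nat}.
Local Notation E := 'rV[R]_N.
Local Notation mu := (@lebesgue_rV R N).
Hypothesis N0 : (0 < N)%N.
Variables (q m : R).
Hypothesis m1 : 1 < m.
Hypothesis mq : m < q.

Let mB := @measurable_oball R N.
Let m0 : 0 < m. Proof. exact: lt_trans m1. Qed.
Let q0 : 0 < q. Proof. exact: lt_trans mq. Qed.

Lemma powR_norm_cvg (V h : R -> R) (p : nat -> R) : C1_profile V h ->
  (forall r, V r <= 2) -> (forall r, h r <= 2) ->
  (forall n, 0 < p n < q) -> p n @[n --> \oo] --> m ->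
  powR_norm (N := N) V h (p n) @[n --> \oo] --> powR_norm (N := N) V h m.
Proof.
move=> [[cV _ V0 _ _] ch _ h0 _] V2 h2 pq pm.
have split_norm a : 0 < a -> powR_norm (N := N) V h a =
    \int[mu]_(x in oball) (h (enorm x) `^ a) + \int[mu]_(x in oball) (V (enorm x) `^ a).
  by move=> a0; rewrite /powR_norm RintegralD//; exact: radial_powR_integrable.
have -> : (fun n => powR_norm (N := N) V h (p n)) = (fun n =>
    \int[mu]_(x in oball) (h (enorm x) `^ p n) + \int[mu]_(x in oball) (V (enorm x) `^ p n)).
  by apply/funext => n; rewrite split_norm//; case/andP: (pq n).
rewrite split_norm//; have pq' n : 0 <= p n <= q by have /andP[/ltW -> /ltW ->] := pq n.
apply: cvgD.
  apply: (@radial_powR_cvg R N (fun=> h) h p m 2 q) => //.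
  - by move=> n r; rewrite h0 h2.
  - by rewrite ler1n.
  - by move=> r; exact: cvg_cst.
apply: (@radial_powR_cvg R N (fun=> V) V p m 2 q) => //.
- by move=> n r; rewrite V0 V2.
- by rewrite ler1n.
- by move=> r; exact: cvg_cst.
Qed.

(** A multiple t_n V with t_n -> 1 lies on the n-th Nehari set, so the mass of V
    bounds those of the n-th ground states in the limit. *)
Lemma limit_mass_le (p l : nat -> R) (u : nat -> E -> R) (w : nat -> R -> R) (V W : R -> R) :
  (forall n, 1 < p n) -> (forall n, p n < q) -> p n @[n --> \oo] --> m ->
  (forall n, ground_state (p n) q (l n) (u n)) ->
  (forall n, @radial_profile R N (p n) q (w n)) -> (forall n, has_profile (u n) (w n)) ->
  @radial_profile R N m q V -> (forall r, w n r @[n --> \oo] --> W r) -> continuous W ->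
  powR_mass (N := N) W q <= powR_mass (N := N) V q.
Proof.
move=> p1 pq pm gs wP uw VP wW cW.
have VC := radial_profile_C1 N0 m1 mq VP; have V1 := radial_profile_gt0 VP.
pose h := slope N m q V; pose Q := powR_mass (N := N) V q.
have Q0 : 0 < Q := powR_mass_gt0 N0 q0 VC V1.
pose t n := (powR_norm (N := N) V h (p n) / Q) `^ (q - p n)^-1.
have p0 n : 0 < p n by rewrite (lt_trans _ (p1 n)).
have w02 n r : 0 <= w n r <= 2.
  have [[_ _ w0 _ _] _ _ _] := wP n; rewrite w0/=.
  by rewrite ltW// (radial_profile_lt2 N0 (p1 n) (pq n) (wP n)).
have cvg_norm_ : powR_norm (N := N) V h (p n) @[n --> \oo] --> Q.
  have <- : powR_norm (N := N) V h m = Q by exact: (radial_profile_nehari N0 m1 mq VP).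
  apply: powR_norm_cvg => //.
  - by move=> r; rewrite ltW// (radial_profile_lt2 N0 m1 mq VP).
  - have [cV J1 _ _] := VP; move=> r.
    by rewrite ltW// (lt_le_trans (slope_lt1 N0 m1 mq cV J1 r))// ler1n.
  - by move=> n; rewrite p0 pq.
have t1 : t n @[n --> \oo] --> (1 : R).
  rewrite -(powR1r (q - m)^-1); apply: cvg_powR => //.
  - by rewrite invr_gt0 subr_gt0.
  - by move=> n; rewrite divr_ge0 ?(ltW Q0)// ltW// (powR_norm_gt0 N0 (p0 n) VC V1).
  - rewrite -[X in _ --> X](mulfV (lt0r_neq0 Q0)).
    by apply: cvgM; [exact: cvg_norm_|exact: cvg_cst].
  - apply: cvgV; first by rewrite gt_eqF// subr_gt0.
    by apply: cvgB; [exact: cvg_cst|exact: pm].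
have W0 r : 0 <= W r.
  have wr := @wW r; apply: (cvgr_to_ge wr); apply: nearW => n.
  by case/andP: (w02 n r).
have mass_cvg : powR_mass (N := N) (w n) q @[n --> \oo] --> powR_mass (N := N) W q.
  apply: (@radial_powR_cvg R N w W (fun=> q) q 2 q) => //.
  - by move=> n; have [[]] := wP n.
  - by rewrite ler1n.
  - by move=> n; rewrite lexx ltW.
  - exact: cvg_cst.
have bound_cvg : t n `^ q * Q @[n --> \oo] --> Q.
  rewrite -[X in _ --> X]mul1r -(powR1r q); apply: cvgM; last exact: cvg_cst.
  apply: cvg_powR => //; last exact: cvg_cst.
  by move=> n; exact: powR_ge0.
apply: (ler_cvg_to mass_cvg bound_cvg).
have tV : t n * V 1 @[n --> \oo] --> V 1.
  by rewrite -[X in _ --> X]mul1r; apply: cvgM; [exact: t1|exact: cvg_cst].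
have V2 : V 1 < 2 by exact: (radial_profile_lt2 N0 m1 mq VP).
near=> n; have tn : t n * V 1 <= 2 by near: n; exact: (cvgr_le _ tV).
apply: (ground_state_le N0 (p1 n) (pq n) (uw n) (wP n) (gs n) VC V1) => //.
by rewrite (le_trans tn)// ltW// s0_gt2.
Unshelve. all: by end_near. Qed.

End convergence_of_profiles.

Section full_sequence.
Context {R : realType} {N : nat}.
Local Notation E := 'rV[R]_N.
Local Notation mu := (@lebesgue_rV R N).
Hypothesis N0 : (0 < N)%N.
Variables (q l2 : R) (u2 : E -> R) (V : R -> R).
Hypothesis q2 : 2 < q.
Hypothesis gs2 : ground_state 2 q l2 u2.
Hypothesis uV : has_profile u2 V.
Hypothesis VP : @radial_profile R N 2 q V.
Hypothesis unique : forall v : E -> R, ground_state 2 q l2 v ->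
  v = u2 %[ae mu in oball].

Let two1 : (1 : R) < 2. Proof. by rewrite ltr1n. Qed.

Lemma limit_profile_eq (p l : nat -> R) (u : nat -> E -> R) (w : nat -> R -> R) (W : R -> R) :
  (forall n, 1 < p n) -> (forall n, p n < q) -> p n @[n --> \oo] --> (2 : R) ->
  (forall n, ground_state (p n) q (l n) (u n)) ->
  (forall n, @radial_profile R N (p n) q (w n)) -> (forall n, has_profile (u n) (w n)) ->
  (forall r, w n r @[n --> \oo] --> W r) -> W = V.
Proof.
move=> p1 pq pm gs wP uw wW.
have WP := radial_profile_limit N0 two1 q2 p1 pq pm wP wW.
have [[cW _ _ W_0 W_1] _ _ _] := WP; have [[cV _ _ V_0 V_1] _ _ _] := VP.
have WV := limit_mass_le N0 two1 q2 p1 pq pm gs wP uw VP wW cW.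
have W0 := radial_profile2_gt0 N0 q2 WP.
have gW := ground_state_of_mass N0 two1 q2 uV VP gs2 WP W0 WV.
have cWV : continuous (fun r => W r - V r).
  by move=> r; apply: cvgB; [exact: cW|exact: cV].
have e r : 0 <= r <= 1 -> W r = V r.
  move=> r01; apply/eqP; rewrite -subr_eq0; apply/eqP.
  apply: (radial_ae_eq0 N0 cWV) r01.
  apply: filterS2 (unique gW) uV => x h1 h2 xB.
  by rewrite h1// h2// subrr.
apply/funext => r; have [r0|r0] := leP r 0.
  by rewrite W_0// V_0// e// lexx ler01.
have [r1|r1] := leP 1 r; first by rewrite W_1// V_1// e// lexx ler01.
by rewrite e// (ltW r0) (ltW r1).
Qed.

Lemma ge_id_cvg (s : nat -> nat) (f : nat -> R) (a : R) : (forall k, (k <= s k)%N) ->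
  f n @[n --> \oo] --> a -> f (s k) @[k --> \oo] --> a.
Proof.
move=> ks /cvgrPdist_lt fa; apply/cvgrPdist_lt => e e0.
have [n _ hn] := fa e e0; exists n => // k /= nk.
by apply: hn => /=; exact: leq_trans (ks k).
Qed.

(** A subsequence that stays away from V at some point would have a further
    subsequence with a limit, which is V by uniqueness. *)
Lemma profile_cvg (p l : nat -> R) (u : nat -> E -> R) (w : nat -> R -> R) :
  (forall n, 1 < p n) -> (forall n, p n < q) -> p n @[n --> \oo] --> (2 : R) ->
  (forall n, ground_state (p n) q (l n) (u n)) ->
  (forall n, @radial_profile R N (p n) q (w n)) -> (forall n, has_profile (u n) (w n)) ->
  forall r, w n r @[n --> \oo] --> V r.
Proof.
move=> p1 pq pm gs wP uw r; apply: contrapT => nwV.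
have [e e0 far] : exists2 e : R, 0 < e & forall k, exists n, (k <= n)%N /\ e <= `|V r - w n r|.
  apply: contrapT => h; apply: nwV; apply/cvgrPdist_lt => e e0.
  apply: contrapT => h2; apply: h; exists e => // k.
  apply: contrapT => h3; apply: h2; exists k => // n kn /=.
  by rewrite ltNge; apply/negP => h4; apply: h3; exists n.
have [s sP] := boolp.choice far.
have w02 n t : 0 <= w n t <= 2.
  have [[_ _ w0 _ _] _ _ _] := wP n; rewrite w0/=.
  by rewrite ltW// (radial_profile_lt2 N0 (p1 n) (pq n) (wP n)).
have wL n t t' : `|w n t - w n t'| <= `|t - t'|.
  exact: (radial_profile_lipschitz N0 (p1 n) (pq n) (wP n)).
have [tau [kt [W wW]]] := lipschitz_subsequence (fun k => w02 (s k)) (fun k => wL (s k)).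
have kst k : (k <= s (tau k))%N by rewrite (leq_trans (kt k))//; have [] := sP (tau k).
have WV : W = V.
  have pst : p (s (tau k)) @[k --> \oo] --> (2 : R) by apply: ge_id_cvg kst pm.
  exact: (@limit_profile_eq (fun k => p (s (tau k))) (fun k => l (s (tau k)))
    (fun k => u (s (tau k))) (fun k => w (s (tau k))) W (fun k => p1 _) (fun k => pq _) pst
    (fun k => gs _) (fun k => wP _) (fun k => uw _) wW).
rewrite WV in wW; have /cvgrPdist_lt/(_ e e0) := @wW r.
move=> [k _ /(_ k (leqnn k))] /=; rewrite ltNge => /negP; apply.
by have [] := sP (tau k).
Qed.

End full_sequence.

(** * Convergence in Sobolev and Hoelder norms *)

Section norms_of_radial_functions.
Context {R : realType} {N : nat}.
Local Notation E := 'rV[R]_N.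
Local Notation mu := (@lebesgue_rV R N).
Hypothesis N0 : (0 < N)%N.

Let mB := @measurable_oball R N.

(** By the common Lipschitz constant it suffices to control the functions at the
    points of a fine finite grid. *)
Lemma uniform_cvg_lipschitz (z : nat -> R -> R) :
  (forall n r s, `|z n r - z n s| <= 2 * `|r - s|) ->
  (forall r, z n r @[n --> \oo] --> (0 : R)) ->
  forall e, 0 < e -> \forall n \near \oo, forall r, 0 <= r <= 1 -> `|z n r| <= e.
Proof.
move=> zL z0 e e0; have e3 : 0 < e / 3 by rewrite divr_gt0.
have /cvgrPdist_lt/(_ _ e3)[K _ /(_ K (leqnn K))] := @cvg_harmonic R.
rewrite /= sub0r normrN ger0_norm ?invr_ge0// => Ke.
have K0 : (0 : R) < K.+1%:R by [].
have grid M : \forall n \near \oo, forall j, (j < M)%N -> `|z n (j%:R / K.+1%:R)| <= e / 3.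
  elim: M => [|M IH]; first exact: nearW.
  have /cvgr0Pnorm_le/(_ _ e3) h := @z0 (M%:R / K.+1%:R).
  apply: filterS2 IH h => n h1 h2 j.
  by rewrite ltnS leq_eqVlt => /predU1P[->//|]; exact: h1.
apply: filterS (grid K.+2) => n hn r /andP[r0 r1].
have kr0 : 0 <= K.+1%:R * r by rewrite mulr_ge0.
have /andP[j1 j2] := truncn_itv kr0.
set j := Num.truncn _ in j1 j2 *.
have jK : (j < K.+2)%N.
  by rewrite ltnS -(ler_nat R) (le_trans j1)// ger_pMr.
have h1 := hn j jK; have h2 := zL n r (j%:R / K.+1%:R).
have h3 : `|r - j%:R / K.+1%:R| <= K.+1%:R^-1.
  have -> : r - j%:R / K.+1%:R = (K.+1%:R * r - j%:R) / K.+1%:R.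
    by rewrite mulrBl mulrAC mulfV ?mul1r// gt_eqF.
  rewrite ger0_norm ?divr_ge0 ?subr_ge0// ler_pdivrMr// mulVf ?gt_eqF//.
  by rewrite lerBlDl natr1 ltW.
have -> : z n r = (z n r - z n (j%:R / K.+1%:R)) + z n (j%:R / K.+1%:R) by rewrite subrK.
rewrite (le_trans (ler_normD _ _))//.
have -> : e = 2 * (e / 3) + e / 3 by field.
apply: lerD => //; apply: (le_trans h2); rewrite ler_pM2l//.
by rewrite (le_trans h3)// ltW.
Qed.

Lemma holder_norm_ge0 (b : R) (f : E -> R) : (0 <= holder_norm b f)%E.
Proof.
apply: adde_ge0.
  apply: (@le_trans _ _ (`|f 0|%:E)); first by rewrite lee_fin.
  by apply: ereal_sup_ubound; exists 0 => //; rewrite /cball/= enorm0.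
pose e : E := delta_mx ord0 (Ordinal N0).
have ee : enorm e = 1.
  rewrite /enorm /dotv (bigD1 (Ordinal N0))//= big1 ?addr0.
    by rewrite !mxE !eqxx mulr1 sqrtr1.
  by move=> i i0; rewrite mxE eqxx/= (negbTE i0) mul0r.
apply: (@le_trans _ _ (`|f 0 - f e| / enorm (0 - e) `^ b)%:E).
  by rewrite lee_fin divr_ge0// powR_ge0.
apply: ereal_sup_ubound; exists (0, e) => //=; split; rewrite /cball/= ?enorm0 ?ee//.
by apply/eqP => e0; move: ee; rewrite -e0 enorm0 => /eqP; rewrite eq_sym oner_eq0.
Qed.

(** Interpolation between the sup norm and the Lipschitz constant. *)
Lemma holder_norm_radial_le (b : R) (f : R -> R) (e : R) : 0 < b < 1 -> 0 < e ->
  (forall r, 0 <= r <= 1 -> `|f r| <= e) ->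
  (forall r s, `|f r - f s| <= 2 * `|r - s|) ->
  (holder_norm b (fun x : E => f (enorm x)) <= (e + 2 * e `^ (1 - b))%:E)%E.
Proof.
move=> /andP[b0 b1] e0 fe fL; have b10 : 0 < 1 - b by rewrite subr_gt0.
have fB (x : E) : cball x -> `|f (enorm x)| <= e.
  by move=> x1; apply: fe; rewrite enorm_ge0.
rewrite EFinD; apply: leeD.
  by apply: ge_ereal_sup => _ [x xB <-]; rewrite lee_fin fB.
apply: ge_ereal_sup => _ [[x y] /= [xB yB xy] <-]; rewrite lee_fin.
have d0 : 0 < enorm (x - y).
  rewrite lt_neqAle enorm_ge0 andbT eq_sym; apply: contra_neq xy => /enorm_eq0/eqP.
  by rewrite subr_eq0 => /eqP.
rewrite ler_pdivrMr ?powR_gt0// -mulrA.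
have fd : `|f (enorm x) - f (enorm y)| <= 2 * enorm (x - y).
  by rewrite (le_trans (fL _ _))// ler_wpM2l// enormB_le.
have powE (s : R) : 0 < s -> s = s `^ (1 - b) * s `^ b.
  by move=> s0; rewrite -powRD ?subrK ?powRr1// ?ltW// (gt_eqF s0) implybT.
have [de|/ltW ed] := leP (enorm (x - y)) e.
  rewrite (le_trans fd)// ler_wpM2l// [leLHS]powE// ler_wpM2r ?powR_ge0//.
  by apply: ge0_ler_powR; rewrite ?nnegrE// ltW.
apply: (@le_trans _ _ (2 * e)).
  rewrite (le_trans (ler_normB _ _))// (_ : 2 * e = e + e); last by ring.
  by apply: lerD; exact: fB.
rewrite ler_wpM2l// [leLHS]powE// ler_wpM2l ?powR_ge0//.
by apply: ge0_ler_powR; rewrite ?nnegrE// ltW.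
Qed.

Lemma holder_norm_radial_fin (b : R) (f : R -> R) (e : R) : 0 < b < 1 -> 0 < e ->
  (forall r, 0 <= r <= 1 -> `|f r| <= e) ->
  (forall r s, `|f r - f s| <= 2 * `|r - s|) ->
  (holder_norm b (fun x : E => f (enorm x)) < +oo)%E.
Proof.
by move=> b01 e0 fe fL; rewrite (le_lt_trans (holder_norm_radial_le b01 e0 fe fL))// ltry.
Qed.

Lemma holder_norm_radial_cvg (b : R) (z : nat -> R -> R) : 0 < b < 1 ->
  (forall n r s, `|z n r - z n s| <= 2 * `|r - s|) ->
  (forall r, z n r @[n --> \oo] --> (0 : R)) ->
  holder_norm b (fun x : E => z n (enorm x)) @[n --> \oo] --> 0%E.
Proof.
move=> b01 zL z0; have /andP[b0 b1] := b01; have b10 : 0 < 1 - b by rewrite subr_gt0.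
have near_le e : 0 < e -> \forall n \near \oo,
    (holder_norm b (fun x : E => z n (enorm x)) <= (e + 2 * e `^ (1 - b))%:E)%E.
  move=> e0; apply: filterS (uniform_cvg_lipschitz zL z0 e0) => n hn.
  exact: holder_norm_radial_le.
apply/fine_cvgP; split.
  apply: filterS (near_le 1 ltr01) => n hn.
  by rewrite ge0_fin_numE ?holder_norm_ge0// (le_lt_trans hn)// ltry.
(* With this e both terms of the bound e + 2 e^(1 - b) are at most d / 2. *)
apply/cvgr0Pnorm_le => d d0; pose e := Num.min (d / 2) ((d / 4) `^ (1 - b)^-1).
have e0 : 0 < e by rewrite lt_min divr_gt0//= powR_gt0// divr_gt0.
apply: filterS (near_le e e0) => n hn /=.
rewrite ger0_norm ?fine_ge0 ?holder_norm_ge0//.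
apply: (@le_trans _ _ (e + 2 * e `^ (1 - b))).
  by rewrite -lee_fin fineK// ge0_fin_numE ?holder_norm_ge0// (le_lt_trans hn)// ltry.
have e1 : e <= d / 2 by rewrite ge_min lexx.
have e2 : e `^ (1 - b) <= d / 4.
  have -> : d / 4 = ((d / 4) `^ (1 - b)^-1) `^ (1 - b).
    by rewrite -powRrM mulVf ?gt_eqF// powRr1// divr_ge0// ltW.
  apply: ge0_ler_powR; rewrite ?nnegrE ?powR_ge0 ?(ltW e0) ?(ltW b10)//.
  by rewrite ge_min lexx orbT.
by lra.
Qed.

Lemma W1_profile (m a : R) (u : E -> R) (W h : R -> R) : 0 <= a -> W1 m u ->
  C1_profile W h -> has_profile u W -> W1 a u.
Proof.
move=> a0 [[mu_ _] _] WC uW; have [[mW Wa] [g [Wg ga]]] := C1_W1 (N := N) WC a0.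
split.
  split; first exact: mu_.
  rewrite (@ae_integral _ _ _ mu _ _ (fun x => (`|W (enorm x)| `^ a)%:E)); first exact: Wa.
  by apply: filterS uW => x e xB; rewrite e.
exists g; split => //; apply: weak_gradient_ae Wg.
by apply: filterS uW => x e xB; rewrite e.
Qed.

Lemma W1norm_radial_cvg (m : R) (v : nat -> E -> R) (z h : nat -> R -> R) (C : R) : 0 < m ->
  1 <= C -> (forall n, v n = (fun x => z n (enorm x)) %[ae mu in oball]) ->
  (forall n, continuous (h n)) -> (forall n, h n 0 = 0) ->
  (forall n r, is_derive r (1 : R) (z n) (h n r)) ->
  (forall n r, `|z n r| <= C) -> (forall n r, `|h n r| <= C) ->
  (forall r, z n r @[n --> \oo] --> (0 : R)) -> (forall r, h n r @[n --> \oo] --> (0 : R)) ->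
  W1norm m (v n) @[n --> \oo] --> (0 : R).
Proof.
move=> m0 C1 vz ch h0 zh zC hC z_0 h_0.
have cz n : continuous (z n) by move=> r; exact: is_derive_continuous (zh n r).
have zg n : weak_gradient (v n) (radial_field (h n)).
  apply: weak_gradient_ae (weak_gradient_radial (ch n) (h0 n) (zh n)).
  by apply: filterS (vz n) => x e xB; rewrite e.
have cn (f : R -> R) : continuous f -> continuous (fun r => `|f r|).
  by move=> cf r; apply: cvg_norm; exact: cf.
have ip (f : R -> R) : continuous f ->
    mu.-integrable oball (EFin \o (fun x : E => `|f (enorm x)| `^ m)).
  by move=> cf; apply: (radial_powR_integrable (f := fun r => `|f r|)) => //; exact: cn.
have nE n : W1norm m (v n) = (\int[mu]_(x in oball) (`|h n (enorm x)| `^ m) +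
    \int[mu]_(x in oball) (`|z n (enorm x)| `^ m)) `^ m^-1.
  rewrite /W1norm; congr (_ `^ _); rewrite -(RintegralD mB (ip _ (ch n)) (ip _ (cz n))).
  apply: ae_Rintegral; apply: filterS2 (wgrad_ae (zg n)) (vz n) => x e1 e2 xB.
  by rewrite e1// e2// enorm_radial_field// h0.
have i0 (f : nat -> R -> R) : (forall n, continuous (f n)) -> (forall n r, `|f n r| <= C) ->
    (forall r, f n r @[n --> \oo] --> (0 : R)) ->
    \int[mu]_(x in oball) (`|f n (enorm x)| `^ m) @[n --> \oo] --> (0 : R).
  move=> cf fC f0.
  have -> : (0 : R) = \int[mu]_(x in oball) ((0 : R) `^ m).
    by rewrite powR0 ?gt_eqF// Rintegral_cst// mul0r.
  apply: (@radial_powR_cvg R N (fun n r => `|f n r|) (fun=> 0) (fun=> m) m C m) => //.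
  - by move=> n; exact: cn.
  - exact: cst_continuous.
  - by move=> n r; rewrite normr_ge0 fC.
  - by move=> r; rewrite -(normr0 R); apply: cvg_norm; exact: f0.
  - by move=> n; rewrite lexx ltW.
  - exact: cvg_cst.
under eq_fun do rewrite nE.
rewrite -(@powR0 R m^-1) ?invr_eq0 ?gt_eqF//; apply: cvg_powR => //.
- by rewrite invr_gt0.
- by move=> n; rewrite addr_ge0// Rintegral_ge0// => x _; exact: powR_ge0.
- by rewrite -[X in _ --> X]addr0; apply: cvgD; exact: i0.
- exact: cvg_cst.
Qed.

End norms_of_radial_functions.

(** * Convergence of the ground states *)

Lemma normB_le_max (R : realDomainType) (a b c : R) :
  0 <= a <= c -> 0 <= b <= c -> `|a - b| <= c.
Proof.
move=> /andP[a0 ac] /andP[b0 bc]; rewrite ler_norml; apply/andP; split; lra.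
Qed.

Theorem corollary1p3 (R : realType) (N : nat) (q : R)
    (p : nat -> R) (l : nat -> R) (l2 : R)
    (u : nat -> 'rV[R]_N -> R) (u2 : 'rV[R]_N -> R) :
  (1 <= N)%N ->
  (forall n, 1 < p n) -> p n @[n --> \oo] --> (2 : R) ->
  2 < q -> (forall n, p n < q) ->
  2 < l2 -> (l2%:E < critical_exponent N 2)%E ->
  (forall n, p n < l n) ->
  (forall n, ((l n)%:E < critical_exponent N (p n))%E) ->
  (forall n, ground_state (p n) q (l n) (u n)) ->
  ground_state 2 q l2 u2 ->
  (forall v : 'rV[R]_N -> R, ground_state 2 q l2 v ->
     v = u2 %[ae lebesgue_rV N in oball]) ->
  [/\ forall n, W1 2 (u n), W1 2 u2 &
      W1norm 2 (fun x => u n x - u2 x) @[n --> \oo] --> (0 : R)] /\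
  exists (U : nat -> 'rV[R]_N -> R) (U2 : 'rV[R]_N -> R),
    [/\ forall n, {within cball, continuous (U n)},
        {within cball, continuous U2},
        forall n, U n = u n %[ae lebesgue_rV N in oball],
        U2 = u2 %[ae lebesgue_rV N in oball] &
        forall b : R, 0 < b < 1 ->
          [/\ forall n, (holder_norm b (U n) < +oo)%E,
              (holder_norm b U2 < +oo)%E &
              holder_norm b (fun x => U n x - U2 x) @[n --> \oo] --> 0%E]].
Proof.
move=> N0 p1 pm q2 pq _ _ _ _ gs gs2 uniq.
have two1 : (1 : R) < 2 by rewrite ltr1n.
have two0 : (0 : R) < 2 by [].
have prof n : exists W, @radial_profile R N (p n) q W /\ has_profile (u n) W.
  have [W ? ?] := cone_solution_profile N0 (p1 n) (pq n) (proj1 (gs n)).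
  by exists W.
have [w wP] := boolp.choice prof.
have wR n : @radial_profile R N (p n) q (w n) := proj1 (wP n).
have uw n : has_profile (u n) (w n) := proj2 (wP n).
have [V VP uV] := cone_solution_profile N0 two1 q2 (proj1 gs2).
have wV := profile_cvg N0 q2 gs2 uV VP uniq p1 pq pm gs wR uw.
have sV := slope_cvg N0 two1 q2 p1 pq pm wR wV.
have wC n := radial_profile_C1 N0 (p1 n) (pq n) (wR n).
have VC := radial_profile_C1 N0 two1 q2 VP.
have wL n := radial_profile_lipschitz N0 (p1 n) (pq n) (wR n).
have VL := radial_profile_lipschitz N0 two1 q2 VP.
have w2 n := radial_profile_lt2 N0 (p1 n) (pq n) (wR n).
have V2 := radial_profile_lt2 N0 two1 q2 VP.
pose z n r := w n r - V r.
pose h n r := slope N (p n) q (w n) r - slope N 2 q V r.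
have w0 n r : 0 <= w n r by have [[_ _ h0 _ _] _ _ _ _] := wC n.
have V0 r : 0 <= V r by have [[_ _ h0 _ _] _ _ _ _] := VC.
have z0 r : z n r @[n --> \oo] --> (0 : R).
  by rewrite -(subrr (V r)); apply: cvgB; [exact: wV|exact: cvg_cst].
have h0 r : h n r @[n --> \oo] --> (0 : R).
  by rewrite -(subrr (slope N 2 q V r)); apply: cvgB; [exact: sV|exact: cvg_cst].
have zL n r s : `|z n r - z n s| <= 2 * `|r - s|.
  have -> : z n r - z n s = (w n r - w n s) - (V r - V s) by rewrite /z; ring.
  rewrite (le_trans (ler_normB _ _))// (_ : 2 * _ = `|r - s| + `|r - s|); last by ring.
  by apply: lerD; [exact: wL|exact: VL].
have z2 n r : `|z n r| <= 2.
  by apply: normB_le_max; rewrite ?w0 ?V0 ltW ?w2 ?V2.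
have weak2 (f : R -> R) : (forall r s, `|f r - f s| <= `|r - s|) ->
    forall r s, `|f r - f s| <= 2 * `|r - s|.
  by move=> fL r s; rewrite (le_trans (fL r s))// ler_peMl// ler1n.
have h2 n r : `|h n r| <= 2.
  have [cw Jw _ _] := wR n; have [cV JV _ _] := VP.
  have le2 (x : R) : x < 1 -> x <= 2 by move=> x1; rewrite ltW// (lt_trans x1).
  apply: normB_le_max; rewrite slope_ge0 le2//.
    exact: (slope_lt1 N0 (p1 n) (pq n) cw Jw).
  exact: (slope_lt1 N0 two1 q2 cV JV).
have uz n : (fun x => u n x - u2 x) = (fun x => z n (enorm x)) %[ae lebesgue_rV N in oball].
  by apply: filterS2 (uw n) uV => x e1 e2 xB; rewrite e1// e2.
have cE (f : R -> R) : continuous f -> {within cball, continuous (fun x : 'rV[R]_N => f (enorm x))}.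
  move=> cf; apply: continuous_subspaceT => x.
  by apply: (@continuous_comp _ _ _ (@enorm R N) f); [exact: enorm_continuous|exact: cf].
split.
  split.
  - move=> n; have [[[uW _] _] _ _] := proj1 (gs n).
    by apply: (W1_profile _ uW (wC n) (uw n)); exact: ltW.
  - by have [[[uW _] _] _ _] := proj1 gs2.
  - apply: (W1norm_radial_cvg two0 _ uz _ _ _ z2 h2 z0 h0).
    + by rewrite ler1n.
    + move=> n r; have [_ cw _ _ _] := wC n; have [_ cV _ _ _] := VC.
      by apply: cvgB; [exact: cw|exact: cV].
    + by move=> n; have [_ _ sw _ _] := wC n; have [_ _ sv _ _] := VC; rewrite /h sw sv subrr.
    + by move=> n r; have [_ _ _ _ dw] := wC n; have [_ _ _ _ dV] := VC; have := is_deriveB (dw r) (dV r).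
exists (fun n x => w n (enorm x)), (fun x => V (enorm x)); split.
- by move=> n; apply: cE; have [[]] := wC n.
- by apply: cE; have [[]] := VC.
- by move=> n; apply: filterS (uw n) => x e xB; rewrite e.
- by apply: filterS uV => x e xB; rewrite e.
- move=> b b01.
  split.
  + move=> n; apply: (holder_norm_radial_fin b01 two0) => [r _|].
      by rewrite ger0_norm ?w0// ltW.
    by apply: weak2; exact: wL.
  + apply: (holder_norm_radial_fin b01 two0) => [r _|].
      by rewrite ger0_norm ?V0// ltW.
    by apply: weak2; exact: VL.
  + exact: (holder_norm_radial_cvg N0 b01 zL z0).
Qed.
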